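(* Let $T>0$, and for every $t\in[0,T]$ let $f(t,\cdot)$ and $g(t,\cdot)$ be functions in $L^2(\mathbb{R}^+)$. Let $\{N_s,s\ge 0\}$ be a standard Poisson process and let $\theta\in(0,\pi)\cup(\pi,2\pi)$. Let $W=\{W_s,s\ge0\}$ and $\tilde W=\{\tilde W_s,s\ge0\}$ be independent standard Brownian motions and define $$Y^f=\left\{\int_0^\infty f(t,s)\,\mathrm{d}W_s,\ t\in[0,T]\right\},\qquad \tilde Y^g=\left\{\int_0^\infty g(t,s)\,\mathrm{d}\tilde W_s,\ t\in[0,T]\right\}.$$ For $\varepsilon>0$ define $$Y^f_\varepsilon=\left\{\frac{2}{\varepsilon}\int_0^\infty f(t,s)\cos\left(\theta N_{\frac{2s}{\varepsilon^2}}\right)\mathrm{d}s,\ t\in[0,T]\right\},\qquad \tilde Y^g_\varepsilon=\left\{\frac{2}{\varepsilon}\int_0^\infty g(t,s)\sin\left(\theta N_{\frac{2s}{\varepsilon^2}}\right)\mathrm{d}s,\ t\in[0,T]\right\}.$$ Then, as $\varepsilon\to0$, the finite dimensional distributions of the processes $Y^f_\varepsilon$ and $\tilde Y^g_\varepsilon$ (jointly, i.e. of the pair $(Y^f_\varepsilon,\tilde Y^g_\varepsilon)$) converge in law to the finite dimensional distributions of the independent processes $Y^f$ and $\tilde Y^g$ (i.e. of the pair $(Y^f,\tilde Y^g)$).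
   Context: A standard Poisson process is a Poisson process of intensity $1$ with $N_0=0$. $Y^f_\varepsilon$ and $\tilde Y^g_\varepsilon$ are built from the same Poisson process. The functions $f(t,\cdot),g(t,\cdot)$ are real valued. For each $t$, an integral $\int_0^\infty f(t,s)\cos(\theta N_{2s/\varepsilon^2})\,\mathrm{d}s$ (and similarly with $\sin$ and $g$) is understood as the limit in $L^2(\Omega)$, as $R\to\infty$, of $\int_0^R f(t,s)\cos(\theta N_{2s/\varepsilon^2})\,\mathrm{d}s$; it is the ordinary integral when the kernel is integrable on $\mathbb{R}^+$. *)

(* Defs.v *)
From HB Require Import structures.
From mathcomp Require Import all_boot all_order all_algebra.
From mathcomp Require Import all_classical all_reals all_analysis.

Set Implicit Arguments.
Unset Strict Implicit.
Unset Printing Implicit Defensive.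

Import Order.TTheory GRing.Theory Num.Theory.
Import numFieldNormedType.Exports.

Local Open Scope classical_set_scope.
Local Open Scope ring_scope.

(* Processes indexed by the half line s >= 0 are families indexed by R; their
   values at negative indices are never used. *)

Section independence.
Context (R : realType) (d : measure_display) (Omega : measurableType d).
Context (P : probability Omega R).

(* Taking some B i to be setT gives the product rule for subfamilies. *)
Definition mutually_independent (d' : measure_display) (E : measurableType d')
    (n : nat) (X : 'I_n -> Omega -> E) : Prop :=
  forall B : 'I_n -> set E, (forall i, measurable (B i)) ->
    P (\bigcap_(i in [set: 'I_n]) (X i @^-1` B i)) =
      (\prod_(i < n) P (X i @^-1` B i))%E.

Definition sigma_process (X : R -> Omega -> R) : set (set Omega) :=
  <<s \bigcup_(s in [set s : R | 0 <= s])
        preimage_set_system setT (X s) measurable >>.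

Definition independent_processes (X Y : R -> Omega -> R) : Prop :=
  forall A B, sigma_process X A -> sigma_process Y B ->
    P (A `&` B) = (P A * P B)%E.

End independence.

Section processes.
Context (R : realType) (d : measure_display) (Omega : measurableType d).
Context (P : probability Omega R).

(* The paths are those of a counting process; the truncated subtraction of
   nat is harmless since they are nondecreasing. *)
Record standard_poisson_process (N : R -> Omega -> nat) : Prop := {
  poisson_measurable : forall s, 0 <= s -> measurable_fun setT (N s) ;
  poisson_start : forall w, N 0 w = 0%N ;
  poisson_nondecreasing : forall w s t, 0 <= s -> s <= t ->
    (N s w <= N t w)%N ;
  poisson_right_continuous : forall w s, 0 <= s ->
    N u w @[u --> s^'+] --> N s w ;
  poisson_independent_increments : forall (n : nat) (t : nat -> R),
    0 <= t 0%N -> nondecreasing_seq t ->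
    mutually_independent P
      (fun (i : 'I_n) w => (N (t i.+1) w - N (t i) w)%N) ;
  poisson_increment_law : forall s t (k : nat), 0 <= s -> s < t ->
    P [set w | (N t w - N s w)%N = k] = (poisson_pmf (t - s) k)%:E }.

(* The second parameter of normal_prob is the standard deviation. *)
Record standard_brownian_motion (W : R -> Omega -> R) : Prop := {
  brownian_measurable : forall s, 0 <= s -> measurable_fun setT (W s) ;
  brownian_start : {ae P, forall w, W 0 w = 0} ;
  brownian_continuous :
    {ae P, forall w, {within `[0, +oo[, continuous (fun s => W s w)}} ;
  brownian_independent_increments : forall (n : nat) (t : nat -> R),
    0 <= t 0%N -> nondecreasing_seq t ->
    mutually_independent P (fun (i : 'I_n) w => W (t i.+1) w - W (t i) w) ;
  brownian_increment_law : forall s t (B : set R), 0 <= s -> s < t ->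
    measurable B ->
    P [set w | B (W t w - W s w)] = normal_prob 0 (Num.sqrt (t - s)) B }.

End processes.

Definition L2_halfline (R : realType) (h : R -> R) : Prop :=
  h \_ `[0, +oo[ \in Lfun (@lebesgue_measure R) 2%:E.

Section L2_integrals.
Context (R : realType) (d : measure_display) (Omega : measurableType d).
Context (P : probability Omega R).

Definition L2_cvg (T : Type) (F : set_system T) (Z : T -> Omega -> R)
    (X : Omega -> R) : Prop :=
  X \in Lfun P 2%:E /\
  'N[P]_2%:E[EFin \o (Z r \- X)%R]%E @[r --> F] --> 0%E.

(* A version of the limit in L2(Omega); cst 0 if the limit does not exist. *)
Definition L2_lim (T : Type) (F : set_system T) (Z : T -> Omega -> R) :
    Omega -> R :=
  xget (cst 0) [set X | L2_cvg F Z X].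

(* An item (a, (u, v)) stands for a times the indicator of ]u, v]. *)
Definition step_data := seq (R * (R * R)).

Definition step_wf (p : step_data) : Prop :=
  forall q, q \in p -> 0 <= q.2.1 /\ q.2.1 <= q.2.2.

Definition step_fun (p : step_data) (s : R) : R :=
  \sum_(q <- p) q.1 * \1_(`]q.2.1, q.2.2] : set R) s.

Definition step_integral (W : R -> Omega -> R) (p : step_data) (w : Omega) : R :=
  \sum_(q <- p) q.1 * (W q.2.2 w - W q.2.1 w).

(* X is the value at h of the L2 extension of step_integral. *)
Definition is_wiener_integral (W : R -> Omega -> R) (h : R -> R)
    (X : Omega -> R) : Prop :=
  exists p : nat -> step_data,
    [/\ forall k, step_wf (p k),
        'N[@lebesgue_measure R]_2%:E
          [EFin \o ((step_fun (p k) \- h) \_ `[0, +oo[)%R]%E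
          @[k --> \oo] --> 0%E &
        L2_cvg \oo (fun k => step_integral W (p k)) X].

(* A version of the integral of h over the half line with respect to W. *)
Definition wiener_integral (W : R -> Omega -> R) (h : R -> R) : Omega -> R :=
  xget (cst 0) [set X | is_wiener_integral W h X].

(* A version of the integral of h(s) * psi (theta * N_(2 s / eps^2)) over the
   half line, as the limit in L2(Omega) of the integrals over [0, r]. *)
Definition poisson_integral (N : R -> Omega -> nat) (psi : R -> R)
    (theta eps : R) (h : R -> R) : Omega -> R :=
  L2_lim +oo (fun r w =>
    \int[@lebesgue_measure R]_(s in `[0, r])
      (h s * psi (theta * (N (2 * s / eps ^+ 2) w)%:R))).

Definition kac_stroock (N : R -> Omega -> nat) (psi : R -> R)
    (theta eps : R) (h : R -> R) (w : Omega) : R :=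
  2 / eps * poisson_integral N psi theta eps h w.

End L2_integrals.

Section convergence_in_law.
Context (R : realType).
Context (d : measure_display) (Omega : measurableType d).
Context (P : probability Omega R).
Context (d' : measure_display) (Omega' : measurableType d').
Context (P' : probability Omega' R).

Definition cvg_in_law (E : topologicalType) (T : Type) (F : set_system T)
    (X : T -> Omega -> E) (Y : Omega' -> E) : Prop :=
  forall phi : E -> R, continuous phi ->
    (exists M : R, forall x, `|phi x| <= M) ->
    \int[P]_w phi (X e w) @[e --> F] --> \int[P']_w phi (Y w).

Definition fdd_pair (O : Type) (X Y : R -> O -> R) (n : nat) (t : 'I_n -> R)
    (w : O) : 'rV[R]_n * 'rV[R]_n :=
  (\row_(i < n) X (t i) w, \row_(i < n) Y (t i) w).

Definition fdd_pair_cvg (I : set R) (T : Type) (F : set_system T)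
    (X1 X2 : T -> R -> Omega -> R) (Y1 Y2 : R -> Omega' -> R) : Prop :=
  forall (n : nat) (t : 'I_n -> R), (forall i, I (t i)) ->
    cvg_in_law F (fun e => fdd_pair (X1 e) (X2 e) t) (fdd_pair Y1 Y2 t).

End convergence_in_law.

(* Main.v *)
Require Import Defs.
From mathcomp Require Import all_boot all_order all_algebra.
From mathcomp Require Import all_classical all_reals all_analysis.
From mathcomp Require Import measurable_realfun.
From mathcomp Require Import ring lra.

Set Implicit Arguments.
Unset Strict Implicit.
Unset Printing Implicit Defensive.

Import Order.TTheory GRing.Theory Num.Theory.
Import numFieldNormedType.Exports.

Local Open Scope classical_set_scope.
Local Open Scope ring_scope.

(** Convergence in law of the finite dimensional distributions is reduced to
    that of characteristic functions.  By linearity this means that, for kernels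
    [F] and [G], the real variable
      [2 / eps * \int (F s * cos (theta * N_u) + G s * sin (theta * N_u)) ds],
    where [u = 2 * s / eps ^+ 2], must converge in law to the sum of the Wiener
    integrals of [F] and [G] with respect to [W] and [W'], which is Gaussian
    with variance [\int (F ^+ 2 + G ^+ 2)].  No complex numbers occur: the mean of
    [cos (X + p)] for all phases [p] carries the same information as the
    characteristic function of [X].

    Kernels that are constant on the cells of a regular grid come first.  Up to
    a Riemann sum error that is controlled by the number of jumps
    ([riemann_wave]), the integral is a sum along a Markov chain: the phase
    [theta * N] rotates by [theta] at each jump.  The integrand oscillates with
    mean zero over this rotation, so it has a discrete primitive [wave_prim];
    adding to [cos x] correctors built from primitives ([perturbed]) removes the
    oscillating part of the drift and leaves the decay at rate [rate]
    ([perturbed_step]).  The second corrector oscillates with the angle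
    [2 * theta], and dividing by [sin theta] is what excludes [theta = pi].
    Independence of the increments then multiplies the contributions of
    successive cells ([grid_char], [wave_integral_char]), with an error of order
    [eps].

    General kernels are limits in L2 of such kernels ([grid_fun_dense]).  The
    approximation commutes with [eps -> 0] because the second moment of the
    integral is bounded by a constant times the squared L2 norm of the kernel,
    uniformly in [eps]: the correlation of the integral with the current phase
    decays at rate [1 - cos theta], which a Lyapunov function turns into that
    bound ([lyapunov_step], [grid_L2]).  The same bound makes the integrals over
    [[0, r]] converge in L2 as [r] grows ([poisson_integral_cvg]), so that the
    integrals over the half line are indeed limits and not the default value.

    On the Gaussian side, the variance of an increment follows from comparing
    normal densities ([sqn_normal]), its characteristic function from splitting
    it into many independent increments ([mean_cos_incr]), and the existence of
    the Wiener integral from Ito's isometry ([step_isometry]).  Independence of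
    [W] and [W'] gives the characteristic function of a pair of step integrals
    ([step_integral_char]).

    Finally, characteristic functions determine the limit ([cvg_mean_of_char]).
    Second moments are bounded, so large values contribute little; on a cube a
    continuous function is uniformly approximated by Bernstein polynomials in
    the variables [(1 + sin (x_i / L)) / 2], which are positive averages of its
    values and also trigonometric polynomials ([smooth_approx]). *)

(** * Elementary trigonometric bounds *)

Section trigonometry.
Context (R : realType).
Implicit Types x y : R.

Lemma dist_cos x y : `|cos x - cos y| <= `|x - y|.
Proof.
wlog yx : x y / y <= x => [hw|].
  case: (leP y x) => [/hw//|/ltW/hw h].
  by rewrite -normrN opprB -[leRHS]normrN opprB.
have [|c _ ->] := @MVT_segment R cos (fun z => - sin z) y x yx.
  by apply: continuous_subspaceT => z; exact: continuous_cos.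
by rewrite normrM normrN ler_piMl// sin_max.
Qed.

Lemma dist_sin x y : `|sin x - sin y| <= `|x - y|.
Proof. by rewrite -!cosBpihalf; apply: le_trans (dist_cos _ _) _; rewrite opprB addrA subrK. Qed.

Lemma norm_sin_le x : `|sin x| <= `|x|.
Proof. by have := dist_sin x 0; rewrite sin0 !subr0. Qed.

Lemma cos_half x : cos x = 1 - 2 * sin (x / 2) ^+ 2.
Proof.
rewrite {1}(_ : x = (x / 2) *+ 2); last by rewrite -mulr_natr divfK.
by rewrite cos_mulr2n cos2sin2 -mulr_natl; ring.
Qed.

Lemma norm_subr1_cos x : `|cos x - 1| <= x ^+ 2 / 2.
Proof.
rewrite cos_half addrC addKr normrN normrM normrX ger0_norm//.
have := norm_sin_le (x / 2); rewrite -(ler_pXn2r (n := 2))// ?nnegrE//.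
by rewrite [in leRHS]real_normK ?num_real// expr_div_n; lra.
Qed.

Lemma dist_sin_id x : `|sin x - x| <= `|x| * (x ^+ 2 / 2) /\ `|sin x - x| <= x ^+ 2.
Proof.
have [c cx ->] : exists2 c, `|c| <= `|x| & sin x - x = (cos c - 1) * x.
  have key y : 0 <= y -> exists2 c, `|c| <= `|y| & sin y - y = (cos c - 1) * y.
    move=> y0; have [|c] := @MVT_segment R (fun z => sin z - z) (fun z => cos z - 1) 0 y y0.
      by apply: continuous_subspaceT => z; apply: cvgB; [exact: continuous_sin|exact: cvg_id].
    rewrite in_itv/= => /andP[c0 cy]; rewrite sin0 !subr0 => ->.
    by exists c => //; rewrite !ger0_norm.
  have [x0|/ltW x0] := leP 0 x; first exact: key.
  have [|c cx e] := key (- x); first by rewrite oppr_ge0.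
  exists c; first by rewrite -(normrN x).
  by apply: oppr_inj; rewrite -mulrN -e sinN opprB opprK addrC.
rewrite normrM mulrC; split; first rewrite ler_wpM2l//.
  apply: le_trans (norm_subr1_cos _) _; rewrite ler_pM2r//.
  by rewrite -[leLHS]real_normK ?num_real// -[leRHS]real_normK ?num_real// lerXn2r ?nnegrE.
rewrite -[leRHS]real_normK ?num_real// expr2 ler_wpM2l//.
by have := dist_cos c 0; rewrite cos0 subr0 => /le_trans; apply.
Qed.

Lemma cos_taylor1 x y : `|cos (x + y) - cos x + y * sin x| <= 2 * y ^+ 2.
Proof.
have [_ h1] := dist_sin_id y; have h2 := norm_subr1_cos y.
rewrite cosD [X in `|X|](_ : _ = cos x * (cos y - 1) - sin x * (sin y - y)); last by ring.
apply: le_trans (ler_normB _ _) _; rewrite !normrM.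
have hc := cos_max x; have hs := sin_max x.
have n1 := normr_ge0 (cos y - 1); have n2 := normr_ge0 (sin y - y).
have := ler_pM (normr_ge0 _) n1 hc h2; have := ler_pM (normr_ge0 _) n2 hs h1.
by have := sqr_ge0 y; lra.
Qed.

Lemma sin_taylor1 x y : `|sin (x + y) - sin x - y * cos x| <= 2 * y ^+ 2.
Proof.
have [_ h1] := dist_sin_id y; have h2 := norm_subr1_cos y.
rewrite sinD (_ : _ - _ = sin x * (cos y - 1) + cos x * (sin y - y)); last by ring.
apply: le_trans (ler_normD _ _) _; rewrite !normrM.
have hc := cos_max x; have hs := sin_max x.
have n1 := normr_ge0 (cos y - 1); have n2 := normr_ge0 (sin y - y).
have := ler_pM (normr_ge0 _) n2 hc h1; have := ler_pM (normr_ge0 _) n1 hs h2.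
by have := sqr_ge0 y; lra.
Qed.

(** An even power on the right keeps the proof to even moments, which have no
    cancellations to track. *)
Lemma cos_taylor3 x : `|cos x - 1 + x ^+ 2 / 2| <= x ^+ 4.
Proof.
have [h _] := dist_sin_id (x / 2); have hs := norm_sin_le (x / 2).
rewrite cos_half (_ : _ + _ = - (2 * (sin (x / 2) - x / 2) * (sin (x / 2) + x / 2))); last by field.
rewrite normrN !normrM ger0_norm//.
have := ler_pM (normr_ge0 _) (normr_ge0 _) h (le_trans (ler_normD _ _) (lerD hs (lexx `|x / 2|))).
have [a [ae a2]] : exists a : R, `|x / 2| = a /\ (x / 2) ^+ 2 = a ^+ 2.
  by exists `|x / 2|; rewrite real_normK ?num_real.
rewrite ae a2.
have -> : x ^+ 4 = 16 * (a ^+ 2) ^+ 2 by rewrite -a2; field.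
have -> : a * (a ^+ 2 / 2) * (a + a) = (a ^+ 2) ^+ 2 by field.
have := sqr_ge0 (a ^+ 2); move: (_ ^+ 2 ^+ 2) => b.
by rewrite -mulrA; move: (`|_| * `|_|) => z; lra.
Qed.

End trigonometry.

(** * Means of bounded random variables *)

Section mean.
Context (R : realType) (d : measure_display) (Omega : measurableType d).
Context (P : probability Omega R).
Implicit Types (X Y Z : Omega -> R) (A B : set Omega).

(** All means below are means of bounded variables: these form an algebra, so
    that integrability needs no separate bookkeeping. *)
Definition bounded_rv Y : Prop :=
  measurable_fun setT Y /\ exists M : R, forall w, `|Y w| <= M.

Definition mean Y : R := \int[P]_w Y w.

Lemma bounded_rv_cst (c : R) : bounded_rv (fun=> c).
Proof. by split => //; exists `|c|. Qed.

Lemma bounded_rvD X Y : bounded_rv X -> bounded_rv Y ->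
  bounded_rv (fun w => X w + Y w).
Proof.
move=> [mX [M hM]] [mY [M' hM']]; split; first exact: measurable_funD.
by exists (M + M') => w; rewrite (le_trans (ler_normD _ _))// lerD.
Qed.

Lemma bounded_rvM X Y : bounded_rv X -> bounded_rv Y ->
  bounded_rv (fun w => X w * Y w).
Proof.
move=> [mX [M hM]] [mY [M' hM']]; split; first exact: measurable_funM.
by exists (M * M') => w; rewrite normrM ler_pM.
Qed.

Lemma bounded_rvZ (c : R) Y : bounded_rv Y -> bounded_rv (fun w => c * Y w).
Proof. by apply: bounded_rvM; exact: bounded_rv_cst. Qed.

Lemma bounded_rvB X Y : bounded_rv X -> bounded_rv Y ->
  bounded_rv (fun w => X w - Y w).
Proof.
move=> [mX [M hM]] [mY [M' hM']]; split; first exact: measurable_funB.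
by exists (M + M') => w; rewrite (le_trans (ler_normB _ _))// lerD.
Qed.

Lemma bounded_rv_sum (I : Type) (s : seq I) (F : I -> Omega -> R) :
  (forall i, bounded_rv (F i)) -> bounded_rv (fun w => \sum_(i <- s) F i w).
Proof.
move=> hF; elim: s => [|i s IH].
  by under eq_fun do rewrite big_nil; exact: bounded_rv_cst.
by under eq_fun do rewrite big_cons; exact: bounded_rvD.
Qed.

Lemma bounded_rv_comp (phi : R -> R) (M : R) Y :
  measurable_fun setT phi -> (forall x, `|phi x| <= M) ->
  measurable_fun setT Y -> bounded_rv (fun w => phi (Y w)).
Proof. by move=> mphi hphi mY; split; [exact: measurableT_comp|exists M]. Qed.

Lemma measurable_cos : measurable_fun setT (@cos R).
Proof. by apply: continuous_measurable_fun; exact: continuous_cos. Qed.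

Lemma measurable_sin : measurable_fun setT (@sin R).
Proof. by apply: continuous_measurable_fun; exact: continuous_sin. Qed.

Lemma bounded_rv_cos Y : measurable_fun setT Y -> bounded_rv (fun w => cos (Y w)).
Proof. exact: bounded_rv_comp measurable_cos (@cos_max R). Qed.

Lemma bounded_rv_sin Y : measurable_fun setT Y -> bounded_rv (fun w => sin (Y w)).
Proof. exact: bounded_rv_comp measurable_sin (@sin_max R). Qed.

Lemma bounded_rv_indic A : measurable A -> bounded_rv (\1_A : Omega -> R).
Proof.
move=> mA; split; first exact: measurable_indic.
by exists 1 => w; rewrite indicE; case: (_ \in _); rewrite ?normr1 ?normr0.
Qed.

Lemma bounded_rv_integrable Y : bounded_rv Y -> P.-integrable setT (EFin \o Y).
Proof.
move=> [mY [M hM]]; apply: measurable_bounded_integrable => //.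
  by rewrite [X in (X < _)%E](probability_setT P) ltry.
by exists M; split; [exact: num_real|move=> x Mx y _; exact: le_trans (hM y) (ltW Mx)].
Qed.

Lemma mean_cst (c : R) : mean (fun=> c) = c.
Proof. by rewrite /mean Rintegral_cst// [X in fine X](probability_setT P) mulr1. Qed.

Lemma meanD X Y : bounded_rv X -> bounded_rv Y ->
  mean (fun w => X w + Y w) = mean X + mean Y.
Proof. by move=> bX bY; rewrite /mean RintegralD//; exact: bounded_rv_integrable. Qed.

Lemma meanB X Y : bounded_rv X -> bounded_rv Y ->
  mean (fun w => X w - Y w) = mean X - mean Y.
Proof. by move=> bX bY; rewrite /mean RintegralB//; exact: bounded_rv_integrable. Qed.

Lemma meanZ (c : R) Y : bounded_rv Y -> mean (fun w => c * Y w) = c * mean Y.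
Proof. by move=> bY; rewrite /mean RintegralZl//; exact: bounded_rv_integrable. Qed.

Lemma mean_sum (I : Type) (s : seq I) (F : I -> Omega -> R) :
  (forall i, bounded_rv (F i)) ->
  mean (fun w => \sum_(i <- s) F i w) = \sum_(i <- s) mean (F i).
Proof.
move=> hF; elim: s => [|i s IH].
  by rewrite big_nil; under eq_fun do rewrite big_nil; exact: mean_cst.
rewrite big_cons -IH -meanD//; last exact: bounded_rv_sum.
by congr mean; apply/funext => w; rewrite big_cons.
Qed.

Lemma mean_le X Y : bounded_rv X -> bounded_rv Y ->
  (forall w, X w <= Y w) -> mean X <= mean Y.
Proof.
by move=> bX bY XY; apply: le_Rintegral => //; exact: bounded_rv_integrable.
Qed.

Lemma mean_norm_le Y (M : R) : bounded_rv Y -> (forall w, `|Y w| <= M) ->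
  `|mean Y| <= M.
Proof.
move=> bY hM; rewrite ler_norml; apply/andP; split.
  rewrite -(mean_cst (- M)); apply: mean_le => //; first exact: bounded_rv_cst.
  by move=> w; have := hM w; rewrite ler_norml => /andP[].
rewrite -(mean_cst M); apply: mean_le => //; first exact: bounded_rv_cst.
by move=> w; have := hM w; rewrite ler_norml => /andP[].
Qed.

Lemma mean_norm_le_mean X Y : bounded_rv X -> bounded_rv Y ->
  (forall w, `|X w| <= Y w) -> `|mean X| <= mean Y.
Proof.
move=> bX bY XY; rewrite ler_norml; apply/andP; split.
  rewrite -[- _]mulN1r -meanZ//; apply: mean_le => //; first exact: bounded_rvZ.
  by move=> w; have := XY w; rewrite ler_norml mulN1r => /andP[].
by apply: mean_le => // w; have := XY w; rewrite ler_norml => /andP[].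
Qed.

Lemma mean_dist_le X Y (M : R) : bounded_rv X -> bounded_rv Y ->
  (forall w, `|X w - Y w| <= M) -> `|mean X - mean Y| <= M.
Proof. by move=> bX bY h; rewrite -meanB//; apply: mean_norm_le => //; exact: bounded_rvB. Qed.

Lemma mean_indic A : measurable A -> mean (\1_A) = fine (P A).
Proof. by move=> mA; rewrite /mean /Rintegral integral_indic// setIT. Qed.

(** Bounded convergence. *)
Lemma mean_cvg (Y_ : nat -> Omega -> R) Y (M : R) :
  (forall n, measurable_fun setT (Y_ n)) -> measurable_fun setT Y ->
  (forall n w, `|Y_ n w| <= M) -> (forall w, Y_ n w @[n --> \oo] --> Y w) ->
  mean (Y_ n) @[n --> \oo] --> mean Y.
Proof.
move=> mY_ mY hM cY.
have bY w : `|Y w| <= M.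
  have c : `|Y_ n w| @[n --> \oo] --> `|Y w| by apply: cvg_norm.
  rewrite -(cvg_lim _ c)//; apply: limr_le; first by apply/cvg_ex; eexists; exact: c.
  exact: nearW.
have [] := @dominated_convergence _ _ _ P setT measurableT
   (fun n w => (Y_ n w)%:E) (fun w => (Y w)%:E) (fun=> M%:E).
- by move=> n; exact/measurable_EFinP.
- exact/measurable_EFinP.
- by apply: aeW => w _; apply: cvg_EFin; [exact: nearW|exact: cY].
- by apply: bounded_rv_integrable; exact: bounded_rv_cst.
- by apply: aeW => w n _; rewrite lee_fin.
move=> _ _ c; rewrite /mean /Rintegral; apply: fine_cvg.
rewrite fineK; first exact: c.
by apply: integrable_fin_num => //; apply: bounded_rv_integrable; split => //; exists M.
Qed.

End mean.

(** * Squared L2 norms *)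

Section sqn.
Context (R : realType) (d : measure_display) (T : measurableType d).
Context (mu : {measure set T -> \bar R}).
Implicit Types (f g h : T -> R).
Local Open Scope ereal_scope.

(** The square of the L2 norm: the squared triangle inequality [sqnD]
    suffices throughout, and squares are additive over partitions. *)
Definition sqn f : \bar R := \int[mu]_x ((f x ^+ 2)%R)%:E.

Lemma sqn_ge0 f : 0 <= sqn f.
Proof. by apply: integral_ge0 => x _; rewrite lee_fin sqr_ge0. Qed.

Lemma measurable_sqr f : measurable_fun setT f ->
  measurable_fun setT (EFin \o (fun x => f x ^+ 2)%R).
Proof. by move=> mf; apply/measurable_EFinP; exact: measurable_funX. Qed.

Lemma sqn_le f g : measurable_fun setT f -> measurable_fun setT g ->
  (forall x, `|f x| <= `|g x|)%R -> sqn f <= sqn g.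
Proof.
move=> mf mg fg; apply: ge0_le_integral => //.
- by move=> x _; rewrite lee_fin sqr_ge0.
- exact: measurable_sqr.
- exact: measurable_sqr.
- by move=> x _; rewrite lee_fin -(real_normK (num_real (f x)))
    -(real_normK (num_real (g x))) lerXn2r// ?nnegrE.
Qed.

Lemma sqnZ (c : R) f : measurable_fun setT f ->
  sqn (fun x => c * f x)%R = ((c ^+ 2)%R)%:E * sqn f.
Proof.
move=> mf; rewrite /sqn; under eq_integral do rewrite exprMn EFinM.
by rewrite ge0_integralZl//; [exact: measurable_sqr|move=> x _; rewrite lee_fin sqr_ge0|rewrite lee_fin sqr_ge0].
Qed.

Lemma sqnD f g : measurable_fun setT f -> measurable_fun setT g ->
  sqn (fun x => f x + g x)%R <= 2%:E * sqn f + 2%:E * sqn g.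
Proof.
move=> mf mg; rewrite /sqn.
rewrite -ge0_integralZl//; [|exact: measurable_sqr|by move=> x _; rewrite lee_fin sqr_ge0].
rewrite -ge0_integralZl//; [|exact: measurable_sqr|by move=> x _; rewrite lee_fin sqr_ge0].
rewrite -ge0_integralD//.
- apply: ge0_le_integral => //.
  + by move=> x _; rewrite lee_fin sqr_ge0.
  + by apply: measurable_sqr; exact: measurable_funD.
  + by apply/measurable_EFinP; apply: measurable_funD;
      apply: measurable_funM => //; exact: measurable_funX.
  + move=> x _; rewrite lee_fin; have := sqr_ge0 (f x - g x)%R; nra.
- by move=> x _; rewrite lee_fin mulr_ge0// sqr_ge0.
- by apply/measurable_EFinP; apply: measurable_funM => //; exact: measurable_funX.
- by move=> x _; rewrite lee_fin mulr_ge0// sqr_ge0.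
- by apply/measurable_EFinP; apply: measurable_funM => //; exact: measurable_funX.
Qed.

Lemma sqnN f : sqn (fun x => - f x)%R = sqn f.
Proof. by rewrite /sqn; under eq_integral do rewrite sqrrN. Qed.

Lemma sqn_sym f g : sqn (fun x => f x - g x)%R = sqn (fun x => g x - f x)%R.
Proof. by rewrite -sqnN; congr sqn; apply/funext => x; rewrite opprB. Qed.

(** The triangle inequality in the form used to pass between approximations. *)
Lemma sqn_trans g f h (a b : R) :
  measurable_fun setT f -> measurable_fun setT g -> measurable_fun setT h ->
  sqn (fun x => f x - g x)%R <= a%:E -> sqn (fun x => g x - h x)%R <= b%:E ->
  sqn (fun x => f x - h x)%R <= (2 * a + 2 * b)%:E.
Proof.
move=> mf mg mh fg gh.
rewrite (_ : (fun x => f x - h x)%R = fun x => ((f x - g x) + (g x - h x))%R); last first.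
  by apply/funext => x; ring.
apply: le_trans (sqnD _ _) _; [exact: measurable_funB|exact: measurable_funB|].
by rewrite (EFinD (2 * a)%R) !EFinM; apply: leeD; apply: lee_wpmul2l.
Qed.

Lemma sqn_sum (I : Type) (s : seq I) (F : I -> T -> R) (c : I -> R) :
  (forall i, measurable_fun setT (F i)) ->
  (forall i, sqn (F i) <= (c i)%:E) ->
  sqn (fun x => \sum_(i <- s) F i x)%R <= ((2 ^+ size s) * \sum_(i <- s) c i)%:E.
Proof.
move=> mF hF; have c0 i : (0 <= c i)%R by rewrite -lee_fin (le_trans (sqn_ge0 (F i))).
elim: s => [|i s IH].
  rewrite big_nil mulr0 /sqn; under eq_integral do rewrite big_nil expr0n/=.
  by rewrite integral0.
rewrite (_ : (fun x => _) = (fun x => F i x + \sum_(j <- s) F j x)%R); last first.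
  by apply/funext => x; rewrite big_cons.
apply: le_trans (sqnD _ _) _ => //; first exact: measurable_sum.
rewrite big_cons [size _]/= exprS mulrDr (EFinD (2 * 2 ^+ size s * c i)%R); apply: leeD.
  rewrite (le_trans (lee_wpmul2l _ (hF i)))// -EFinM lee_fin.
  by rewrite ler_pM// ler_peMr// exprn_ege1// ler1n.
by rewrite (le_trans (lee_wpmul2l _ IH))// -EFinM lee_fin mulrA.
Qed.

Lemma Lnorm2E f : 'N[mu]_2%:E[EFin \o f] = sqn f `^ 2^-1.
Proof.
rewrite unlock /sqn; congr (_ `^ _); apply: eq_integral => x _.
by rewrite /= powR_mulrn// real_normK// num_real.
Qed.

Lemma Lnorm2_le f (c : R) : (0 <= c)%R ->
  ('N[mu]_2%:E[EFin \o f] <= c%:E) = (sqn f <= ((c ^+ 2)%R)%:E).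
Proof.
move=> c0; rewrite Lnorm2E; have := sqn_ge0 f; case: (sqn f) => [s| |]//.
- rewrite lee_fin poweR_EFin !lee_fin => s0.
  rewrite -[in LHS](@ler_pXn2r _ 2)// ?nnegrE ?powR_ge0//.
  by rewrite powR12_sqrt// sqr_sqrtr.
- by move=> _; rewrite poweRyr ?invr_neq0// !leye_eq.
Qed.

Lemma Lfun2P f : f \in Lfun mu 2%:E <-> measurable_fun setT f /\ (sqn f < +oo)%E.
Proof.
rewrite inE/=; split.
  move=> /andP[/[!inE]/= mf]; rewrite /finite_norm Lnorm2E => h; split => //.
  move: h (sqn_ge0 f); case: (sqn f) => [s| |]//=; first by move=> _ _; rewrite ltry.
  by rewrite gt_eqF ?invr_gt0.
move=> [mf sf]; apply/andP; split; rewrite inE//= /finite_norm Lnorm2E.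
by move: sf (sqn_ge0 f); case: (sqn f) => [s| |]//= _ _; rewrite ltry.
Qed.

(** Convergence in norm, restated with [sqn] to avoid roots. *)
Lemma Lnorm2_cvg0P (I : Type) (F : set_system I) (FF : ProperFilter F) (h : I -> T -> R) :
  'N[mu]_2%:E[EFin \o h r] @[r --> F] --> 0 <->
  (forall c : R, (0 < c)%R -> \forall r \near F, sqn (h r) <= c%:E).
Proof.
have FF' : Filter F := filter_filter; split=> [hc c c0|hc].
  have s0 : (0 < Num.sqrt c)%R by rewrite sqrtr_gt0.
  have : \forall r \near F, 'N[mu]_2%:E[EFin \o h r] < (Num.sqrt c)%:E.
    by apply: (hc [set x | x < (Num.sqrt c)%:E]); apply: open_ereal_lt'; rewrite lte_fin.
  apply: filterS => r /ltW; rewrite Lnorm2_le; last exact: ltW.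
  by rewrite sqr_sqrtr// ltW.
have N_le c : (0 < c)%R -> \forall r \near F, 'N[mu]_2%:E[EFin \o h r] <= c%:E.
  move=> c0; have := hc _ (exprn_gt0 2 c0); apply: filterS => r.
  by rewrite Lnorm2_le// ltW.
apply/fine_cvgP; split.
  apply: filterS (N_le 1%R ltr01) => r Nr.
  by rewrite ge0_fin_numE ?Lnorm_ge0// (le_lt_trans Nr)// ltry.
apply/cvgr0Pnorm_le => e e0; apply: filterS (N_le _ e0) => r Nr.
have N0 := Lnorm_ge0 mu 2%:E (EFin \o h r).
rewrite /= ger0_norm ?fine_ge0// -lee_fin fineK// ge0_fin_numE//.
by rewrite (le_lt_trans Nr)// ltry.
Qed.

Lemma sqn_fatou (f_ : nat -> T -> R) f (u : nat -> R) (c : R) :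
  (forall n, measurable_fun setT (f_ n)) -> (forall x, f_ n x @[n --> \oo] --> f x) ->
  (forall n, sqn (f_ n) <= (u n)%:E) -> u n @[n --> \oo] --> c ->
  sqn f <= c%:E.
Proof.
move=> mf cf hu uc; have c2 x : ((f_ n x ^+ 2)%R)%:E @[n --> \oo] --> ((f x ^+ 2)%R)%:E.
  by apply: cvg_EFin; [exact: nearW|apply: cvgM; exact: cf].
rewrite (_ : sqn f = \int[mu]_x limn_einf (fun n => ((f_ n x ^+ 2)%R)%:E)); last first.
  apply: eq_integral => x _; have cx := c2 x.
  rewrite is_cvg_limn_einfE; first by apply/esym/cvg_lim.
  by apply/cvg_ex; eexists; exact: cx.
apply: le_trans (fatou _ _ _ _) _ => //.
- by move=> n; exact: measurable_sqr.
- by move=> n x _; rewrite lee_fin sqr_ge0.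
have cu : (u n)%:E @[n --> \oo] --> c%:E by apply: cvg_EFin; [exact: nearW|].
rewrite -(cvg_lim _ cu)// limn_einf_lim; apply: lee_lim.
- exact: is_cvg_einfs.
- by apply/cvg_ex; eexists; exact: cu.
- by apply: nearW => n; apply: le_trans (hu n); apply: ereal_inf_lbound; exists n => /=.
Qed.

End sqn.

(** * Completeness of L2 of a probability space *)

Section completeness.
Context (R : realType) (d : measure_display) (Omega : measurableType d).
Context (P : probability Omega R).
Implicit Types (X Y Z : Omega -> R).

Lemma sqn_cst (c : R) : sqn P (fun=> c) = (c ^+ 2)%:E.
Proof. by rewrite /sqn integral_cst// [X in (_ * X)%E](probability_setT P) mule1. Qed.

(** The first moment is controlled by the second through
    [x <= c / 2 + x ^+ 2 / (2 * c)]. *)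
Lemma integral_norm_le_sqn Y (c : R) : measurable_fun setT Y -> 0 < c ->
  (sqn P Y <= (c ^+ 2)%:E)%E -> (\int[P]_w `|Y w|%:E <= c%:E)%E.
Proof.
move=> mY c0 hY.
apply: (@le_trans _ _ (\int[P]_w ((c / 2)%:E + (2 * c)^-1%:E * (Y w ^+ 2)%:E))%E).
  apply: ge0_le_integral => //.
  - by apply/measurable_EFinP; exact: measurableT_comp.
  - by apply/measurable_EFinP; apply: measurable_funD => //;
      apply: measurable_funM => //; exact: measurable_funX.
  - move=> w _; rewrite lee_fin -[Y w ^+ 2]real_normK ?num_real//.
    set y := `|Y w|; rewrite -subr_ge0.
    have -> : c / 2 + (2 * c)^-1 * y ^+ 2 - y = (2 * c)^-1 * (c - y) ^+ 2.
      by field; rewrite gt_eqF.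
    by rewrite mulr_ge0 ?sqr_ge0// invr_ge0 mulr_ge0// ltW.
rewrite ge0_integralD//; last 3 first.
- by move=> w _; rewrite lee_fin divr_ge0// ltW.
- by move=> w _; rewrite mule_ge0// lee_fin ?sqr_ge0// invr_ge0 mulr_ge0// ltW.
- by apply/measurable_EFinP; apply: measurable_funM => //; exact: measurable_funX.
rewrite integral_cst// [X in (_ * X)%E](probability_setT P) mule1 ge0_integralZl//; last 3 first.
- exact: measurable_sqr.
- by move=> w _; rewrite lee_fin sqr_ge0.
- by rewrite lee_fin invr_ge0 mulr_ge0// ltW.
apply: (@le_trans _ _ ((c / 2)%:E + (2 * c)^-1%:E * (c ^+ 2)%:E)%E).
  by apply: leeD => //; apply: lee_wpmul2l => //; rewrite lee_fin invr_ge0 mulr_ge0// ltW.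
by rewrite -EFinM -EFinD lee_fin le_eqVlt; apply/orP; left; apply/eqP; field; rewrite gt_eqF.
Qed.

Let sqn_telescope (Y_ : nat -> Omega -> R) (a : R) k n : 0 <= a ->
  (forall k, measurable_fun setT (Y_ k)) ->
  (forall k, sqn P (fun w => Y_ k.+1 w - Y_ k w)%R <= (a * 8^-1 ^+ k)%:E)%E ->
  (sqn P (fun w => Y_ k w - Y_ (k + n)%N w)%R <= (4 * a * 8^-1 ^+ k)%:E)%E.
Proof.
move=> a0 mY hY; elim: n k => [k|n IH k].
  rewrite addn0; under eq_fun do rewrite subrr.
  by rewrite sqn_cst expr0n/= lee_fin !mulr_ge0// exprn_ge0.
apply: le_trans; first apply: (@sqn_trans _ _ _ P (Y_ k.+1) _ _ (a * 8^-1 ^+ k) (4 * a * 8^-1 ^+ k.+1)) => //.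
- by rewrite sqn_sym.
- by rewrite addnS -addSn; exact: IH.
rewrite lee_fin exprS; have : 0 <= a * 8^-1 ^+ k by rewrite mulr_ge0// exprn_ge0.
by move: (8^-1 ^+ k) => e; lra.
Qed.

(** Along a sequence that converges this fast, almost every path converges
    absolutely; Fatou's lemma then controls the distance to the limit. *)
Let fast_complete (Y_ : nat -> Omega -> R) :
  (forall k, measurable_fun setT (Y_ k)) ->
  (forall k, sqn P (fun w => Y_ k.+1 w - Y_ k w)%R <= (8^-1 ^+ k)%:E)%E ->
  exists2 X : Omega -> R, measurable_fun setT X &
    forall k, (sqn P (fun w => Y_ k w - X w)%R <= (4 * 8^-1 ^+ k)%:E)%E.
Proof.
move=> mY hY.
pose D k w := `|Y_ k.+1 w - Y_ k w|.
have mD k : measurable_fun setT (D k).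
  by apply: measurableT_comp => //; exact: measurable_funB.
pose H w := (\sum_(k <oo) (D k w)%:E)%E.
have mH : measurable_fun setT H.
  apply: ge0_emeasurable_sum => //; first by move=> k w _ _; rewrite lee_fin normr_ge0.
  by move=> k _; exact/measurable_EFinP.
have D_le k : (\int[P]_w (D k w)%:E <= (2^-1 ^+ k)%:E)%E.
  apply: integral_norm_le_sqn; [exact: measurable_funB|exact: exprn_gt0|].
  apply: le_trans (hY k) _; rewrite lee_fin -exprM mulnC exprM.
  by apply: lerXn2r; rewrite ?nnegrE//; lra.
have iH : (\int[P]_w H w < +oo)%E.
  rewrite /H integral_nneseries//; last 2 first.
  - by move=> k; exact/measurable_EFinP.
  - by move=> k w _; rewrite lee_fin normr_ge0.
  apply: le_lt_trans (lee_nneseries _ (fun k _ => D_le k)) _.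
    by move=> k _ _; apply: integral_ge0 => w _; rewrite lee_fin normr_ge0.
  apply: (@le_lt_trans _ _ (1 * (1 - 2^-1)^-1)%:E); last exact: ltry.
  apply: lime_le.
    by apply: is_cvg_nneseries => k _ _; rewrite lee_fin exprn_ge0.
  apply: nearW => n; rewrite sumEFin lee_fin.
  have -> : \sum_(0 <= k < n) 2^-1 ^+ k = series (geometric 1 (2^-1 : R)) n.
    by apply: eq_bigr => k _; rewrite /= mul1r.
  by apply: geometric_le_lim; rewrite ?ger0_norm//; lra.
pose A := [set w | (H w < +oo)%E].
have mA : measurable A by rewrite -[A]setTI; exact: emeasurable_fun_infty_o.
have H0 w : (0 <= H w)%E by apply: nneseries_ge0 => k _; rewrite lee_fin normr_ge0.
have A1 : {ae P, forall w, A w}.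
  have := @integrable_ae _ _ _ P setT measurableT H; case.
    apply/integrableP; split => //.
    by under eq_integral do rewrite gee0_abs//.
  move=> N [mN PN sN]; exists N; split => // w /= nAw; apply: sN => /= Hfin.
  by apply: nAw; rewrite /A /= -ge0_fin_numE//; exact: Hfin.
pose Y' k w := Y_ k w * \1_A w.
have mY' k : measurable_fun setT (Y' k).
  by apply: measurable_funM => //; exact: measurable_indic.
have cY' w : cvgn (Y' ^~ w).
  have [Aw|nAw] := pselect (A w); last first.
    by apply/cvg_ex; exists 0; rewrite /Y' indicE memNset//; under eq_fun do rewrite mulr0; exact: cvg_cst.
  have cS : cvgn (series (fun k => Y_ k.+1 w - Y_ k w)).
    apply: normed_cvg; apply: nondecreasing_is_cvgn.
      by apply/nondecreasing_seqP => n; rewrite /= /series/= big_nat_recr//= lerDl.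
    exists (fine (H w)) => _ [n _ <-]; rewrite -lee_fin fineK ?ge0_fin_numE//.
    rewrite /= /series/= -sumEFin; apply: nneseries_lim_ge => k _.
    by rewrite lee_fin normr_ge0.
  have -> : Y' ^~ w = fun n => Y_ 0%N w + series (fun k => Y_ k.+1 w - Y_ k w) n.
    apply/funext => n; rewrite /Y' indicE mem_set// mulr1 /series/= telescope_sumr//.
    by rewrite addrC subrK.
  by apply: is_cvgD => //; exact: is_cvg_cst.
pose X w := limn (Y' ^~ w).
have cX w : Y' n w @[n --> \oo] --> X w by exact: cY'.
exists X; first by apply: (@measurable_fun_cvg _ _ _ setT Y') => // w _.
move=> k.
have -> : sqn P (fun w => Y_ k w - X w) = sqn P (fun w => Y' k w - X w).
  have mX : measurable_fun setT X by apply: (@measurable_fun_cvg _ _ _ setT Y').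
  apply: ge0_ae_eq_integral => //.
  - by apply: measurable_sqr; exact: measurable_funB.
  - by apply: measurable_sqr; exact: measurable_funB.
  - by move=> w _; rewrite lee_fin sqr_ge0.
  - by move=> w _; rewrite lee_fin sqr_ge0.
  - by apply: filterS A1 => w Aw _; rewrite /Y' indicE mem_set// mulr1.
apply: (@sqn_fatou _ _ _ P (fun n w => Y' k w - Y' (k + n)%N w) _ (fun=> 4 * 8^-1 ^+ k)).
- by move=> n; exact: measurable_funB.
- move=> w; apply: cvgB; first exact: cvg_cst.
  exact: cvg_comp (cvg_addnl k) (cX w).
- move=> n; apply: (@le_trans _ _ (sqn P (fun w => Y_ k w - Y_ (k + n)%N w))).
    apply: sqn_le; [exact: measurable_funB|exact: measurable_funB|].
    move=> w; rewrite /Y' -mulrBl normrM indicE.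
    by case: (_ \in _); rewrite ?normr1 ?mulr1// normr0 mulr0.
  rewrite -(mulr1 4); apply: sqn_telescope => // j; rewrite mul1r; exact: hY.
- exact: cvg_cst.
Qed.

(** The Riesz-Fischer theorem, by extraction of a fast subsequence. *)
Lemma L2_complete (Y_ : nat -> Omega -> R) :
  (forall k, measurable_fun setT (Y_ k)) -> (forall k, sqn P (Y_ k) < +oo)%E ->
  (forall c : R, 0 < c -> exists K, forall k l, (K <= k)%N -> (K <= l)%N ->
     (sqn P (fun w => Y_ k w - Y_ l w)%R <= c%:E)%E) ->
  exists2 X : Omega -> R, X \in Lfun P 2%:E & forall c : R, 0 < c -> exists K, forall k, (K <= k)%N ->
     (sqn P (fun w => Y_ k w - X w)%R <= c%:E)%E.
Proof.
move=> mY fY hY.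
have h8 k : 0 < (8^-1 : R) ^+ k by rewrite exprn_gt0.
pose K k := projT1 (cid (hY _ (h8 k))).
have hK k : forall i j, (K k <= i)%N -> (K k <= j)%N ->
    (sqn P (fun w => Y_ i w - Y_ j w)%R <= (8^-1 ^+ k)%:E)%E.
  exact: projT2 (cid (hY _ (h8 k))).
pose n k := (\sum_(j < k.+1) K j)%N.
have nS k : (n k <= n k.+1)%N by rewrite /n [leqRHS]big_ord_recr leq_addr.
have Kn k : (K k <= n k)%N by rewrite /n big_ord_recr leq_addl.
have [X mX hX] := fast_complete (fun k => mY (n k))
  (fun k => hK k _ _ (leq_trans (Kn k) (nS k)) (Kn k)).
exists X.
  apply/Lfun2P; split => //.
  rewrite (_ : X = fun w => Y_ (n 0%N) w + - (Y_ (n 0%N) w - X w)); last first.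
    by apply/funext => w; ring.
  apply: le_lt_trans (sqnD _ _ _) _ => //.
    by apply: measurableT_comp => //; exact: measurable_funB.
  apply: lte_add_pinfty; first by rewrite lte_mul_pinfty.
  rewrite lte_mul_pinfty// sqnN; apply: le_lt_trans (hX 0%N) _; exact: ltry.
move=> c c0.
have [k hk] : exists k, 10 * 8^-1 ^+ k <= c.
  have g0 : geometric 10 (8^-1 : R) n @[n --> \oo] --> 0.
    by apply: cvg_geometric; rewrite ger0_norm; lra.
  have /cvgr0Pnorm_le/(_ _ c0)[k _ /(_ k (leqnn k))] := g0.
  by rewrite /= => h; exists k; exact: le_trans (ler_norm _) h.
exists (n k) => i ni.
apply: (@le_trans _ _ (2 * (8^-1 ^+ k) + 2 * (4 * 8^-1 ^+ k))%:E).
  by apply: (@sqn_trans _ _ _ P (Y_ (n k))) => //; apply: hK => //; exact: leq_trans ni.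
by rewrite lee_fin; apply: le_trans hk; have := ltW (h8 k); lra.
Qed.

(** The cosine is 1-Lipschitz and the L1 norm is at most the L2 norm, so that
    approximations in L2 pass to characteristic functions. *)
Lemma mean_cos_dist X Y (p c : R) :
  measurable_fun setT X -> measurable_fun setT Y -> 0 < c ->
  (sqn P (fun w => X w - Y w)%R <= (c ^+ 2)%:E)%E ->
  `|mean P (fun w => cos (X w + p)) - mean P (fun w => cos (Y w + p))| <= c.
Proof.
move=> mX mY c0 hXY.
have bX : bounded_rv (fun w => cos (X w + p)).
  by apply: bounded_rv_cos; exact: measurable_funD.
have bY : bounded_rv (fun w => cos (Y w + p)).
  by apply: bounded_rv_cos; exact: measurable_funD.
rewrite -meanB// -lee_fin.
apply: le_trans (integral_norm_le_sqn (measurable_funB mX mY) c0 hXY).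
rewrite /mean EFin_normr_Rintegral//; last exact/bounded_rv_integrable/bounded_rvB.
apply: le_trans (le_abse_integral _ _ _) _ => //.
  by have [mB _] := bounded_rvB bX bY; exact/measurable_EFinP.
apply: ge0_le_integral => //.
- by have [mB _] := bounded_rvB bX bY; apply: measurableT_comp => //; exact/measurable_EFinP.
- by apply/measurable_EFinP; apply: measurableT_comp => //; exact: measurable_funB.
- move=> w _; rewrite lee_fin; apply: le_trans (dist_cos _ _) _.
  by rewrite opprD addrACA subrr addr0.
Qed.

End completeness.

(** * Random variables generated by a countable partition *)

Section countable.
Context (R : realType) (d : measure_display) (Omega : measurableType d).
Context (P : probability Omega R) (T : countType) (X : Omega -> T).
Hypothesis mX : forall x, measurable [set w | X w = x].

(** Measurability with respect to [X], stated without a sigma-algebra: since [X]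
    has countably many values it is automatic. *)
Definition determined (Y : Omega -> R) : Prop :=
  forall w w', X w = X w' -> Y w = Y w'.

Lemma determined_measurable Y : determined Y -> measurable_fun setT Y.
Proof.
move=> dY _ B _; rewrite setTI.
rewrite (_ : Y @^-1` B = \bigcup_n [set w | pickle (X w) = n /\ B (Y w)]); last first.
  by apply/seteqP; split=> [w Bw|w [n _ []//]]; exists (pickle (X w)).
apply: bigcup_measurable => n _.
have [[w0 [e0 B0]]|no] := pselect (exists w, pickle (X w) = n /\ B (Y w)); last first.
  rewrite (_ : [set w | _] = set0)//; apply/seteqP; split=> // w hw.
  by apply: no; exists w.
rewrite (_ : [set w | _] = [set w | X w = X w0]); first exact: mX.
apply/seteqP; split=> w /=.
  by move=> [e _]; apply: (pcan_inj pickleK); rewrite e.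
by move=> e; rewrite (dY w w0)// e.
Qed.

Lemma bounded_rv_eq x : bounded_rv (fun w => (X w == x)%:R : R).
Proof.
rewrite (_ : (fun w => _) = \1_[set w | X w = x]); first exact: bounded_rv_indic.
by apply/funext => w; rewrite indicE; case: eqP => e; [rewrite mem_set|rewrite memNset].
Qed.

Lemma mean_eq x : mean P (fun w => (X w == x)%:R) = fine (P [set w | X w = x]).
Proof.
rewrite -mean_indic//; congr mean; apply/funext => w; rewrite indicE.
by case: eqP => e; [rewrite mem_set|rewrite memNset].
Qed.

(** A mean is determined by its restrictions to the atoms, since the first
    [n] atoms exhaust the space as [n] grows. *)
Lemma mean_ext_atoms Y Y' : bounded_rv Y -> bounded_rv Y' ->
  (forall x, mean P (fun w => (X w == x)%:R * Y w) =
             mean P (fun w => (X w == x)%:R * Y' w)) ->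
  mean P Y = mean P Y'.
Proof.
pose S Z n w : R := \sum_(0 <= j < n) (pickle (X w) == j)%:R * Z w.
have bj j : bounded_rv (fun w => (pickle (X w) == j)%:R : R).
  case: (pselect (exists x : T, pickle x = j)) => [[x <-]|nx].
    under eq_fun do rewrite (inj_eq (pcan_inj pickleK)); exact: bounded_rv_eq.
  rewrite (_ : (fun w => _) = fun=> 0); first exact: bounded_rv_cst.
  by apply/funext => w; case: eqP => // e; exfalso; apply: nx; exists (X w).
have SE Z n w : S Z n w = (pickle (X w) < n)%:R * Z w.
  rewrite /S -mulr_suml; congr (_ * _).
  rewrite -natr_sum; congr (_%:R); elim: n => [|n IH]; first by rewrite big_nil.
  by rewrite big_nat_recr//= IH ltnS [in RHS]leq_eqVlt; case: ltngtP.
have cS Z : bounded_rv Z -> mean P (S Z n) @[n --> \oo] --> mean P Z.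
  move=> [mZ [M hM]]; apply: (@mean_cvg _ _ _ _ _ _ M) => //.
  - move=> n; apply: measurable_sum => j; apply: measurable_funM => //.
    by case: (bj j).
  - by move=> n w; rewrite SE normrM; case: (_ < _)%N;
      rewrite ?normr1 ?mul1r// normr0 mul0r (le_trans _ (hM w)).
  - move=> w; apply: cvg_near_cst; exists (pickle (X w)).+1 => // n /= hn.
    by rewrite SE hn mul1r.
move=> bY bY' h.
have e : (fun n => mean P (S Y n)) = fun n => mean P (S Y' n).
  apply/funext => n; rewrite !mean_sum; first last.
  - by move=> j; exact: bounded_rvM.
  - by move=> j; exact: bounded_rvM.
  apply: eq_bigr => j _; case: (pselect (exists x : T, pickle x = j)) => [[x <-]|nx].
    by under eq_fun do rewrite (inj_eq (pcan_inj pickleK));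
       under [in RHS]eq_fun do rewrite (inj_eq (pcan_inj pickleK)); exact: h.
  by congr mean; apply/funext => w; case: eqP => [e|_]; rewrite ?mul0r//;
    exfalso; apply: nx; exists (X w).
have := cS _ bY; rewrite e => /cvg_lim <-//; exact/cvg_lim/cS.
Qed.

End countable.

(** * The Poisson process along a regular time grid *)

Section poisson_grid.
Context (R : realType) (d : measure_display) (Omega : measurableType d).
Context (P : probability Omega R) (N : R -> Omega -> nat).
Hypothesis poissonN : standard_poisson_process P N.
Variable h : R.
Hypothesis h_gt0 : 0 < h.

Definition gridN (k : nat) (w : Omega) : nat := N (h * k%:R) w.

Definition gridD (k : nat) (w : Omega) : nat := (gridN k.+1 w - gridN k w)%N.

Definition history (k : nat) (w : Omega) : seq nat := [seq gridD j w | j <- iota 0 k].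

Lemma grid_ge0 k : 0 <= h * k%:R.
Proof. by rewrite mulr_ge0// ltW. Qed.

Lemma grid_le k l : (k <= l)%N -> h * k%:R <= h * l%:R.
Proof. by move=> kl; rewrite ler_pM2l// ler_nat. Qed.

Lemma measurable_gridN k : measurable_fun setT (gridN k).
Proof. exact: poisson_measurable poissonN _ (grid_ge0 k). Qed.

Lemma gridN_le w k l : (k <= l)%N -> (gridN k w <= gridN l w)%N.
Proof.
by move=> kl; apply: (poisson_nondecreasing poissonN); [exact: grid_ge0|exact: grid_le].
Qed.

Lemma gridN_succ k w : gridN k.+1 w = (gridN k w + gridD k w)%N.
Proof. by rewrite /gridD subnKC// gridN_le. Qed.

Lemma historyS k w : history k.+1 w = rcons (history k w) (gridD k w).
Proof. by rewrite /history -addn1 iotaD map_cat cats1. Qed.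

Lemma size_history k w : size (history k w) = k.
Proof. by rewrite size_map size_iota. Qed.

Lemma gridN_history k w : gridN k w = sumn (history k w).
Proof.
elim: k => [|k IH]; first by rewrite /gridN mulr0 (poisson_start poissonN).
by rewrite gridN_succ historyS -cats1 sumn_cat /= addn0 IH.
Qed.

Lemma measurable_gridD k m : measurable [set w | gridD k w = m].
Proof.
rewrite (_ : [set w | _] = \bigcup_n ([set w | gridN k.+1 w = (n + m)%N] `&` [set w | gridN k w = n])).
  apply: bigcup_measurable => n _; apply: measurableI.
    by rewrite -[X in measurable X]setTI; exact: (measurable_gridN _ _ (Y := [set (n + m)%N])).
  by rewrite -[X in measurable X]setTI; exact: (measurable_gridN _ _ (Y := [set n])).
apply/seteqP; split=> w /=.
  by move=> e; exists (gridN k w) => //; split => //=; rewrite gridN_succ e.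
by move=> [n _ [/= e1 e2]]; rewrite /gridD e1 e2 addKn.
Qed.

Definition gridq (k m : nat) : R := fine (P [set w | gridD k w = m]).

Lemma gridqE k m : P [set w | gridD k w = m] = (gridq k m)%:E.
Proof. by rewrite /gridq fineK// fin_num_measure//; exact: measurable_gridD. Qed.

Lemma gridq_pmf k m : gridq k m = poisson_pmf h m.
Proof.
rewrite /gridq; have := poisson_increment_law poissonN m (grid_ge0 k) (_ : h * k%:R < h * k.+1%:R).
rewrite /gridD /gridN => ->/=; last by rewrite ltr_pM2l// ltr_nat.
by rewrite -mulrBr -natrB// subSnn mulr1.
Qed.

Lemma history_eqE k (x : seq nat) : size x = k ->
  [set w | history k w = x] =
  \bigcap_(i in [set: 'I_k]) [set w | gridD i w = nth 0%N x i].
Proof.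
move=> sx; apply/seteqP; split=> w /=.
  move=> <- i _ /=; rewrite /history (nth_map 0%N) ?size_iota//.
  by rewrite nth_iota// add0n.
move=> hw; apply: (@eq_from_nth _ 0%N); first by rewrite size_history.
move=> i; rewrite size_history => ik.
rewrite /history (nth_map 0%N) ?size_iota// nth_iota// add0n.
exact: (hw (Ordinal ik)).
Qed.

Lemma measurable_history k x : measurable [set w | history k w = x].
Proof.
have [sx|nsx] := eqVneq (size x) k.
  rewrite history_eqE//; apply: fin_bigcap_measurable => // i _.
  exact: measurable_gridD.
rewrite (_ : [set w | _] = set0)//; apply/seteqP; split=> // w /= e.
by move: nsx; rewrite -e size_history eqxx.
Qed.

Lemma history_law k x : size x = k ->
  fine (P [set w | history k w = x]) = \prod_(i < k) gridq i (nth 0%N x i).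
Proof.
move=> sx; rewrite history_eqE//.
have := @poisson_independent_increments _ _ _ _ _ poissonN k (fun k => h * k%:R).
rewrite mulr0 => /(_ (lexx _)) /(_ _ (fun i : 'I_k => [set nth 0%N x i])).
rewrite /preimage/= => ->//; last by move=> i j; exact: grid_le.
under eq_bigr do rewrite [P _](gridqE _ _).
by rewrite prodEFin.
Qed.

Definition past (k : nat) (Y : Omega -> R) : Prop := determined (history k) Y.

Lemma pastS k Y : past k Y -> past k.+1 Y.
Proof. by move=> pY w w'; rewrite !historyS => /rcons_inj [e _]; exact: pY. Qed.

Lemma past_gridN (F : nat -> R) k : past k (fun w => F (gridN k w)).
Proof. by move=> w w' e; rewrite !gridN_history e. Qed.

Lemma past_measurable k Y : past k Y -> measurable_fun setT Y.
Proof. by apply: determined_measurable; exact: measurable_history. Qed.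

Lemma past_bounded k Y (M : R) : past k Y -> (forall w, `|Y w| <= M) -> bounded_rv Y.
Proof. by move=> /past_measurable mY hM; split => //; exists M. Qed.

(** On an atom of the history both sides are products of increment laws, and
    the atoms determine a mean. *)
Lemma past_indep k Y m : past k Y -> bounded_rv Y ->
  mean P (fun w => (gridD k w == m)%:R * Y w) = poisson_pmf h m * mean P Y.
Proof.
move=> pY bY; have bD : bounded_rv (fun w => (gridD k w == m)%:R : R).
  by apply: bounded_rv_eq => x; exact: measurable_gridD.
rewrite -(gridq_pmf k) -meanZ//.
apply: (@mean_ext_atoms _ _ _ _ _ (history k)) => //.
- exact: measurable_history.
- exact: bounded_rvM.
- exact: bounded_rvZ.
move=> x; have bx : bounded_rv (fun w => (history k w == x)%:R : R).
  exact: bounded_rv_eq (measurable_history k) x.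
have [y hy] : exists y, forall w, (history k w == x)%:R * Y w = y * (history k w == x)%:R.
  have [[w0 e0]|no] := pselect (exists w, history k w = x).
    exists (Y w0) => w; case: eqP => [e|_]; last by rewrite mul0r mulr0.
    by rewrite mul1r mulr1; apply: pY; rewrite e e0.
  by exists 0 => w; case: eqP => [e|_]; rewrite ?mul0r//; exfalso; apply: no; exists w.
under eq_fun do rewrite mulrCA hy mulrCA.
under [in RHS]eq_fun do rewrite mulrCA hy mulrCA.
rewrite !meanZ//; [|exact: bounded_rvZ|exact: bounded_rvM]; congr (_ * _).
have [sx|nsx] := eqVneq (size x) k; last first.
  have z w : (history k w == x) = false.
    by apply/eqP => e; move: nsx; rewrite -e size_history eqxx.
  under eq_fun do rewrite z mulr0.
  by under [in RHS]eq_fun do rewrite z; rewrite !mean_cst mulr0.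
rewrite mean_eq; last exact: measurable_history.
rewrite history_law//.
transitivity (mean P (fun w => (history k.+1 w == rcons x m)%:R)).
  congr mean; apply/funext => w; rewrite historyS eqseq_rcons andbC.
  by case: (_ == m); case: (_ == x); rewrite ?mulr0 ?mul0r ?mulr1.
rewrite mean_eq; last exact: measurable_history.
rewrite history_law ?size_rcons ?sx// big_ord_recr/= mulrC.
rewrite nth_rcons sx ltnn eqxx; congr (_ * _); apply: eq_bigr => i _.
by rewrite nth_rcons sx ltn_ord.
Qed.

(** Up to [O(h ^+ 2)] an increment over a time [h] is a Bernoulli variable. *)
Lemma mean_step k (U : nat -> Omega -> R) (M : R) : h <= 1 ->
  (forall m, past k (U m)) -> (forall m w, `|U m w| <= M) ->
  `|mean P (fun w => U (gridD k w) w)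
    - ((1 - h) * mean P (U 0%N) + h * mean P (U 1%N))| <= 3 * M * h ^+ 2.
Proof.
move=> h1 pU hM; have M0 : 0 <= M.
  by apply: le_trans (hM 0%N (point : Omega)); rewrite normr_ge0.
have bU m : bounded_rv (U m) by exact: past_bounded (pU m) (hM m).
have bD m : bounded_rv (fun w => (gridD k w == m)%:R : R).
  by apply: bounded_rv_eq => x; exact: measurable_gridD.
pose V w := U (gridD k w) w.
have bV : bounded_rv V.
  apply: (@past_bounded k.+1 _ M) => [w w'|w]; last exact: hM.
  by rewrite !historyS => /rcons_inj [e1 e2]; rewrite /V e2; exact: pU.
pose r w := V w - ((gridD k w == 0%N)%:R * U 0%N w + (gridD k w == 1%N)%:R * U 1%N w).
have bS : bounded_rv (fun w => (gridD k w == 0%N)%:R * U 0%N w + (gridD k w == 1%N)%:R * U 1%N w).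
  by apply: bounded_rvD; exact: bounded_rvM.
have br : bounded_rv r by exact: bounded_rvB.
have hr : `|mean P r| <= M * (1 - (poisson_pmf h 0 + poisson_pmf h 1)).
  have -> : M * (1 - (poisson_pmf h 0 + poisson_pmf h 1)) =
      mean P (fun w => M * (1 - ((gridD k w == 0%N)%:R * 1 + (gridD k w == 1%N)%:R * 1))).
    have c1 : bounded_rv (fun=> 1 : R) := bounded_rv_cst _ 1.
    have p1 : past k (fun=> 1) by [].
    have b1 m : bounded_rv (fun w => (gridD k w == m)%:R * 1 : R) by exact: bounded_rvM.
    rewrite meanZ; last by apply: bounded_rvB => //; exact: bounded_rvD.
    rewrite meanB//; last exact: bounded_rvD.
    by rewrite meanD// !past_indep// mean_cst !mulr1.
  apply: mean_norm_le_mean => //.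
    apply: bounded_rvZ; apply: bounded_rvB; first exact: bounded_rv_cst.
    by apply: bounded_rvD; apply: bounded_rvM => //; exact: bounded_rv_cst.
  move=> w; rewrite /r /V; case: (gridD k w) => [|[|m]] /=;
    by rewrite !(mul1r, mul0r, addr0, add0r, subrr, normr0, mulr0, subr0, mulr1)//; exact: hM.
have -> : mean P (fun w => U (gridD k w) w) =
    mean P r + (poisson_pmf h 0 * mean P (U 0%N) + poisson_pmf h 1 * mean P (U 1%N)).
  rewrite -!(past_indep (k := k))// -!meanD//; try exact: bounded_rvM.
  by congr mean; apply/funext => w; rewrite /r subrK.
have u0 := mean_norm_le P (bU 0%N) (hM 0%N).
have u1 := mean_norm_le P (bU 1%N) (hM 1%N).
rewrite /poisson_pmf h_gt0 !fact0 in hr *; rewrite expr0 expr1 !invr1 !mul1r !mulr1 in hr *.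
set e := expR (- h) in hr *.
have e1 : 1 - h <= e by exact: expR_ge1Dx.
have e2 : e <= 1 - h + h ^+ 2.
  rewrite /e expRN; apply: (@le_trans _ _ (1 + h)^-1).
    by rewrite lef_pV2 ?posrE ?expR_gt0 ?expR_ge1Dx// ltr_wpDl.
  rewrite -div1r ler_pdivrMr; last by rewrite ltr_wpDl.
  rewrite (_ : _ * _ = 1 + h ^+ 3); last by ring.
  by rewrite lerDl exprn_ge0// ltW.
set a := mean P (U 0%N) in u0 *; set b := mean P (U 1%N) in u1 *.
rewrite (_ : _ - _ = mean P r + ((e - (1 - h)) * a + h * (e - 1) * b)); last by ring.
apply: le_trans (ler_normD _ _) _.
have l1 : `|(e - (1 - h)) * a| <= h ^+ 2 * M.
  by rewrite normrM ler_pM// ger0_norm; lra.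
have l2 : `|h * (e - 1) * b| <= h ^+ 2 * M.
  rewrite normrM ler_pM// normrM (ger0_norm (ltW h_gt0)) expr2 ler_pM2l//.
  have h2 : h ^+ 2 <= h by rewrite expr2 ler_piMr// ltW.
  by rewrite ler0_norm; lra.
have l3 : M * (1 - (e + h * e)) <= M * h ^+ 2.
  by rewrite ler_wpM2l//; have := ler_wpM2l (ltW h_gt0) e1; lra.
have := ler_normD ((e - (1 - h)) * a) (h * (e - 1) * b); lra.
Qed.

End poisson_grid.

(** * Correctors for the characteristic function *)

Section primitives.
Context (R : realType).
Implicit Types (t a b x p : R) (m : nat).

Definition wave (t a b : R) (m : nat) : R :=
  a * cos (t * m%:R) + b * sin (t * m%:R).

(** The discrete primitive of [wave t a b]; the half step [t / 2] comes from
    writing [cos (t * m)] and [sin (t * m)] as differences. *)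
Definition wave_prim (t a b : R) (m : nat) : R :=
  (a * sin (t * m%:R - t / 2) - b * cos (t * m%:R - t / 2)) / (2 * sin (t / 2)).

Lemma wave_primS t a b m : sin (t / 2) != 0 ->
  wave_prim t a b m.+1 = wave_prim t a b m + wave t a b m.
Proof.
move=> s0; rewrite /wave_prim /wave.
have -> : t * m.+1%:R - t / 2 = t * m%:R + t / 2 by rewrite -addn1 natrD; field.
rewrite sinD cosD sinB cosB; field; exact: s0.
Qed.

Lemma wave_le t a b m : `|wave t a b m| <= `|a| + `|b|.
Proof.
by rewrite (le_trans (ler_normD _ _))// !normrM lerD// ler_piMr// ?cos_max ?sin_max.
Qed.

Definition prim_bound (t a b : R) : R := (`|a| + `|b|) / `|2 * sin (t / 2)|.

Lemma wave_prim_le t a b m : `|wave_prim t a b m| <= prim_bound t a b.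
Proof.
rewrite /wave_prim /prim_bound normrM normfV ler_wpM2r ?invr_ge0//.
by rewrite (le_trans (ler_normB _ _))// !normrM lerD// ler_piMr// ?cos_max ?sin_max.
Qed.

Lemma prim_bound_ge0 t a b : 0 <= prim_bound t a b.
Proof. by rewrite mulr_ge0// ?invr_ge0// addr_ge0. Qed.

Lemma wave_sqr t a b m :
  wave t a b m ^+ 2 = (a ^+ 2 + b ^+ 2) / 2
    + wave (2 * t) ((a ^+ 2 - b ^+ 2) / 2) (a * b) m.
Proof.
rewrite /wave (_ : 2 * t * m%:R = (t * m%:R) *+ 2); last by rewrite -mulrA mulr_natl.
rewrite cos_mulr2n sin_mulr2n; have := cos2Dsin2 (t * m%:R).
move: (cos _) (sin _) => c s e; have -> : (a * c + b * s) ^+ 2 =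
  a ^+ 2 * c ^+ 2 + b ^+ 2 * s ^+ 2 + 2 * a * b * c * s by ring.
by have -> : s ^+ 2 = 1 - c ^+ 2 by [rewrite -e addrC addKr]; rewrite !mulr2n; field.
Qed.

End primitives.

(** The perturbed test function.  Write [r] for the integrand [wave theta a b]
    and consider one step of the chain [(x, m)] of the accumulated integral and
    the number of jumps.  The term of order [eps] cancels the oscillating drift
    [- eps * r * sin x]; its own drift [eps ^+ 2 * r * wave_prim * cos x] has a
    constant part, which becomes the variance, and an oscillating part of
    frequency [2 * theta], which the term of order [eps ^+ 2] cancels.  This is
    where both [sin (theta / 2)] and [sin theta] have to be nonzero. *)
Section perturbed.
Context (R : realType).
Variables (theta a b : R).
Hypothesis sin_half : sin (theta / 2) != 0.
Hypothesis sin_full : sin theta != 0.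
Implicit Types (x eps h : R) (m : nat).

Let r := wave theta a b.
Let r1 := wave_prim theta a b.

Definition second_prim (m : nat) : R :=
  (wave_prim theta a b m ^+ 2
   - wave_prim (2 * theta) ((a ^+ 2 - b ^+ 2) / 2) (a * b) m) / 2.

Definition rate : R := (a ^+ 2 + b ^+ 2) / 4.

Let r2 := second_prim.
Let A : R := `|a| + `|b|.
Let B1 := prim_bound theta a b.
Let B2 := (B1 ^+ 2 + prim_bound (2 * theta) ((a ^+ 2 - b ^+ 2) / 2) (a * b)) / 2.

Let r1S m : r1 m.+1 = r1 m + r m.
Proof. exact: wave_primS. Qed.

Let r2S m : r2 m.+1 = r2 m + (r m * r1 m + rate).
Proof.
have h2 : 2 * theta / 2 = theta by field.
rewrite /r2 /second_prim -/r1 r1S wave_primS ?h2//.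
have := wave_sqr theta a b m; rewrite -/(r m) /rate => e.
have -> : wave (2 * theta) ((a ^+ 2 - b ^+ 2) / 2) (a * b) m =
  r m ^+ 2 - (a ^+ 2 + b ^+ 2) / 2 by rewrite e; ring.
by field.
Qed.

Let rA m : `|r m| <= A. Proof. exact: wave_le. Qed.
Let r1B m : `|r1 m| <= B1. Proof. exact: wave_prim_le. Qed.
Let r2B m : `|r2 m| <= B2.
Proof.
rewrite /r2 /second_prim normrM [`|2^-1|]ger0_norm// ler_pM2r//.
rewrite (le_trans (ler_normB _ _))// lerD//; last exact: wave_prim_le.
by rewrite normrX lerXn2r ?nnegrE ?prim_bound_ge0// wave_prim_le.
Qed.
Let A0 : 0 <= A. Proof. by rewrite addr_ge0. Qed.
Let B10 : 0 <= B1. Proof. exact: prim_bound_ge0. Qed.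
Let B20 : 0 <= B2.
Proof. by rewrite divr_ge0// addr_ge0// ?prim_bound_ge0// exprn_ge0. Qed.
Let rate0 : 0 <= rate. Proof. by rewrite divr_ge0// addr_ge0// sqr_ge0. Qed.

Definition perturbed (eps x : R) (m : nat) : R :=
  cos x + eps * (sin x * wave_prim theta a b m) - eps ^+ 2 * (cos x * second_prim m).

Lemma perturbed_dist : exists2 C : R, 0 <= C & forall eps x m, 0 <= eps <= 1 ->
  `|perturbed eps x m - cos x| <= C * eps.
Proof.
exists (B1 + B2); first exact: addr_ge0.
move=> eps x m /andP[e0 e1]; rewrite /perturbed -/r1 -/r2.
rewrite [X in `|X|](_ : _ = eps * (sin x * r1 m - eps * (cos x * r2 m))); last by ring.
rewrite normrM (ger0_norm e0) mulrC ler_wpM2r// (le_trans (ler_normB _ _))// lerD//.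
  by rewrite normrM -[leRHS]mul1r ler_pM// sin_max.
rewrite normrM (ger0_norm e0) normrM -[leRHS]mul1r ler_pM ?mulr_ge0//.
by rewrite -[leRHS]mul1r; exact: ler_pM (cos_max x) (r2B m).
Qed.

Lemma perturbed_step : exists2 C : R, 0 <= C & forall eps h x m, 0 <= eps <= 1 -> 0 <= h <= 1 ->
  `|(1 - h) * perturbed eps (x + eps * h * r m) m
    + h * perturbed eps (x + eps * h * r m) m.+1
    - (1 - eps ^+ 2 * h * rate) * perturbed eps x m| <= C * (eps ^+ 3 * h + h ^+ 2).
Proof.
pose C1 := A ^+ 2 * (2 + 2 * B1 + 2 * B2) + A * (A + (A * B1 + rate)).
pose C2 := A * B2 + rate * (B1 + B2).
have C10 : 0 <= C1 by rewrite addr_ge0// mulr_ge0// ?exprn_ge0// ?addr_ge0// mulr_ge0.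
have C20 : 0 <= C2 by rewrite addr_ge0// mulr_ge0// addr_ge0.
exists (C1 + C2); first exact: addr_ge0.
move=> eps h x m /andP[e0 e1] /andP[h0 h1].
set y := eps * h * r m.
rewrite /perturbed -/r1 -/r2 r1S r2S.
have hy : `|y| <= h * A.
  rewrite /y !normrM (ger0_norm e0) (ger0_norm h0) ler_pM ?mulr_ge0//.
  by rewrite -[leRHS]mul1r ler_wpM2r.
have hy2 : y ^+ 2 <= h ^+ 2 * A ^+ 2.
  by rewrite -exprMn -[y ^+ 2]real_normK ?num_real// lerXn2r ?nnegrE ?mulr_ge0.
pose d1 := cos (x + y) - cos x + y * sin x.
pose d2 := sin (x + y) - sin x - y * cos x.
have hd1 : `|d1| <= 2 * (h ^+ 2 * A ^+ 2).
  by apply: le_trans (cos_taylor1 _ _) _; rewrite ler_pM2l.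
have hd2 : `|d2| <= 2 * (h ^+ 2 * A ^+ 2).
  by apply: le_trans (sin_taylor1 _ _) _; rewrite ler_pM2l.
have hs : `|sin (x + y) - sin x| <= h * A.
  by apply: le_trans (dist_sin _ _) _; rewrite addrC addKr.
have hc : `|cos (x + y) - cos x| <= h * A.
  by apply: le_trans (dist_cos _ _) _; rewrite addrC addKr.
rewrite [X in `|X|](_ : _ = d1 + eps * (r1 m * d2) - eps ^+ 2 * (r2 m * d1)
  + h * (eps * (r m * (sin (x + y) - sin x)))
  - h * (eps ^+ 2 * ((r m * r1 m + rate) * (cos (x + y) - cos x)))
  + eps ^+ 3 * h * (r m * (r2 m * sin x))
  + eps ^+ 3 * h * (rate * (sin x * r1 m - eps * (cos x * r2 m)))); last first.
  by rewrite /d1 /d2 /y; ring.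
have e2 : 0 <= eps ^+ 2 <= 1 by rewrite exprn_ge0//= exprn_ile1.
have e3 : 0 <= eps ^+ 3 * h by rewrite mulr_ge0// exprn_ge0.
have small (z u v : R) : 0 <= z <= 1 -> `|u| <= v -> `|z * u| <= v.
  move=> /andP[z0 z1] uv; rewrite normrM (ger0_norm z0).
  by rewrite -[leRHS]mul1r ler_pM.
have t2 : `|eps * (r1 m * d2)| <= B1 * (2 * (h ^+ 2 * A ^+ 2)).
  by apply: small; rewrite ?e0// normrM ler_pM.
have t3 : `|eps ^+ 2 * (r2 m * d1)| <= B2 * (2 * (h ^+ 2 * A ^+ 2)).
  by apply: small; rewrite ?e2// normrM ler_pM.
have t4 : `|h * (eps * (r m * (sin (x + y) - sin x)))| <= h * (A * (h * A)).
  by rewrite normrM (ger0_norm h0) ler_wpM2l// small ?e0// normrM ler_pM.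
have t5 : `|h * (eps ^+ 2 * ((r m * r1 m + rate) * (cos (x + y) - cos x)))|
    <= h * ((A * B1 + rate) * (h * A)).
  rewrite normrM (ger0_norm h0) ler_wpM2l// small// normrM ler_pM//.
  by rewrite (le_trans (ler_normD _ _))// normrM lerD ?ler_pM// ger0_norm.
have t6 : `|eps ^+ 3 * h * (r m * (r2 m * sin x))| <= eps ^+ 3 * h * (A * B2).
  rewrite normrM (ger0_norm e3) ler_wpM2l// normrM ler_pM// normrM.
  by rewrite -[leRHS]mulr1 ler_pM// sin_max.
have t7 : `|eps ^+ 3 * h * (rate * (sin x * r1 m - eps * (cos x * r2 m)))|
    <= eps ^+ 3 * h * (rate * (B1 + B2)).
  rewrite normrM (ger0_norm e3) ler_wpM2l// normrM (ger0_norm rate0) ler_wpM2l//.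
  rewrite (le_trans (ler_normB _ _))//; apply: lerD.
    by rewrite normrM -[leRHS]mul1r; exact: ler_pM (normr_ge0 _) (normr_ge0 _) (sin_max x) (r1B m).
  apply: small; first by rewrite e0.
  by rewrite normrM -[leRHS]mul1r; exact: ler_pM (normr_ge0 _) (normr_ge0 _) (cos_max x) (r2B m).
have triD (u v s t : R) : `|u| <= s -> `|v| <= t -> `|u + v| <= s + t.
  by move=> us vt; rewrite (le_trans (ler_normD _ _))// lerD.
have triB (u v s t : R) : `|u| <= s -> `|v| <= t -> `|u - v| <= s + t.
  by move=> us vt; rewrite (le_trans (ler_normB _ _))// lerD.
apply: le_trans (triD _ _ _ _ (triD _ _ _ _ (triB _ _ _ _ (triD _ _ _ _
  (triB _ _ _ _ (triD _ _ _ _ hd1 t2) t3) t4) t5) t6) t7) _.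
rewrite [leLHS](_ : _ = C1 * h ^+ 2 + C2 * (eps ^+ 3 * h)); last first.
  by rewrite /C1 /C2; ring.
have := mulr_ge0 C10 e3; have := mulr_ge0 C20 (sqr_ge0 h).
by clearbody C1 C2; move: (eps ^+ 3 * h) (h ^+ 2) => z1 z2; lra.
Qed.

Lemma perturbed_le : exists2 M : R, 0 <= M &
  forall eps x m, 0 <= eps <= 1 -> `|perturbed eps x m| <= M.
Proof.
have [C C0 hC] := perturbed_dist; exists (1 + C); first by rewrite addr_ge0.
move=> eps x m /[dup] e01 /andP[e0 e1].
rewrite -[perturbed _ _ _](subrK (cos x)) (le_trans (ler_normD _ _))// addrC lerD ?cos_max//.
by rewrite (le_trans (hC _ _ _ e01))// ler_piMr.
Qed.

Lemma rate_ge0 : 0 <= rate.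
Proof. exact: rate0. Qed.

End perturbed.

(** * Sums of waves along the Poisson grid *)

Lemma expRN_taylor (R : realType) (x : R) : 0 <= x -> `|expR (- x) - (1 - x)| <= x ^+ 2.
Proof.
move=> x0; rewrite ger0_norm; last by rewrite subr_ge0 expR_ge1Dx.
rewrite lerBlDr expRN -div1r ler_pdivrMr ?expR_gt0//.
apply: (@le_trans _ _ ((x ^+ 2 + (1 - x)) * (1 + x))).
  by rewrite (_ : _ * _ = 1 + x ^+ 3); [rewrite lerDl exprn_ge0|ring].
rewrite ler_wpM2l ?expR_ge1Dx//.
by have := sqr_ge0 (x - 1); have := sqr_ge0 x; rewrite sqrrB; lra.
Qed.

Section grid_sum.
Context (R : realType) (d : measure_display) (Omega : measurableType d).
Context (P : probability Omega R) (N : R -> Omega -> nat).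
Hypothesis poissonN : standard_poisson_process P N.
Variable theta : R.

Definition grid_sum (h c : R) (al be : nat -> R) (n : nat) (w : Omega) : R :=
  \sum_(k < n) c * wave theta (al k) (be k) (gridN N h k w).

Lemma grid_sumS h c al be n w : grid_sum h c al be n.+1 w =
  grid_sum h c al be n w + c * wave theta (al n) (be n) (gridN N h n w).
Proof. by rewrite /grid_sum big_ord_recr. Qed.

Lemma past_grid_sum h c al be n : 0 < h -> past N h n (grid_sum h c al be n).
Proof.
move=> h0; elim: n => [|n IH]; first by move=> w w' _; rewrite /grid_sum !big_ord0.
move=> w w' e; rewrite !grid_sumS (pastS IH e).
congr (_ + c * _).
exact: (pastS (past_gridN poissonN h0 (wave theta (al n) (be n)) (k := n)) e).
Qed.

Section characteristic.
Hypothesis sin_half : sin (theta / 2) != 0.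
Hypothesis sin_full : sin theta != 0.

(** Over one step the mean of the perturbed test function is multiplied by
    [1 - eps ^+ 2 * h * rate a b] up to [O(eps ^+ 3 * h + h ^+ 2)]; iterate over
    the [K] steps of a block on which the integrand keeps its coefficients. *)
Lemma block_char (a b : R) : exists2 C : R, 0 <= C &
  forall (eps h : R) (k K : nat) (S : nat -> Omega -> R),
    0 <= eps <= 1 -> 0 < h <= 1 ->
    (forall j, past N h (k + j) (S j)) ->
    (forall j w, (j < K)%N ->
      S j.+1 w = S j w + eps * h * wave theta a b (gridN N h (k + j) w)) ->
    `|mean P (fun w => cos (S K w))
      - expR (- (eps ^+ 2 * h * K%:R * rate a b)) * mean P (fun w => cos (S 0%N w))|
    <= C * (eps + K%:R * (eps ^+ 3 * h + h ^+ 2)).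
Proof.
have [C1 C10 hC1] := perturbed_dist theta a b.
have [C2 C20 hC2] := perturbed_step a b sin_half sin_full.
have [M M0 hM] := perturbed_le theta a b.
have r0 := rate_ge0 a b.
pose C3 := 3 * M + C2 + rate a b ^+ 2 * M.
have C30 : 0 <= C3.
  by apply: addr_ge0; [apply: addr_ge0 => //|]; apply: mulr_ge0 => //; exact: sqr_ge0.
exists (2 * C1 + C3); first by rewrite addr_ge0// mulr_ge0.
move=> eps h k K S /[dup] e01 /andP[e0 e1] /andP[h0 h1] pS hS.
have h01 : 0 <= h <= 1 by rewrite ltW.
have e2 : 0 <= eps ^+ 2 <= 1 by rewrite exprn_ge0//= exprn_ile1.
pose G j w := perturbed theta a b eps (S j w) (gridN N h (k + j) w).
pose U j m w := perturbed theta a b eps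
  (S j w + eps * h * wave theta a b (gridN N h (k + j) w)) (gridN N h (k + j) w + m).
have pG j : past N h (k + j) (G j).
  move=> w w' e; rewrite /G (pS j _ _ e).
  by rewrite (past_gridN poissonN h0 (perturbed theta a b eps (S j w')) e).
have pU j m : past N h (k + j) (U j m).
  move=> w w' e; rewrite /U (pS j _ _ e).
  by rewrite (past_gridN poissonN h0 (fun n => perturbed theta a b eps
       (S j w' + eps * h * wave theta a b n) (n + m)) e).
have bG j : bounded_rv (G j) by apply: (past_bounded poissonN h0 (pG j)) => w; exact: hM.
have bU j m : bounded_rv (U j m) by apply: (past_bounded poissonN h0 (pU j m)) => w; exact: hM.
have bc j : bounded_rv (fun w => cos (S j w)).
  by apply: bounded_rv_cos; exact: (past_measurable poissonN h0 (pS j)).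
have Gcos j : `|mean P (G j) - mean P (fun w => cos (S j w))| <= C1 * eps.
  by apply: mean_dist_le => // w; exact: hC1.
pose e := expR (- (eps ^+ 2 * h * rate a b)).
have e_le1 : e <= 1.
  rewrite /e -expR0 ler_expR oppr_le0; apply: mulr_ge0 => //.
  by apply: mulr_ge0; [exact: sqr_ge0|exact: ltW].
have e_ge0 : 0 <= e by exact: expR_ge0.
have step j : (j < K)%N ->
    `|mean P (G j.+1) - e * mean P (G j)| <= C3 * (eps ^+ 3 * h + h ^+ 2).
  move=> jK.
  have s1 : `|mean P (G j.+1) - ((1 - h) * mean P (U j 0%N) + h * mean P (U j 1%N))|
      <= 3 * M * h ^+ 2.
    have -> : G j.+1 = fun w => U j (gridD N h (k + j) w) w.
      by apply/funext => w; rewrite /G /U hS// addnS (gridN_succ poissonN).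
    by apply: (mean_step poissonN h0) => // m w; exact: hM.
  have s2 : `|((1 - h) * mean P (U j 0%N) + h * mean P (U j 1%N))
       - (1 - eps ^+ 2 * h * rate a b) * mean P (G j)| <= C2 * (eps ^+ 3 * h + h ^+ 2).
    rewrite -!meanZ// -meanD//; [|exact: bounded_rvZ..].
    apply: mean_dist_le; [by apply: bounded_rvD; exact: bounded_rvZ|exact: bounded_rvZ|].
    by move=> w; rewrite /U /G addn0 addn1; exact: hC2.
  have s3 : `|(1 - eps ^+ 2 * h * rate a b) * mean P (G j) - e * mean P (G j)|
      <= rate a b ^+ 2 * M * h ^+ 2.
    rewrite -mulrBl normrM [leRHS]mulrAC; apply: ler_pM => //; last first.
      by apply: mean_norm_le => // w; exact: hM.
    rewrite -normrN opprB; apply: le_trans (expRN_taylor _) _.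
      by apply: mulr_ge0 => //; apply: mulr_ge0; [exact: sqr_ge0|exact: ltW].
    rewrite (_ : _ ^+ 2 = (eps ^+ 2) ^+ 2 * (rate a b ^+ 2 * h ^+ 2)); last by ring.
    rewrite ler_piMl//; first by apply: mulr_ge0; exact: sqr_ge0.
    by case/andP: e2 => ? ?; rewrite exprn_ile1.
  have h20 := sqr_ge0 h; have e3 : 0 <= eps ^+ 3 * h by rewrite mulr_ge0 ?exprn_ge0// ltW.
  rewrite [X in `|X|](_ : _ = (mean P (G j.+1) - ((1 - h) * mean P (U j 0%N) + h * mean P (U j 1%N)))
   + (((1 - h) * mean P (U j 0%N) + h * mean P (U j 1%N))
       - (1 - eps ^+ 2 * h * rate a b) * mean P (G j))
   + ((1 - eps ^+ 2 * h * rate a b) * mean P (G j) - e * mean P (G j))); last by ring.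
  apply: le_trans (ler_normD _ _) _; apply: le_trans (lerD (ler_normD _ _) (lexx _)) _.
  apply: le_trans (lerD (lerD s1 s2) s3) _.
  have q1 : 0 <= M * (eps ^+ 3 * h) by exact: mulr_ge0.
  have q2 : 0 <= rate a b ^+ 2 * M * (eps ^+ 3 * h).
    by apply: mulr_ge0 => //; apply: mulr_ge0 => //; exact: sqr_ge0.
  by rewrite /C3 !mulrDl !mulrDr; lra.
have iter n : (n <= K)%N ->
    `|mean P (G n) - e ^+ n * mean P (G 0%N)| <= n%:R * (C3 * (eps ^+ 3 * h + h ^+ 2)).
  elim: n => [|n IH] nK; first by rewrite expr0 mul1r subrr normr0 mul0r.
  rewrite [X in `|X|](_ : _ = (mean P (G n.+1) - e * mean P (G n))
     + e * (mean P (G n) - e ^+ n * mean P (G 0%N))); last by rewrite exprS; ring.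
  apply: le_trans (ler_normD _ _) _.
  rewrite -natr1 [leRHS]mulrDl mul1r [leRHS]addrC lerD ?step//.
  rewrite normrM (ger0_norm e_ge0) (le_trans _ (IH (ltnW nK)))//.
  by rewrite ler_piMl.
have := iter K (leqnn K); rewrite /e -expRM_natl mulrN.
rewrite (_ : K%:R * (eps ^+ 2 * h * rate a b) = eps ^+ 2 * h * K%:R * rate a b); last by ring.
set E := expR _ => iK.
have E_le1 : E <= 1.
  rewrite /E -expR0 ler_expR oppr_le0; apply: mulr_ge0 => //; apply: mulr_ge0 => //.
  by apply: mulr_ge0; [exact: sqr_ge0|exact: ltW].
have E_ge0 : 0 <= E by exact: expR_ge0.
rewrite [X in `|X|](_ : _ = - (mean P (G K) - mean P (fun w => cos (S K w)))
  + (mean P (G K) - E * mean P (G 0%N))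
  + E * (mean P (G 0%N) - mean P (fun w => cos (S 0%N w)))); last by ring.
apply: le_trans (ler_normD _ _) _; apply: le_trans (lerD (ler_normD _ _) (lexx _)) _.
rewrite normrN normrM (ger0_norm E_ge0).
have g0 : E * `|mean P (G 0%N) - mean P (fun w => cos (S 0%N w))| <= C1 * eps.
  by apply: le_trans (Gcos 0%N); rewrite ler_piMl.
apply: le_trans (lerD (lerD (Gcos K) iK) g0) _.
have X0 : 0 <= K%:R * (eps ^+ 3 * h + h ^+ 2).
  by rewrite mulr_ge0// addr_ge0 ?sqr_ge0// mulr_ge0 ?exprn_ge0// ltW.
rewrite [K%:R * (C3 * _)]mulrCA.
have := mulr_ge0 C10 X0; have := mulr_ge0 C30 e0.
by move: (K%:R * _) => X; rewrite !mulrDl !mulrDr; lra.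
Qed.

(** The blocks decouple because the error of [block_char] does not depend on
    the phase accumulated before the block. *)
Lemma grid_char (J : nat) (a b : nat -> R) (p : R) : exists2 C : R, 0 <= C &
  forall (eps h : R) (K : nat), 0 <= eps <= 1 -> 0 < h <= 1 ->
    `|mean P (fun w => cos (grid_sum h (eps * h) (fun k => a (k %/ K)%N)
         (fun k => b (k %/ K)%N) (J * K) w + p))
      - expR (- (eps ^+ 2 * h * K%:R * \sum_(j < J) rate (a j) (b j))) * cos p|
    <= C * (eps + K%:R * (eps ^+ 3 * h + h ^+ 2)).
Proof.
elim: J => [|J [C C0 IH]].
  exists 0 => // eps h K _ _; rewrite mul0n big_ord0 mulr0 oppr0 expR0 mul1r mul0r.
  by under eq_fun do rewrite /grid_sum big_ord0 add0r; rewrite mean_cst subrr normr0.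
have [C' C'0 hC'] := block_char (a J) (b J).
exists (C' + C); first exact: addr_ge0.
move=> eps h K /[dup] e01 /andP[e0 e1] /[dup] h01 /andP[h0 h1].
pose S j w := grid_sum h (eps * h) (fun k => a (k %/ K)%N) (fun k => b (k %/ K)%N)
  (J * K + j) w + p.
have := hC' eps h (J * K)%N K S e01 h01.
have pS j : past N h (J * K + j) (S j).
  by move=> w w' e; rewrite /S (past_grid_sum _ _ _ h0 e).
move=> /(_ pS); have sS j w : (j < K)%N -> S j.+1 w = S j w +
    eps * h * wave theta (a J) (b J) (gridN N h (J * K + j) w).
  move=> jK; rewrite /S addnS grid_sumS divnMDl ?(leq_ltn_trans _ jK)//.
  by rewrite divn_small// addn0 addrAC.
move=> /(_ sS); rewrite mulSn addnC /S addn0.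
set T := mean P _; set T0 := mean P _ => hb.
have := IH eps h K e01 h01; rewrite -/T0 => hi.
rewrite big_ord_recr/= mulrDr opprD expRD.
set E := expR (- (eps ^+ 2 * h * K%:R * rate (a J) (b J))) in hb *.
set E' := expR _ in hi *.
have r0 := rate_ge0 (a J) (b J).
have E_le1 : E <= 1.
  rewrite /E -expR0 ler_expR oppr_le0; apply: mulr_ge0 => //; apply: mulr_ge0 => //.
  by apply: mulr_ge0; [exact: sqr_ge0|exact: ltW].
have E_ge0 : 0 <= E by exact: expR_ge0.
rewrite [X in `|X|](_ : _ = (T - E * T0) + E * (T0 - E' * cos p)); last by ring.
rewrite (le_trans (ler_normD _ _))// mulrDl lerD// normrM (ger0_norm E_ge0).
by rewrite (le_trans _ hi)// ler_piMl.
Qed.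

End characteristic.

(** ** The L2 bound *)

(** Here [c], [s] are the correlations of the sum with the current phase, [u],
    [v] those after the sum is incremented, and [q] its second moment.  The
    correlations decay at rate [kappa * h], which pays for the growth of [q]:
    [q + c ^+ 2 + s ^+ 2] is a Lyapunov function. *)
Lemma lyapunov_step (kappa h eps om q c s u v : R) :
  0 < kappa <= 2 -> 0 < h <= 2^-1 -> 0 <= eps -> 0 <= om ->
  `|u - c| <= eps * h * om -> `|v - s| <= eps * h * om ->
  q + 2 * (eps * h) * (om * (`|c| + `|s|)) + (eps * h) ^+ 2 * om ^+ 2
   + (1 - 2 * h * (1 - h) * kappa) * (u ^+ 2 + v ^+ 2) <=
  q + (c ^+ 2 + s ^+ 2) + (8 / kappa + 3) * (h * eps ^+ 2 * om ^+ 2).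
Proof.
move=> /andP[k0 k2] /andP[h0 h2] e0 om0 hu hv; set g := eps * h * om.
have g0 : 0 <= g by apply: mulr_ge0 => //; apply: mulr_ge0 => //; exact: ltW.
have sq (x y : R) : `|x - y| <= g -> x ^+ 2 <= `|y| ^+ 2 + 2 * g * `|y| + g ^+ 2.
  move=> xy; have xy' : `|x| <= `|y| + g.
    by rewrite -[x](subrK y) (le_trans (ler_normD _ _))// addrC lerD2l.
  rewrite -(real_normK (num_real x)).
  rewrite (_ : `|y| ^+ 2 + 2 * g * `|y| + g ^+ 2 = (`|y| + g) ^+ 2); last by ring.
  by apply: lerXn2r => //; rewrite nnegrE// addr_ge0.
move: (sq _ _ hu) (sq _ _ hv) => {sq hu hv}.
rewrite -(real_normK (num_real c)) -(real_normK (num_real s)).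
have [c' -> c0] : exists2 c', `|c| = c' & 0 <= c' by exists `|c|.
have [s' -> s0] : exists2 s', `|s| = s' & 0 <= s' by exists `|s|.
move=> hu hv.
pose D1 := c' ^+ 2 + s' ^+ 2 + (2 * g * (c' + s') + 2 * g ^+ 2).
have hD : u ^+ 2 + v ^+ 2 <= D1 by rewrite /D1; lra.
have hk0 : 0 <= h * kappa by rewrite mulr_ge0// ltW.
have hk1 : h * kappa <= 1.
  by rewrite -[leRHS](mulVf (x := 2))// ler_pM// ltW.
have f1 : (1 - 2 * h * (1 - h) * kappa) * (u ^+ 2 + v ^+ 2) <= (1 - h * kappa) * D1.
  apply: (@le_trans _ _ ((1 - h * kappa) * (u ^+ 2 + v ^+ 2))).
    rewrite ler_wpM2r ?addr_ge0 ?sqr_ge0//.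
    have : 0 <= h * kappa * (1 - 2 * h) by rewrite mulr_ge0//; lra.
    by lra.
  by rewrite ler_wpM2l// subr_ge0.
have f2 : 0 <= h * kappa * (2 * g * (c' + s') + 2 * g ^+ 2).
  by apply: mulr_ge0 => //; apply: addr_ge0; apply: mulr_ge0 => //;
    [exact: mulr_ge0|exact: addr_ge0|exact: sqr_ge0].
have i1 : g ^+ 2 <= h * eps ^+ 2 * om ^+ 2.
  rewrite (_ : g ^+ 2 = h * (h * eps ^+ 2 * om ^+ 2)); last by rewrite /g; ring.
  rewrite ler_piMl//; last by lra.
  by apply: mulr_ge0; [apply: mulr_ge0; [exact: ltW|]|]; exact: sqr_ge0.
have i2 : 4 * g * (c' + s') <= h * kappa * (c' ^+ 2 + s' ^+ 2) + 8 / kappa * (h * eps ^+ 2 * om ^+ 2).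
  have p1 : 0 <= h / (2 * kappa) * (kappa * (c' + s') - 4 * (eps * om)) ^+ 2.
    by rewrite mulr_ge0 ?sqr_ge0// divr_ge0// ?mulr_ge0// ltW.
  have p2 : 0 <= h * kappa / 2 * (c' - s') ^+ 2 by rewrite mulr_ge0 ?sqr_ge0// divr_ge0.
  rewrite -subr_ge0 [leRHS](_ : _ = h / (2 * kappa) * (kappa * (c' + s') - 4 * (eps * om)) ^+ 2
      + h * kappa / 2 * (c' - s') ^+ 2); first exact: addr_ge0.
  by rewrite /g; field; rewrite gt_eqF.
have e1 : 2 * (eps * h) * (om * (c' + s')) = 2 * g * (c' + s') by rewrite /g; ring.
have e2 : (eps * h) ^+ 2 * om ^+ 2 = g ^+ 2 by rewrite /g; ring.
have e3 : (1 - h * kappa) * D1 = D1 - h * kappa * (c' ^+ 2 + s' ^+ 2)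
    - h * kappa * (2 * g * (c' + s') + 2 * g ^+ 2) by rewrite /D1; ring.
rewrite e1 e2; move: f1; rewrite e3 => f1.
apply: le_trans (lerD (lexx _) f1) _; rewrite /D1.
move: i1 i2 f2; move: (8 / kappa) (h * eps ^+ 2 * om ^+ 2) => X Y i1 i2 f2.
by lra.
Qed.

(** A second moment bound by the L2 norm of the coefficients, uniformly in the
    mesh and in [eps]: the phase decorrelates at rate [1 - cos theta].  The
    second term vanishes with the mesh [h]. *)
Lemma grid_L2 : cos theta < 1 -> exists2 C : R, 0 <= C &
  forall (h eps A : R) (al be : nat -> R) (n : nat), 0 < h <= 2^-1 -> 0 <= eps ->
    (forall k, `|al k| + `|be k| <= A) ->
    mean P (fun w => grid_sum h (eps * h) al be n w ^+ 2) <=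
      C * \sum_(k < n) eps ^+ 2 * h * (al k ^+ 2 + be k ^+ 2)
      + 12 * (n%:R * (eps * h * A)) ^+ 2 * h ^+ 2 *+ n.
Proof.
move=> cos1; pose kappa := 1 - cos theta.
have k02 : 0 < kappa <= 2.
  by have := cos_geN1 theta; rewrite /kappa; lra.
have /andP[k0 k2] := k02.
exists (2 * (8 / kappa + 3)); first by rewrite mulr_ge0// addr_ge0// divr_ge0// ltW.
move=> h eps A al be n /[dup] h02 /andP[h0 h2] e0 hA.
have h1 : h <= 1 by lra.
have A0 : 0 <= A by apply: le_trans (hA 0%N); rewrite addr_ge0.
have eh0 : 0 <= eps * h by rewrite mulr_ge0// ltW.
pose B := n%:R * (eps * h * A).
have B0 : 0 <= B by rewrite !mulr_ge0// ltW.
pose S k := grid_sum h (eps * h) al be k.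
have S_le k w : (k <= n)%N -> `|S k w| <= B.
  move=> kn; rewrite (le_trans (ler_norm_sum _ _ _))//.
  apply: (@le_trans _ _ (\sum_(j < k) eps * h * A)).
    apply: ler_sum => j _; rewrite normrM (ger0_norm eh0) ler_wpM2l//.
    exact: le_trans (wave_le _ _ _ _) (hA j).
  rewrite sumr_const card_ord -mulr_natl ler_wpM2r ?mulr_ge0// ?ler_nat//; exact: ltW.
have pS k : past N h k (S k) by exact: past_grid_sum.
have bS k : (k <= n)%N -> bounded_rv (S k).
  by move=> kn; apply: (past_bounded poissonN h0 (pS k)) => w; exact: S_le.
have mN k : measurable_fun setT (fun w => theta * (gridN N h k w)%:R).
  apply: (past_measurable poissonN h0 (k := k)).
  exact: (past_gridN poissonN h0 (fun m => theta * m%:R)).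
have bcos k : bounded_rv (fun w => cos (theta * (gridN N h k w)%:R)) by exact: bounded_rv_cos.
have bsin k : bounded_rv (fun w => sin (theta * (gridN N h k w)%:R)) by exact: bounded_rv_sin.
pose q k := mean P (fun w => S k w ^+ 2).
pose c k := mean P (fun w => S k w * cos (theta * (gridN N h k w)%:R)).
pose s k := mean P (fun w => S k w * sin (theta * (gridN N h k w)%:R)).
pose om k := `|al k| + `|be k|.
have main k : (k <= n)%N -> q k + (c k ^+ 2 + s k ^+ 2) <=
    2 * (8 / kappa + 3) * \sum_(j < k) eps ^+ 2 * h * (al j ^+ 2 + be j ^+ 2)
    + 12 * B ^+ 2 * h ^+ 2 *+ k.
  elim: k => [|k IH] kn.
    rewrite big_ord0 mulr0 addr0 /q /c /s /S /grid_sum.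
    under eq_fun do rewrite big_ord0 expr0n/=; rewrite mean_cst.
    under eq_fun do rewrite big_ord0 mul0r; rewrite mean_cst.
    under eq_fun do rewrite big_ord0 mul0r; rewrite mean_cst.
    by rewrite expr0n/= !addr0.
  have {}IH := IH (ltnW kn); rewrite big_ord_recr/= mulrDr [12 * _ * _ *+ k.+1]mulrSr.
  pose u := mean P (fun w => S k.+1 w * cos (theta * (gridN N h k w)%:R)).
  pose v := mean P (fun w => S k.+1 w * sin (theta * (gridN N h k w)%:R)).
  pose W w := wave theta (al k) (be k) (gridN N h k w).
  have bW : bounded_rv W.
    apply: (past_bounded poissonN h0 (past_gridN poissonN h0 (wave theta (al k) (be k)) (k := k))).
    by move=> w; exact: wave_le.
  have SE w : S k.+1 w = S k w + eps * h * W w by rewrite /S grid_sumS.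
  have uc : `|u - c k| <= eps * h * om k.
    apply: mean_dist_le; [by apply: bounded_rvM; [exact: bS|]|by apply: bounded_rvM; [exact/bS/ltnW|]|].
    move=> w; rewrite -mulrBl SE addrC addKr normrM normrM (ger0_norm eh0).
    rewrite -[leRHS]mulr1; apply: ler_pM => //; [exact: mulr_ge0| |exact: cos_max].
    by apply: ler_wpM2l => //; exact: wave_le.
  have vs : `|v - s k| <= eps * h * om k.
    apply: mean_dist_le; [by apply: bounded_rvM; [exact: bS|]|by apply: bounded_rvM; [exact/bS/ltnW|]|].
    move=> w; rewrite -mulrBl SE addrC addKr normrM normrM (ger0_norm eh0).
    rewrite -[leRHS]mulr1; apply: ler_pM => //; [exact: mulr_ge0| |exact: sin_max].
    by apply: ler_wpM2l => //; exact: wave_le.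
  have hq : q k.+1 <= q k + 2 * (eps * h) * (om k * (`|c k| + `|s k|)) + (eps * h) ^+ 2 * om k ^+ 2.
    have bSk := bS _ (ltnW kn).
    rewrite (_ : q k.+1 = q k + 2 * (eps * h) * (al k * c k + be k * s k)
       + (eps * h) ^+ 2 * mean P (fun w => W w ^+ 2)); last first.
      rewrite /q /c /s -!meanZ -?meanD; try by do ![exact: bounded_rvM|apply: bounded_rvD|apply: bounded_rvZ].
      rewrite -meanZ -?meanD; try by do ![exact: bounded_rvM|apply: bounded_rvD|apply: bounded_rvZ].
      by congr mean; apply/funext => w; rewrite SE /W /wave; ring.
    apply: lerD; first rewrite lerD2l; first apply: ler_wpM2l; first exact: mulr_ge0.
      apply: le_trans (ler_norm _) _; apply: le_trans (ler_normD _ _) _.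
      rewrite !normrM /om mulrDl !mulrDr.
      have := mulr_ge0 (normr_ge0 (al k)) (normr_ge0 (s k)).
      by have := mulr_ge0 (normr_ge0 (be k)) (normr_ge0 (c k)); lra.
    rewrite ler_wpM2l ?sqr_ge0//; apply: le_trans (ler_norm _) _.
    apply: mean_norm_le => [|w]; first exact: bounded_rvM.
    by rewrite normrX lerXn2r ?nnegrE ?addr_ge0// wave_le.
  have step (f : R -> R) (a b : R) : (forall x, `|f x| <= 1) ->
      (forall w, f (theta * (gridN N h k w)%:R + theta) =
        a * cos (theta * (gridN N h k w)%:R) + b * sin (theta * (gridN N h k w)%:R)) ->
      mean P (fun w => S k.+1 w * f (theta * (gridN N h k.+1 w)%:R)) ^+ 2 <=
      ((1 - h) * mean P (fun w => S k.+1 w * f (theta * (gridN N h k w)%:R))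
               + h * (a * u + b * v)) ^+ 2 + 6 * B ^+ 2 * h ^+ 2.
    move=> f1 fE.
    set x := mean P (fun w => S k.+1 w * f (theta * (gridN N h k.+1 w)%:R)).
    set y := (1 - h) * _ + _.
    pose U m w := S k.+1 w * f (theta * (gridN N h k w + m)%:R).
    have pW : past N h k (fun w => S k.+1 w).
      move=> w w' e; rewrite !SE (pS k _ _ e).
      by rewrite /W (past_gridN poissonN h0 (wave theta (al k) (be k)) e).
    have U_le m w : `|U m w| <= B.
      by rewrite /U normrM -[leRHS]mulr1 ler_pM// S_le.
    have pU m : past N h k (U m).
      move=> w w' e; rewrite /U (pW _ _ e).
      by rewrite (past_gridN poissonN h0 (fun n => f (theta * (n + m)%:R)) e).
    have := @mean_step _ _ _ _ _ poissonN h h0 k U B h1 pU U_le.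
    rewrite (_ : (fun w => U (gridD N h k w) w) =
      fun w => S k.+1 w * f (theta * (gridN N h k.+1 w)%:R)); last first.
      by apply/funext => w; rewrite /U -(gridN_succ poissonN).
    rewrite (_ : U 0%N = fun w => S k.+1 w * f (theta * (gridN N h k w)%:R)); last first.
      by apply/funext => w; rewrite /U addn0.
    rewrite (_ : mean P (U 1%N) = a * u + b * v) -/x -/y; last first.
      have bc := bounded_rvM (bS _ kn) (bcos k); have bs := bounded_rvM (bS _ kn) (bsin k).
      rewrite /u /v -(meanZ P a bc) -(meanZ P b bs).
      rewrite -(meanD P (bounded_rvZ a bc) (bounded_rvZ b bs)).
      congr mean; apply/funext => w; rewrite /U natrD mulrDr mulr1 fE; ring.
    move=> xy; have xB : `|x| <= B.
      apply: mean_norm_le => [|w].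
        apply: (past_bounded poissonN h0 (k := k.+1) (M := B)) => [w w' e|w].
          rewrite (pS k.+1 _ _ e).
          by rewrite (past_gridN poissonN h0 (fun m => f (theta * m%:R)) e).
        by rewrite normrM -[leRHS]mulr1 ler_pM// S_le.
      by rewrite normrM -[leRHS]mulr1 ler_pM// S_le.
    have : `|x * (x - y)| <= B * (3 * B * h ^+ 2) by rewrite normrM ler_pM.
    move=> /(le_trans (ler_norm _)).
    by have := sqr_ge0 (x - y); rewrite sqrrB; lra.
  have hc : c k.+1 ^+ 2 <= ((1 - h) * u + h * (cos theta * u - sin theta * v)) ^+ 2
      + 6 * B ^+ 2 * h ^+ 2.
    rewrite -mulNr; apply: (step cos) => [x|w]; first exact: cos_max.
    by rewrite cosD; ring.
  have hs : s k.+1 ^+ 2 <= ((1 - h) * v + h * (sin theta * u + cos theta * v)) ^+ 2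
      + 6 * B ^+ 2 * h ^+ 2.
    apply: (step sin) => [x|w]; first exact: sin_max.
    by rewrite sinD; ring.
  have om0 : 0 <= om k by rewrite addr_ge0.
  have := @lyapunov_step kappa h eps (om k) (q k) (c k) (s k) u v k02 h02 e0 om0 uc vs.
  have e : ((1 - h) * u + h * (cos theta * u - sin theta * v)) ^+ 2
    + ((1 - h) * v + h * (sin theta * u + cos theta * v)) ^+ 2
    = (1 - 2 * h * (1 - h) * kappa) * (u ^+ 2 + v ^+ 2).
    have e1 : sin theta ^+ 2 = 1 - cos theta ^+ 2 by rewrite -(cos2Dsin2 theta) addrC addKr.
    rewrite [LHS](_ : _ = ((1 - h) ^+ 2 + 2 * h * (1 - h) * cos theta
      + h ^+ 2 * (cos theta ^+ 2 + sin theta ^+ 2)) * (u ^+ 2 + v ^+ 2)); last by ring.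
    by rewrite cos2Dsin2 /kappa; ring.
  have om2 : om k ^+ 2 <= 2 * (al k ^+ 2 + be k ^+ 2).
    rewrite -(real_normK (num_real (al k))) -(real_normK (num_real (be k))) /om.
    by have := sqr_ge0 (`|al k| - `|be k|); lra.
  have : (8 / kappa + 3) * (h * eps ^+ 2 * om k ^+ 2) <=
      2 * (8 / kappa + 3) * (eps ^+ 2 * h * (al k ^+ 2 + be k ^+ 2)).
    rewrite [leRHS](_ : _ = (8 / kappa + 3) * (h * eps ^+ 2 * (2 * (al k ^+ 2 + be k ^+ 2)))); last by ring.
    rewrite ler_wpM2l ?addr_ge0// ?divr_ge0//; first exact: ltW.
    by rewrite ler_wpM2l// mulr_ge0 ?sqr_ge0// ltW.
  rewrite -e; move: hq hc hs IH.
  move: (_ * \sum_(_ < k) _) (12 * _ * _ *+ k) => X1 X2.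
  move: (_ * (eps ^+ 2 * h * _)) (_ * (h * eps ^+ 2 * _)) => X3 X4.
  move: (_ ^+ 2 * om k ^+ 2) (2 * _ * (om k * _)) => X5 X6.
  move: (((1 - h) * u + _) ^+ 2) (((1 - h) * v + _) ^+ 2) => X7 X8.
  lra.
have := main n (leqnn n); rewrite -/(q n) -/B.
by have := sqr_ge0 (c n); have := sqr_ge0 (s n); lra.
Qed.

End grid_sum.

(** * Step functions on regular grids and their density in L2 *)

Section grid_step.
Context (R : realType).
Local Notation mu := (@lebesgue_measure R).
Local Notation allR := (setT : set (measurableTypeR R)).
Implicit Types (m L j : nat) (a : nat -> R) (s : R).

Definition grid_data m L a : step_data R :=
  [seq (a j, (j%:R / m%:R, j.+1%:R / m%:R)) | j <- iota 0 L].

Definition grid_fun m L a : R -> R := step_fun (grid_data m L a).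

Definition cell m j : set R := `]j%:R / m%:R, j.+1%:R / m%:R].

Lemma grid_funE m L a s : grid_fun m L a s = \sum_(0 <= j < L) a j * \1_(cell m j) s.
Proof. by rewrite /grid_fun /step_fun big_map /index_iota subn0. Qed.

Lemma grid_data_wf m L a : step_wf (grid_data m L a).
Proof.
move=> q /mapP[j _ ->] /=; split; first by rewrite divr_ge0.
by rewrite ler_wpM2r ?invr_ge0// ler_nat.
Qed.

Lemma cellE m j s : (0 < m)%N ->
  (s \in cell m j) = (j%:R < s * m%:R) && (s * m%:R <= j.+1%:R).
Proof.
move=> m0; have m0' : 0 < m%:R :> R by rewrite ltr0n.
by rewrite /cell mem_setE in_itv/= ltr_pdivrMr// ler_pdivlMr.
Qed.

Lemma cell_inj m i j s : (0 < m)%N -> s \in cell m i -> s \in cell m j -> i = j.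
Proof.
move=> m0; rewrite !cellE// => /andP[i1 i2] /andP[j1 j2].
have := lt_le_trans i1 j2; have := lt_le_trans j1 i2.
by rewrite !ltr_nat !ltnS => ji ij; apply/eqP; rewrite eqn_leq ij ji.
Qed.

Lemma cell_exists m s : (0 < m)%N -> 0 < s -> exists j, s \in cell m j.
Proof.
move=> m0 s0; have sm0 : 0 < s * m%:R by rewrite mulr_gt0 ?ltr0n.
have /andP[t1 t2] := truncn_itv (ltW sm0); set t := Num.truncn _ in t1 t2.
move: t1; rewrite le_eqVlt => /orP[/eqP e|t1]; last by exists t; rewrite cellE// t1 ltW.
case: t e t2 => [|t] e t2; first by move: sm0; rewrite -e ltxx.
by exists t; rewrite cellE// -e lexx ltr_nat ltnSn.
Qed.

Lemma grid_fun_cell m L a j s : (0 < m)%N -> (j < L)%N -> s \in cell m j ->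
  grid_fun m L a s = a j.
Proof.
move=> m0 jL sj; rewrite grid_funE (bigD1_seq j) ?mem_index_iota ?iota_uniq//=.
rewrite indicE sj mulr1 big1 ?addr0// => i ij; rewrite indicE.
case: (boolP (s \in cell m i)) => [si|]; last by rewrite mulr0.
by move: ij; rewrite (cell_inj m0 si sj) eqxx.
Qed.

Lemma grid_fun_out m L a s : (forall j, (j < L)%N -> s \notin cell m j) ->
  grid_fun m L a s = 0.
Proof.
move=> h; rewrite grid_funE big_nat big1// => j jL.
by rewrite indicE (negbTE (h j jL)) mulr0.
Qed.

Lemma measurable_cell m j : measurable (cell m j).
Proof. exact: measurable_itv. Qed.

Lemma measurable_grid_fun m L a : measurable_fun allR (grid_fun m L a).
Proof.
rewrite (_ : grid_fun m L a = fun s => \sum_(0 <= j < L) a j * \1_(cell m j) s).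
  by apply: measurable_sum => j; apply: measurable_funM => //;
    apply: measurable_indic; exact: measurable_cell.
by apply/funext => s; exact: grid_funE.
Qed.

Lemma grid_fun_gt m L a s : (0 < m)%N -> L%:R / m%:R < s -> grid_fun m L a s = 0.
Proof.
move=> m0 Ls; apply: grid_fun_out => j jL; rewrite cellE//.
rewrite ltr_pdivrMr ?ltr0n// in Ls.
by rewrite negb_and -!leNgt -!ltNge (le_lt_trans _ Ls) ?orbT// ler_nat.
Qed.

Lemma grid_fun_le0 m L a s : (0 < m)%N -> s <= 0 -> grid_fun m L a s = 0.
Proof.
move=> m0 s0; apply: grid_fun_out => j jL; rewrite cellE//.
by rewrite negb_and -leNgt (le_trans (mulr_le0_ge0 s0 _)).
Qed.

Lemma grid_fun_le m L a (M : R) : 0 <= M -> (forall j, `|a j| <= M) ->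
  (0 < m)%N -> forall s, `|grid_fun m L a s| <= M.
Proof.
move=> M0 hM m0 s.
have [[j [jL sj]]|no] := pselect (exists j, (j < L)%N /\ s \in cell m j).
  by rewrite (grid_fun_cell _ m0 jL sj).
rewrite grid_fun_out ?normr0// => j jL; apply/negP => sj; apply: no; by exists j.
Qed.

Lemma grid_fun_sqr m L a s : (0 < m)%N ->
  grid_fun m L a s ^+ 2 = grid_fun m L (fun j => a j ^+ 2) s.
Proof.
move=> m0; have [[j [jL sj]]|no] := pselect (exists j, (j < L)%N /\ s \in cell m j).
  by rewrite !(grid_fun_cell _ m0 jL sj).
have out b : grid_fun m L b s = 0.
  by apply: grid_fun_out => j jL; apply/negP => sj; apply: no; exists j.
by rewrite !out expr0n.
Qed.

Lemma lebesgue_cell m j : (0 < m)%N -> mu (cell m j) = (m%:R^-1)%:E.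
Proof.
move=> m0; rewrite lebesgue_measure_itv/= lte_fin ltr_pM2r ?invr_gt0 ?ltr0n//.
by rewrite ltr_nat ltnSn EFinN -EFinB -mulrBl -natrB// subSnn mul1r.
Qed.

Lemma sqn_grid_fun m L a : (0 < m)%N ->
  sqn mu (grid_fun m L a) = (m%:R^-1 * \sum_(0 <= j < L) a j ^+ 2)%:E.
Proof.
move=> m0; rewrite /sqn.
transitivity (\int[mu]_s (\sum_(0 <= j < L) (a j ^+ 2 * \1_(cell m j) s)%:E))%E.
  by apply: eq_integral => s _; rewrite grid_fun_sqr// grid_funE sumEFin.
rewrite ge0_integral_sum//; last 2 first.
- by move=> j; apply/measurable_EFinP; apply: measurable_funM => //;
    apply: measurable_indic; exact: measurable_cell.
- by move=> j s _; rewrite lee_fin mulr_ge0 ?sqr_ge0// indicE.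
rewrite mulr_sumr -sumEFin; apply: eq_bigr => j _.
under eq_integral do rewrite EFinM.
rewrite ge0_integralZl//; last 2 first.
- by apply/measurable_EFinP; apply: measurable_indic; exact: measurable_cell.
- by rewrite lee_fin sqr_ge0.
rewrite integral_indic//; last exact: measurable_cell.
by rewrite setIT [X in (_ * X)%E](lebesgue_cell j m0) -EFinM mulrC.
Qed.

End grid_step.

Section density.
Context (R : realType).
Local Notation mu := (@lebesgue_measure R).
Local Notation allR := (setT : set (measurableTypeR R)).

(** Dominated convergence.  The origin lies in no cell, hence the exception. *)
Lemma sqn_dct (f_ : nat -> R -> R) (G : R -> R) :
  (forall n, measurable_fun allR (f_ n)) -> measurable_fun allR G ->
  (sqn mu G < +oo)%E -> (forall n s, `|f_ n s| <= `|G s|) ->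
  (forall s, s != 0 -> f_ n s @[n --> \oo] --> 0) ->
  forall c : R, 0 < c -> \forall n \near \oo, (sqn mu (f_ n) <= c%:E)%E.
Proof.
move=> mf mG iG fG cf c c0.
have [] := @dominated_convergence _ _ _ mu setT measurableT
   (fun n s => (f_ n s ^+ 2)%:E) (fun=> 0%E) (fun s => (G s ^+ 2)%:E).
- by move=> n; exact: measurable_sqr.
- exact: measurable_cst.
- exists [set 0]; split; [exact: measurable_set1|exact: lebesgue_measure_set1|].
  move=> s /= ns; apply: contrapT => s0; apply: ns => _.
  apply: cvg_EFin; first exact: nearW.
  have h : f_ n s ^+ 2 @[n --> \oo] --> (0 : R).
    by rewrite -(mulr0 (0 : R)); apply: cvgM; apply: cf; apply/eqP.
  exact: h.
- apply/integrableP; split; first exact: measurable_sqr.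
  by under eq_integral do rewrite gee0_abs ?lee_fin ?sqr_ge0//.
- apply: aeW => s n _; rewrite gee0_abs lee_fin ?sqr_ge0//.
  by rewrite -(real_normK (num_real (f_ n s))) -(real_normK (num_real (G s))) lerXn2r ?nnegrE.
move=> _ _; rewrite integral0 => h.
have : \forall n \near \oo, (sqn mu (f_ n) < c%:E)%E.
  by apply: (h [set x | (x < c%:E)%E]); apply: open_ereal_lt'; rewrite lte_fin.
by apply: filterS => n /ltW.
Qed.

(** Truncation to [[- M, M]], in a form that is visibly continuous. *)
Definition clamp (M x : R) : R := (`|x + M| - `|x - M|) / 2.

Lemma clamp_id (M x : R) : `|x| <= M -> clamp M x = x.
Proof.
rewrite ler_norml => /andP[xM Mx]; rewrite /clamp ger0_norm ?ler0_norm; last 2 first.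
- by rewrite subr_le0.
- by rewrite -lerBlDr sub0r.
by field.
Qed.

Lemma clamp_le (M x : R) : 0 <= M -> `|clamp M x| <= M.
Proof.
move=> M0; rewrite /clamp normrM [`|2^-1|]ger0_norm// ler_pdivrMr//.
apply: (le_trans (ler_dist_dist _ _)).
rewrite (_ : x + M - (x - M) = M + M); last by ring.
by rewrite ger0_norm ?addr_ge0//; lra.
Qed.

Lemma clamp_dist (M x y : R) : `|clamp M x - clamp M y| <= `|x - y|.
Proof.
rewrite /clamp -mulrBl normrM [`|2^-1|]ger0_norm// ler_pdivrMr//.
rewrite (_ : _ - _ = (`|x + M| - `|y + M|) - (`|x - M| - `|y - M|)); last by ring.
rewrite (le_trans (ler_normB _ _))// mulr_natr mulr2n lerD//.
  by rewrite (le_trans (ler_dist_dist _ _))// opprD addrACA subrr addr0.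
by rewrite (le_trans (ler_dist_dist _ _))// opprD addrACA subrr addr0.
Qed.

Lemma continuous_clamp (M : R) : continuous (clamp M).
Proof.
move=> x; apply: cvgMl; apply: cvgB.
  by apply: cvg_norm; apply: cvgD; [exact: cvg_id|exact: cvg_cst].
by apply: cvg_norm; apply: cvgB; [exact: cvg_id|exact: cvg_cst].
Qed.

Lemma measurable_clamp M : measurable_fun allR (clamp M).
Proof. by apply: continuous_measurable_fun; exact: continuous_clamp. Qed.

Let trunc (f : R -> R) (n : nat) (s : R) : R := clamp n%:R (f s) * \1_`[0, n%:R] s.

Let measurable_trunc f n : measurable_fun allR f -> measurable_fun allR (trunc f n).
Proof.
move=> mf; apply: measurable_funM; last exact: measurable_indic.
exact: measurableT_comp (measurable_clamp _) mf.
Qed.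

Let trunc_dense (f : R -> R) (c : R) : measurable_fun allR f -> (sqn mu f < +oo)%E ->
  (forall s, s < 0 -> f s = 0) -> 0 < c ->
  exists n, (sqn mu (fun s => f s - trunc f n s)%R <= c%:E)%E.
Proof.
move=> mf sf f0 c0.
have : \forall n \near \oo, (sqn mu (fun s => f s - trunc f n s)%R <= c%:E)%E.
  apply: (@sqn_dct _ (fun s => 2 * f s)) c0.
  - by move=> n; apply: measurable_funB => //; exact: measurable_trunc.
  - exact: measurable_funM.
  - by rewrite sqnZ// lte_mul_pinfty// lee_fin sqr_ge0.
  - move=> n s; rewrite (le_trans (ler_normB _ _))// [`|2 * _|]normrM ger0_norm//.
    rewrite mulr2n mulrDl mul1r lerD2l /trunc normrM.
    rewrite -[leRHS]mulr1 ler_pM//; last by rewrite indicE; case: (_ \in _); rewrite ?normr1 ?normr0.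
    rewrite -[f s in leRHS]subr0 -[clamp _ _]subr0.
    by rewrite -{1}(clamp_id (M := n%:R) (x := 0)) ?normr0// clamp_dist.
  - move=> s _; apply: cvg_near_cst.
    exists (Num.truncn (`|f s| + `|s|)).+1 => // n /= hn.
    have ln : `|f s| + `|s| <= n%:R.
      by rewrite ltW// (lt_le_trans (truncnS_gt _))// ler_nat.
    rewrite /trunc clamp_id; last by rewrite (le_trans _ ln)// lerDl.
    have [s0|s0] := ltP s 0; first by rewrite f0// mul0r subrr.
    rewrite indicE mem_setE in_itv/= s0 (_ : s <= n%:R) ?mulr1 ?subrr//.
    by rewrite (le_trans _ ln)// (le_trans (ler_norm s))// lerDr.
by move=> [K _ /(_ K (leqnn K)) h]; exists K.
Qed.

(** Grid functions are dense: truncate, approximate by a continuous function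
    and sample the latter at the left end points of the cells. *)
Lemma grid_fun_dense (f : R -> R) (c : R) : L2_halfline f -> 0 < c ->
  exists k0, forall k, (k0 <= k)%N -> (0 < k)%N /\ exists a,
    (sqn mu ((f \- grid_fun k (k * k) a)%R \_ `[0%R, +oo[) <= c%:E)%E.
Proof.
move=> /Lfun2P[mf sf] c0; pose f0 := f \_ `[0, +oo[.
have f0lt s : s < 0 -> f0 s = 0.
  by move=> s0; rewrite /f0 patchE mem_setE in_itv/= andbT leNgt s0.
have c8 : 0 < c / 16 by rewrite divr_gt0.
have [n hn] := trunc_dense mf sf f0lt (divr_gt0 c0 (ltr0n _ 4)).
have n0 : 0 <= n%:R :> R by [].
pose h := trunc f0 n.
have mh : measurable_fun allR h by exact: measurable_trunc.
have h_le s : `|h s| <= n%:R.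
  rewrite /h /trunc normrM -[leRHS]mulr1 ler_pM// ?clamp_le//.
  by rewrite indicE; case: (_ \in _); rewrite ?normr1 ?normr0.
have fin_n : (mu `[0%R, n%:R] < +oo)%E.
  by rewrite lebesgue_measure_itv/=; case: ifP; rewrite ?ltry// -EFinN -EFinD ltry.
have ih : mu.-integrable `[0, n%:R] (EFin \o h).
  apply: measurable_bounded_integrable => //; first exact: measurable_funTS.
  by exists n%:R; split; [exact: num_real|move=> x nx y _; exact: le_trans (h_le y) (ltW nx)].
have [g_ [cg ig hg]] := approximation_continuous_integrable (measurable_itv _) fin_n ih.
have [i hi] : exists i, (\int[mu]_(z in `[0%R, n%:R]) `|(h z - g_ i z)%:E|
    <= (c / (16 * (2 * n.+1%:R)))%:E)%E.
  have d0 : 0 < c / (16 * (2 * n.+1%:R)) by rewrite divr_gt0// !mulr_gt0.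
  have : \forall i \near \oo, (\int[mu]_(z in `[0%R, n%:R]) `|(h z - g_ i z)%:E|
      < (c / (16 * (2 * n.+1%:R)))%:E)%E.
    by apply: (hg [set x | (x < _)%E]); apply: open_ereal_lt'; rewrite lte_fin.
  by move=> [i _ /(_ i (leqnn i))/ltW hi]; exists i.
pose g s := clamp n%:R (g_ i s).
have cgg : continuous g.
  by move=> s; apply: (@cvg_comp _ _ _ (g_ i) (clamp n%:R) _ _ _ (cg i s)); exact: continuous_clamp.
have mg : measurable_fun allR g by exact: continuous_measurable_fun.
pose I : R -> R := \1_`[0, n%:R].
have mI : measurable_fun allR I by exact: measurable_indic.
have I01 s : I s = 0 \/ I s = 1 by rewrite /I indicE; case: (_ \in _); [right|left].
pose gI s := g s * I s.
have mgI : measurable_fun allR gI by exact: measurable_funM.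
have hE s : (0 <= s <= n%:R) = false -> h s = 0.
  by move=> ns; rewrite /h /trunc indicE mem_setE in_itv/= ns mulr0.
have IE s : I s = (0 <= s <= n%:R)%R%:R by rewrite /I indicE mem_setE in_itv.
have hgI : (sqn mu (fun s => h s - gI s)%R <= (c / 16)%:E)%E.
  have mgi : measurable_fun allR (g_ i) by exact: continuous_measurable_fun.
  have mD : measurable_fun allR (fun s => `|(h s - g_ i s)%:E|%E).
    by apply: measurableT_comp => //; apply/measurable_EFinP; exact: measurable_funB.
  apply: (@le_trans _ _ (\int[mu]_(z in `[0%R, n%:R]) ((2 * n%:R)%:E * `|(h z - g_ i z)%:E|))%E).
    rewrite [leRHS]integral_mkcond; apply: ge0_le_integral => //.
    - by move=> s _; rewrite lee_fin sqr_ge0.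
    - by apply: measurable_sqr; exact: measurable_funB.
    - apply/(measurable_restrictT _ _).1 => //; apply: measurable_funTS.
      by apply: emeasurable_funM => //; exact: measurable_cst.
    - move=> s _; rewrite patchE mem_setE in_itv/=; case: ifPn => [s01|/negbTE s01].
        rewrite /gI IE s01 mulr1 -EFinM lee_fin -real_normK ?num_real// expr2.
        have hc : h s = clamp n%:R (h s) by rewrite clamp_id.
        apply: ler_pM => //.
          rewrite (le_trans (ler_normB _ _))// mulr2n mulrDl mul1r lerD//.
          exact: clamp_le.
        by rewrite {1}hc; exact: clamp_dist.
      by rewrite /gI IE s01 mulr0 hE// subrr expr0n.
  rewrite ge0_integralZl//; last exact: measurable_funTS.
  apply: (le_trans (lee_wpmul2l _ hi)); first by rewrite lee_fin.
  rewrite -EFinM lee_fin (_ : 2 * n%:R * _ = (c / 16) * (n%:R / n.+1%:R)).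
    rewrite ler_piMr ?(ltW c8)// ler_pdivrMr// mul1r ler_nat; exact: leqnSn.
  have : n.+1%:R != 0 :> R by rewrite pnatr_eq0.
  by move: (n.+1%:R : R) => x x0; field.
pose a k j : R := if (j < n * k)%N then g (j%:R / k%:R) else 0.
have g_le s : `|g s| <= n%:R by exact: clamp_le.
have a_le k j : `|a k j| <= n%:R by rewrite /a; case: ifP; rewrite ?normr0.
have p0 k (s : R) : (0 <= s <= n%:R) = false -> grid_fun k.+1 (k.+1 * k.+1) (a k.+1) s = 0.
  have [s0 _|s0 /= /negbT] := ltP s 0; first by rewrite grid_fun_le0// ltW.
  rewrite -ltNge => ns.
  have [[j [jL sj]]|no] := pselect (exists j, (j < k.+1 * k.+1)%N /\ s \in (cell k.+1 j : set R)).
    rewrite (grid_fun_cell _ _ jL sj)// /a ifF//; apply/negbTE; rewrite -leqNgt.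
    move: sj; rewrite cellE// => /andP[_ sj].
    have : n%:R * k.+1%:R < j.+1%:R :> R by rewrite (lt_le_trans _ sj)// ltr_pM2r.
    by rewrite -natrM ltr_nat ltnS.
  by apply: grid_fun_out => j jL; apply/negP => sj; apply: no; exists j.
have gp : \forall k \near \oo,
   (sqn mu (fun s => gI s - grid_fun k.+1 (k.+1 * k.+1) (a k.+1) s)%R <= (c / 16)%:E)%E.
  apply: (@sqn_dct _ (fun s => 2 * n%:R * I s)) c8.
  - by move=> k; apply: measurable_funB => //; exact: measurable_grid_fun.
  - exact: measurable_funM.
  - rewrite sqnZ// lte_mul_pinfty ?lee_fin ?sqr_ge0//.
    rewrite /sqn (_ : (fun s => _) = (fun s => (I s)%:E)); last first.
      by apply/funext => s; case: (I01 s) => ->; rewrite ?expr1n ?expr0n.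
    by rewrite integral_indic// setIT.
  - move=> k s; rewrite !IE; case: (boolP (0 <= s <= n%:R)) => [s01|/negbTE s01].
      rewrite /gI IE s01 !mulr1 (le_trans (ler_normB _ _))// [leRHS]ger0_norm ?mulr_ge0//.
      by rewrite mulr2n mulrDl mul1r lerD// grid_fun_le.
    by rewrite /gI IE s01 !mulr0 p0// subrr.
  - move=> s s0; case: (boolP (0 <= s <= n%:R)) => [/[dup] s01 /andP[s0' sn]|/negbTE s01]; last first.
      rewrite (_ : (fun k => _) = fun=> 0); first exact: cvg_cst.
      by apply/funext => k; rewrite /gI IE s01 mulr0 p0// subrr.
    have {}s0 : 0 < s by rewrite lt_neqAle eq_sym s0.
    apply/cvgr0Pnorm_le => e e0.
    have /cvgrPdist_le/(_ e e0)/nbhs_ballP[dl /= dl0 hdl] := cgg s.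
    have [K0 _ hK0] := near_infty_natSinv_lt (PosNum dl0).
    exists (maxn K0 n) => // k /=; rewrite geq_max => /andP[K0k nk].
    have [j sj] := @cell_exists _ k.+1 s isT s0.
    move: (sj); rewrite cellE// => /andP[j1 j2].
    have jn : (j < n * k.+1)%N.
      by rewrite -(ltr_nat R) (lt_le_trans j1)// natrM ler_wpM2r.
    have jL : (j < k.+1 * k.+1)%N by rewrite (leq_trans jn)// leq_mul2r (leqW nk) orbT.
    rewrite (grid_fun_cell _ _ jL sj)// /a jn /gI IE s01 mulr1.
    apply: hdl; rewrite /ball/= ger0_norm.
      apply: le_lt_trans (hK0 k K0k) => /=.
      rewrite -(ler_pM2r (x := k.+1%:R))// mulrBl divfK ?pnatr_eq0// mulVf ?pnatr_eq0//.
      by rewrite lerBlDr addrC natr1.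
    by rewrite subr_ge0 ler_pdivrMr// ltW.
case: gp => K _ gp.
exists (maxn K n).+1 => -[//|k]; rewrite ltnS geq_max => /andP[Kk nk]; split => //.
exists (a k.+1).
have mp := measurable_grid_fun k.+1 (k.+1 * k.+1) (a k.+1).
rewrite (_ : _ \_ _ = fun s => f0 s - grid_fun k.+1 (k.+1 * k.+1) (a k.+1) s); last first.
  apply/funext => s; rewrite /f0 !patchE; case: ifPn => //.
  rewrite mem_setE in_itv/= andbT -ltNge => s0.
  by rewrite grid_fun_le0// ?(ltW s0)// subrr.
have m0 : measurable_fun allR f0 by [].
apply: (le_trans (sqn_trans m0 mh mp hn (sqn_trans mh mgI mp hgI (gp k Kk)))).
rewrite lee_fin; lra.
Qed.

End density.

(** * The integrated process along a fixed path *)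

Section path.
Context (R : realType).
Local Notation mu := (@lebesgue_measure R).
Local Notation allR := (setT : set (measurableTypeR R)).
Implicit Types (a b : nat -> R) (s r : R).

Definition is_path (nu : R -> nat) : Prop :=
  forall s t, 0 <= s -> s <= t -> (nu s <= nu t)%N.

(** A nondecreasing function is measurable once it is extended to the left of
    the origin by its value there. *)
Lemma measurable_path (nu : R -> nat) (F : R -> R) (r : R) : is_path nu ->
  measurable_fun setT F -> measurable_fun (`[0, r] : set (measurableTypeR R)) (fun s => F (nu s)%:R).
Proof.
move=> pnu mF.
have mn : measurable_fun allR (fun s => (nu (Num.max s 0))%:R : R).
  apply: nondecreasing_measurable => // s t st; rewrite ler_nat; apply: pnu.
    by rewrite le_max lexx orbT.
  by rewrite ge_max !le_max st lexx !orbT.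
apply: (eq_measurable_fun (fun s => F (nu (Num.max s 0))%:R)).
  by move=> s; rewrite inE/= in_itv/= => /andP[s0 _]; rewrite max_l.
by apply: measurable_funTS; exact: measurableT_comp.
Qed.

Lemma wave_lip (theta x y : R) (m n : nat) : (m <= n)%N ->
  `|wave theta x y n - wave theta x y m| <= (`|x| + `|y|) * `|theta| * (n%:R - m%:R).
Proof.
move=> mn; rewrite /wave.
rewrite [X in `|X|](_ : _ = x * (cos (theta * n%:R) - cos (theta * m%:R))
  + y * (sin (theta * n%:R) - sin (theta * m%:R))); last by ring.
have e : `|theta * n%:R - theta * m%:R| = `|theta| * (n%:R - m%:R).
  by rewrite -mulrBr normrM [`|_ - _|]ger0_norm// subr_ge0 ler_nat.
rewrite (le_trans (ler_normD _ _))// !normrM -mulrA mulrDl lerD// ler_wpM2l// -e.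
  exact: dist_cos.
exact: dist_sin.
Qed.

Section riemann.
Variables (nu : R -> nat) (theta : R) (m L : nat) (a b : nat -> R).
Hypothesis pnu : is_path nu.
Hypothesis m0 : (0 < m)%N.
Variable A : R.
Hypothesis hA : forall j, `|a j| + `|b j| <= A.

Definition wave_kernel (s : R) : R :=
  grid_fun m L a s * cos (theta * (nu s)%:R) + grid_fun m L b s * sin (theta * (nu s)%:R).

Let A0 : 0 <= A.
Proof. by apply: le_trans (hA 0%N); rewrite addr_ge0. Qed.

Lemma measurable_wave_kernel r : measurable_fun (`[0, r] : set (measurableTypeR R)) wave_kernel.
Proof.
apply: measurable_funD; apply: measurable_funM.
- by apply: measurable_funTS; exact: measurable_grid_fun.
- apply: (@measurable_path nu (fun x => cos (theta * x)) r pnu).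
  apply: continuous_measurable_fun => x.
  by apply: continuous_comp; [exact: mulrl_continuous|exact: continuous_cos].
- by apply: measurable_funTS; exact: measurable_grid_fun.
- apply: (@measurable_path nu (fun x => sin (theta * x)) r pnu).
  apply: continuous_measurable_fun => x.
  by apply: continuous_comp; [exact: mulrl_continuous|exact: continuous_sin].
Qed.

Lemma wave_kernel_le s : `|wave_kernel s| <= 2 * A.
Proof.
have a_le j : `|a j| <= A by rewrite (le_trans _ (hA j))// lerDl.
have b_le j : `|b j| <= A by rewrite (le_trans _ (hA j))// lerDr.
rewrite mulr2n mulrDl mul1r (le_trans (ler_normD _ _))// lerD// normrM -[leRHS]mulr1 ler_pM//.
- exact: grid_fun_le.
- exact: cos_max.
- exact: grid_fun_le.
- exact: sin_max.
Qed.

Lemma finite_itv (x y : R) : (mu `[x, y] < +oo)%E.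
Proof. by rewrite lebesgue_measure_itv/=; case: ifP; rewrite ?ltry// -EFinN -EFinD ltry. Qed.

Lemma integrable_wave_kernel r : mu.-integrable `[0, r] (EFin \o wave_kernel).
Proof.
apply: measurable_bounded_integrable => //; first exact: finite_itv.
  exact: measurable_wave_kernel.
exists (2 * A); split; [exact: num_real|move=> x Ax s _; exact: le_trans (wave_kernel_le s) (ltW Ax)].
Qed.

(** On a cell that the path crosses without jumping the Riemann sum is exact,
    so the total error is the mesh times the number of jumps. *)
Lemma riemann_wave (K : nat) : (0 < K)%N -> forall l, (l <= L * K)%N ->
  forall D : R, D = ((m * K)%:R)^-1 ->
  `|\int[mu]_(s in `[0, D * l%:R]) wave_kernel s
    - \sum_(k < l) D * wave theta (a (k %/ K)%N) (b (k %/ K)%N) (nu (D * k%:R))|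
  <= D * (A * `|theta|) * (nu (D * l%:R))%:R.
Proof.
move=> K0 l lLK D DE; have mK0 : (0 < m * K)%N by rewrite muln_gt0 m0.
have D0 : 0 < D by rewrite DE invr_gt0 ltr0n.
elim: l lLK => [|l IH] lLK.
  rewrite mulr0 set_itv1 Rintegral_set1 big_ord0 subrr normr0.
  by rewrite mulr_ge0// mulr_ge0 ?mulr_ge0// ltW.
have DS : D * l.+1%:R = D * l%:R + D by rewrite -natr1 mulrDr mulr1.
have Dl0 : 0 <= D * l%:R by rewrite mulr_ge0// ltW.
have lt_l : D * l%:R < D * l.+1%:R by rewrite ltr_pM2l// ltr_nat.
have := @Rintegral_itvB R wave_kernel (BLeft 0) (BRight (D * l.+1%:R)) (D * l%:R).
move=> /(_ (integrable_wave_kernel _)); rewrite !bnd_simp => /(_ Dl0 (ltW lt_l)).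
move=> /eqP; rewrite subr_eq => /eqP ->.
rewrite big_ord_recr/=; set I := \int[mu]_(x in `]_, _]) _.
set w0 := wave theta (a (l %/ K)%N) (b (l %/ K)%N) (nu (D * l%:R)).
have {}IH := IH (ltnW lLK).
pose dn : R := (nu (D * l.+1%:R))%:R - (nu (D * l%:R))%:R.
have hI : `|I - D * w0| <= D * (A * `|theta|) * dn.
  have mcell : measurable (`]D * l%:R, D * l.+1%:R] : set (measurableTypeR R)) by exact: measurable_itv.
  have ik : mu.-integrable `]D * l%:R, D * l.+1%:R] (EFin \o wave_kernel).
    apply: integrableS (integrable_wave_kernel (D * l.+1%:R)) => //.
    by apply: subset_itv; rewrite bnd_simp.
  have mu_cell : mu `]D * l%:R, D * l.+1%:R] = D%:E.
    by rewrite lebesgue_measure_itv/= lte_fin lt_l DS EFinN -EFinB addrAC subrr add0r.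
  have ic (c : R) : mu.-integrable `]D * l%:R, D * l.+1%:R] (EFin \o cst c).
    apply: measurable_bounded_integrable => //; first by rewrite [X in (X < _)%E]mu_cell ltry.
    by exists `|c|; split; [exact: num_real|move=> x cx s _; exact: ltW].
  have -> : D * w0 = \int[mu]_(s in `]D * l%:R, D * l.+1%:R]) cst w0 s.
    by rewrite Rintegral_cst// [X in fine X]mu_cell/= mulrC.
  rewrite /I -(RintegralB mcell ik (ic w0)).
  have -> : D * (A * `|theta|) * dn = \int[mu]_(s in `]D * l%:R, D * l.+1%:R]) cst (A * `|theta| * dn) s.
    by rewrite Rintegral_cst// [X in fine X]mu_cell/=; ring.
  have iB : mu.-integrable `]D * l%:R, D * l.+1%:R] (EFin \o (fun s => wave_kernel s - cst w0 s)).
    exact: integrableB ik (ic w0).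
  apply: le_trans (le_normr_Rintegral _ iB) _ => //.
  apply: (le_Rintegral mcell (integrable_abse iB) (ic (A * `|theta| * dn))).
  move=> s; rewrite /= in_itv/= => /andP[s1 s2].
  have sc : s \in (cell (m * K) l : set R).
    by rewrite cellE// -ltr_pdivrMr ?ltr0n// -ler_pdivlMr ?ltr0n// ![_ / _]mulrC -DE s1.
  have sc' : s \in (cell m (l %/ K) : set R).
    move: sc; rewrite !cellE// natrM mulrA => /andP[c1 c2].
    have K0' : 0 < K%:R :> R by rewrite ltr0n.
    rewrite -(ltr_pM2r K0') (le_lt_trans _ c1) -?natrM ?ler_nat ?leq_trunc_div//=.
    rewrite -(ler_pM2r K0') (le_trans c2)// -natrM ler_nat.
    exact: ltn_ceil.
  have lK : (l %/ K < L)%N by rewrite ltn_divLR.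
  rewrite /wave_kernel !(grid_fun_cell _ m0 lK sc') -/(wave theta _ _ _).
  have n1 : (nu (D * l%:R) <= nu s)%N by apply: pnu => //; exact: ltW.
  have n2 : (nu s <= nu (D * l.+1%:R))%N by apply: pnu => //; rewrite (le_trans Dl0)// ltW.
  apply: le_trans (wave_lip _ _ _ n1) _.
  apply: ler_pM; [by rewrite mulr_ge0// addr_ge0|by rewrite subr_ge0 ler_nat| |].
    by rewrite ler_wpM2r.
  by rewrite lerD2r ler_nat.
rewrite [X in `|X|](_ : _ = (I - D * w0) + (\int[mu]_(s in `[0, D * l%:R]) wave_kernel s
   - \sum_(k < l) D * wave theta (a (k %/ K)%N) (b (k %/ K)%N) (nu (D * k%:R)))); last by ring.
apply: le_trans (ler_normD _ _) _; apply: le_trans (lerD hI IH) _.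
by rewrite -mulrDr /dn subrK.
Qed.

End riemann.
End path.

Section kernel_limit.
Context (R : realType) (d : measure_display) (Omega : measurableType d).
Context (P : probability Omega R) (N : R -> Omega -> nat).
Hypothesis poissonN : standard_poisson_process P N.
Variable theta : R.
Local Notation mu := (@lebesgue_measure R).

Definition fast_path (eps : R) (w : Omega) (s : R) : nat := N (2 * s / eps ^+ 2) w.

Lemma fast_path_is_path eps w : 0 < eps -> is_path (fast_path eps w).
Proof.
move=> e0 s t s0 st; have e2 : 0 <= (eps ^+ 2)^-1 by rewrite invr_ge0 sqr_ge0.
apply: (poisson_nondecreasing poissonN); first by rewrite mulr_ge0// mulr_ge0.
by rewrite ler_wpM2r// ler_wpM2l.
Qed.

Definition wave_integral (m L : nat) (a b : nat -> R) (eps : R) (w : Omega) : R :=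
  2 / eps * \int[mu]_(s in `[0, L%:R / m%:R]) wave_kernel (fast_path eps w) theta m L a b s.

(** The Poisson time spent in one of the [K] equal parts of a cell of width
    [1 / m]. *)
Definition mesh (m : nat) (eps : R) (K : nat) : R := 2 * ((m * K)%:R)^-1 / eps ^+ 2.

Section fixed.
Variables (m L : nat) (a b : nat -> R) (eps : R).
Hypothesis m0 : (0 < m)%N.
Hypothesis e0 : 0 < eps.

Lemma mesh_gt0 K : (0 < K)%N -> 0 < mesh m eps K.
Proof.
by move=> K0; rewrite !mulr_gt0// ?invr_gt0 ?exprn_gt0// ltr0n muln_gt0 m0.
Qed.

Lemma mesh_scale K : (0 < K)%N -> eps ^+ 2 * mesh m eps K * K%:R = 2 / m%:R.
Proof.
move=> K0; rewrite /mesh natrM; field.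
by rewrite !pnatr_eq0 -!lt0n m0 K0 gt_eqF.
Qed.

Lemma mesh_cvg0 : mesh m eps K.+1 @[K --> \oo] --> 0.
Proof.
have -> : (fun K => mesh m eps K.+1) = (fun K => 2 / (m%:R * eps ^+ 2) * K.+1%:R^-1).
  apply/funext => K; rewrite /mesh natrM; field.
  by rewrite nat1r !pnatr_eq0 -!lt0n m0 gt_eqF.
rewrite -(mulr0 (2 / (m%:R * eps ^+ 2))); apply: cvgM; first exact: cvg_cst.
exact: cvg_harmonic.
Qed.

Variable A : R.
Hypothesis hA : forall j, `|a j| + `|b j| <= A.

Let S K := grid_sum N theta (mesh m eps K) (eps * mesh m eps K)
  (fun k => a (k %/ K)%N) (fun k => b (k %/ K)%N) (L * K).

Let A0 : 0 <= A.
Proof. by apply: le_trans (hA 0%N); rewrite addr_ge0. Qed.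

Let S_dist K w : (0 < K)%N ->
  `|wave_integral m L a b eps w - S K w| <=
  eps * mesh m eps K * (A * `|theta|) * (fast_path eps w (L%:R / m%:R))%:R.
Proof.
move=> K0; set D : R := ((m * K)%:R)^-1.
have DL : D * (L * K)%:R = L%:R / m%:R.
  by rewrite /D !natrM; field; rewrite !pnatr_eq0 -!lt0n m0 K0.
have := riemann_wave theta (fast_path_is_path w e0) m0 hA K0 (leqnn (L * K)) (erefl D).
rewrite DL => h.
have ec : 2 / eps * D = eps * mesh m eps K by rewrite /mesh -/D; field; rewrite gt_eqF.
have -> : S K w = 2 / eps * \sum_(k < L * K) D * wave theta (a (k %/ K)%N) (b (k %/ K)%N)
    (fast_path eps w (D * k%:R)).
  rewrite /S /grid_sum mulr_sumr; apply: eq_bigr => k _; rewrite [RHS]mulrA ec.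
  congr (_ * wave _ _ _ _); rewrite /gridN /fast_path; congr (N _ w).
  by rewrite /mesh -/D mulrA mulrAC.
rewrite /wave_integral -mulrBr normrM gtr0_norm ?divr_gt0//.
apply: le_trans (ler_wpM2l _ h) _; first by rewrite divr_ge0// ltW.
rewrite [leLHS](_ : _ = (2 / eps * D) * (A * `|theta|) * (fast_path eps w (L%:R / m%:R))%:R).
  by rewrite ec.
ring.
Qed.

Let S_cvg w : S K.+1 w @[K --> \oo] --> wave_integral m L a b eps w.
Proof.
apply/cvgrPdist_le => e ee.
have c0 : eps * mesh m eps K.+1 * (A * `|theta|) * (fast_path eps w (L%:R / m%:R))%:R
    @[K --> \oo] --> 0.
  rewrite -(mul0r (fast_path eps w (L%:R / m%:R))%:R); apply: cvgM; last exact: cvg_cst.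
  rewrite -(mul0r (A * `|theta|)); apply: cvgM; last exact: cvg_cst.
  by rewrite -(mulr0 eps); apply: cvgM; [exact: cvg_cst|exact: mesh_cvg0].
move/cvgr0Pnorm_le : c0 => /(_ e ee); apply: filterS => K hK.
exact: le_trans (S_dist w (ltn0Sn K)) (le_trans (ler_norm _) hK).
Qed.

Let mS K : (0 < K)%N -> measurable_fun setT (S K).
Proof.
move=> K0; apply: (past_measurable poissonN (mesh_gt0 K0) (k := (L * K)%N)).
by apply: (past_grid_sum poissonN); exact: mesh_gt0.
Qed.

Lemma measurable_wave_integral_bounded : measurable_fun setT (wave_integral m L a b eps).
Proof.
apply: (@measurable_fun_cvg _ _ _ setT (fun K => S K.+1)).
  by move=> K; exact: mS.
by move=> w _; exact: S_cvg.
Qed.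

(** With [eps] fixed, the estimate on the grid passes to the limit of infinitely
    many parts per cell: what remains is an error of order [eps]. *)
Lemma wave_integral_char_bounded (p : R) : eps <= 1 -> forall C : R, 0 <= C ->
  (forall (h : R) (K : nat), 0 < h <= 1 ->
    `|mean P (fun w => cos (grid_sum N theta h (eps * h) (fun k => a (k %/ K)%N)
         (fun k => b (k %/ K)%N) (L * K) w + p))
      - expR (- (eps ^+ 2 * h * K%:R * \sum_(j < L) rate (a j) (b j))) * cos p|
    <= C * (eps + K%:R * (eps ^+ 3 * h + h ^+ 2))) ->
  `|mean P (fun w => cos (wave_integral m L a b eps w + p))
     - expR (- (2^-1 * (m%:R^-1 * \sum_(j < L) (a j ^+ 2 + b j ^+ 2)))) * cos p|
  <= C * (1 + 2 / m%:R) * eps.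
Proof.
move=> e1 C C0 hC.
have c1 : mean P (fun w => cos (S K.+1 w + p)) @[K --> \oo] -->
    mean P (fun w => cos (wave_integral m L a b eps w + p)).
  apply: (@mean_cvg _ _ _ _ _ _ 1).
  - move=> K; apply: measurableT_comp; first exact: measurable_cos.
    by apply: measurable_funD => //; exact: mS.
  - by apply: measurableT_comp; [exact: measurable_cos|apply: measurable_funD => //; exact: measurable_wave_integral_bounded].
  - by move=> K w; exact: cos_max.
  - move=> w; apply: (@cvg_comp _ _ _ (fun K => S K.+1 w + p) cos); last exact: continuous_cos.
    by apply: cvgD; [exact: S_cvg|exact: cvg_cst].
have -> : 2^-1 * (m%:R^-1 * \sum_(j < L) (a j ^+ 2 + b j ^+ 2)) =
    2 / m%:R * \sum_(j < L) rate (a j) (b j).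
  by rewrite /rate -mulr_suml; field; rewrite pnatr_eq0 -lt0n.
have c2 : C * (eps + (2 / m%:R * eps + 2 / (m%:R * eps ^+ 2) * mesh m eps K.+1)) @[K --> \oo]
    --> C * (1 + 2 / m%:R) * eps.
  have -> : C * (1 + 2 / m%:R) * eps =
      C * (eps + (2 / m%:R * eps + 2 / (m%:R * eps ^+ 2) * 0)) by ring.
  apply: cvgM; [exact: cvg_cst|apply: cvgD; [exact: cvg_cst|apply: cvgD; [exact: cvg_cst|]]].
  by apply: cvgM; [exact: cvg_cst|exact: mesh_cvg0].
set E := expR _ * cos p.
have c3 : `|mean P (fun w => cos (S K.+1 w + p)) - E| @[K --> \oo] -->
    `|mean P (fun w => cos (wave_integral m L a b eps w + p)) - E|.
  by apply: cvg_norm; apply: cvgB => //; exact: cvg_cst.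
apply: (ler_cvg_to c3 c2).
have : \forall K \near \oo, `|mesh m eps K.+1| <= 1.
  by move/cvgr0Pnorm_le : mesh_cvg0 => /(_ 1 ltr01).
apply: filterS => K hK; have h1 : 0 < mesh m eps K.+1 <= 1.
  by rewrite mesh_gt0//= (le_trans (ler_norm _)).
have := hC _ K.+1 h1; rewrite -/(S K.+1) mesh_scale// -/E => /le_trans; apply.
rewrite ler_wpM2l// lerD2l mulrDr le_eqVlt; apply/orP; left; apply/eqP.
have e3 : K.+1%:R * (eps ^+ 3 * mesh m eps K.+1) = eps * (eps ^+ 2 * mesh m eps K.+1 * K.+1%:R) by ring.
rewrite e3 mesh_scale// mulrC; congr (_ + _).
have -> : K.+1%:R * mesh m eps K.+1 ^+ 2 =
  (eps ^+ 2 * mesh m eps K.+1 * K.+1%:R) * mesh m eps K.+1 / eps ^+ 2 by field; rewrite gt_eqF.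
by rewrite mesh_scale//; field; rewrite pnatr_eq0 -lt0n m0 gt_eqF.
Qed.

Let sum_blocks (K : nat) (c : nat -> R) :
  \sum_(k < L * K) c (k %/ K)%N = K%:R * \sum_(j < L) c j.
Proof.
elim: (L) => [|l IH]; first by rewrite mul0n !big_ord0 mulr0.
rewrite mulSn addnC big_split_ord/= IH big_ord_recr/= mulrDr; congr (_ + _).
rewrite (eq_bigr (fun=> c l)) ?sumr_const ?card_ord ?mulr_natl// => i _.
case: K i {IH} => [[]//|K i].
by rewrite divnMDl// divn_small// addn0.
Qed.

Lemma wave_integral_sqn_bounded (C : R) : 0 <= C ->
  (forall (h eps A : R) (al be : nat -> R) (n : nat), 0 < h <= 2^-1 -> 0 <= eps ->
    (forall k, `|al k| + `|be k| <= A) ->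
    mean P (fun w => grid_sum N theta h (eps * h) al be n w ^+ 2) <=
      C * \sum_(k < n) eps ^+ 2 * h * (al k ^+ 2 + be k ^+ 2)
      + 12 * (n%:R * (eps * h * A)) ^+ 2 * h ^+ 2 *+ n) ->
  (sqn P (wave_integral m L a b eps) <=
    (2 * C * (m%:R^-1 * \sum_(j < L) (a j ^+ 2 + b j ^+ 2)))%:E)%E.
Proof.
move=> C0 hC.
pose tau := L%:R * (2 / (m%:R * eps ^+ 2)).
pose u K := 2 * C * (m%:R^-1 * \sum_(j < L) (a j ^+ 2 + b j ^+ 2))
   + 12 * (tau * (eps * A)) ^+ 2 * tau * mesh m eps K.+1.
have hS K : mesh m eps K.+1 <= 2^-1 -> (sqn P (S K.+1) <= (u K)%:E)%E.
  move=> h2; have h02 : 0 < mesh m eps K.+1 <= 2^-1 by rewrite mesh_gt0.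
  have := hC _ eps A (fun k => a (k %/ K.+1)%N) (fun k => b (k %/ K.+1)%N) (L * K.+1)%N
    h02 (ltW e0) (fun k => hA _).
  rewrite -/(S K.+1) => hm.
  have tE : (L * K.+1)%:R * mesh m eps K.+1 = tau.
    by rewrite /tau /mesh !natrM; field; rewrite nat1r !pnatr_eq0 -!lt0n m0 gt_eqF.
  have bS : bounded_rv (S K.+1).
    split; first exact: mS.
    exists (\sum_(k < L * K.+1) eps * mesh m eps K.+1 * A) => w.
    rewrite (le_trans (ler_norm_sum _ _ _))//; apply: ler_sum => k _.
    have eh0 : 0 <= eps * mesh m eps K.+1 by rewrite mulr_ge0// ltW// mesh_gt0.
    by rewrite normrM (ger0_norm eh0) ler_wpM2l// (le_trans (wave_le _ _ _ _)).
  have -> : sqn P (S K.+1) = (mean P (fun w => S K.+1 w ^+ 2))%:E.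
    rewrite /mean /Rintegral fineK//; apply: integrable_fin_num => //.
    exact: (bounded_rv_integrable P (bounded_rvM bS bS)).
  rewrite lee_fin (le_trans hm)// /u; apply: lerD.
    rewrite -mulr_sumr (sum_blocks K.+1 (fun j => a j ^+ 2 + b j ^+ 2)).
    by rewrite [_ * (K.+1%:R * _)]mulrA mesh_scale// -[2 / _ * _]mulrA mulrCA mulrA.
  rewrite le_eqVlt; apply/orP; left; apply/eqP.
  rewrite -mulr_natl -tE; ring.
have u_cvg : u K @[K --> \oo] --> 2 * C * (m%:R^-1 * \sum_(j < L) (a j ^+ 2 + b j ^+ 2)).
  rewrite -[X in _ --> X]addr0; apply: cvgD; first exact: cvg_cst.
  rewrite -(mulr0 (12 * (tau * (eps * A)) ^+ 2 * tau)).
  by apply: cvgM; [exact: cvg_cst|exact: mesh_cvg0].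
have : \forall K \near \oo, `|mesh m eps K.+1| <= 2^-1.
  by move/cvgr0Pnorm_le : mesh_cvg0 => /(_ 2^-1); apply; rewrite invr_gt0.
move=> [K0 _ hK0].
apply: (@sqn_fatou _ _ _ P (fun K => S (K + K0).+1) _ (fun K => u (K + K0)%N)).
- by move=> K; exact: mS.
- by move=> w; have := @S_cvg w; rewrite -(cvg_shiftn K0).
- by move=> K; apply: hS; apply: le_trans (ler_norm _) (hK0 _ (leq_addl _ _)).
- by rewrite (cvg_shiftn K0 u).
Qed.

End fixed.

(** Setting the coefficients to [0] after the last cell bounds them without
    changing the grid function. *)
Let cut (L : nat) (a : nat -> R) (j : nat) : R := if (j < L)%N then a j else 0.

Let cutE m L c s : grid_fun m L c s = grid_fun m L (cut L c) s.
Proof. by rewrite !grid_funE !big_nat; apply: eq_bigr => j /= jL; rewrite /cut jL. Qed.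

Let wave_integral_cut m L a b : wave_integral m L a b = wave_integral m L (cut L a) (cut L b).
Proof.
apply/funext => eps; apply/funext => w; congr (_ * _); apply: eq_Rintegral => s _.
by rewrite /wave_kernel -!cutE.
Qed.

Let cut_bound L a b : exists A : R, forall j, `|cut L a j| + `|cut L b j| <= A.
Proof.
exists (\sum_(j < L) (`|a j| + `|b j|)) => j; rewrite /cut.
have s0 : 0 <= \sum_(j < L) (`|a j| + `|b j|).
  by apply: sumr_ge0 => i _; rewrite addr_ge0.
case: ifPn => [jL|_]; last by rewrite normr0 addr0.
rewrite (bigD1 (Ordinal jL))//= lerDl; apply: sumr_ge0 => i _; exact: addr_ge0.
Qed.

Lemma measurable_wave_integral m L a b eps : (0 < m)%N -> 0 < eps ->
  measurable_fun setT (wave_integral m L a b eps).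
Proof.
by move=> m0 e0; rewrite wave_integral_cut; have [A hA] := cut_bound L a b; exact: measurable_wave_integral_bounded hA.
Qed.

Lemma integrable_wave m L a b eps w r : (0 < m)%N -> 0 < eps ->
  mu.-integrable `[0, r] (EFin \o wave_kernel (fast_path eps w) theta m L a b).
Proof.
move=> m0 e0; have [A hA] := cut_bound L a b.
have := integrable_wave_kernel theta L (fast_path_is_path w e0) m0 hA r.
by congr (mu.-integrable _ _); apply/funext => s; rewrite /= /wave_kernel -!cutE.
Qed.

Lemma wave_integral_lin (I : Type) (s : seq I) (xi : I -> R) (a b : I -> nat -> R) m L eps w :
  (0 < m)%N -> 0 < eps ->
  wave_integral m L (fun j => \sum_(i <- s) xi i * a i j) (fun j => \sum_(i <- s) xi i * b i j) eps w =
  \sum_(i <- s) xi i * wave_integral m L (a i) (b i) eps w.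
Proof.
move=> m0 e0; rewrite /wave_integral; under [RHS]eq_bigr do rewrite mulrCA.
rewrite -mulr_sumr; congr (_ * _).
have gE c l x : grid_fun m L (fun j => \sum_(i <- l) xi i * c i j) x = \sum_(i <- l) xi i * grid_fun m L (c i) x.
  rewrite grid_funE; under eq_bigr do rewrite mulr_suml; rewrite exchange_big/=.
  apply: eq_bigr => i _; rewrite grid_funE mulr_sumr; apply: eq_bigr => j _; exact: esym (mulrA _ _ _).
elim: s => [|i s IH].
  rewrite big_nil; apply: (etrans (eq_Rintegral _ (g := cst 0) _)).
    by move=> x _; rewrite /wave_kernel !gE !big_nil !mul0r addr0.
  by rewrite Rintegral_cst// mul0r.
rewrite big_cons -IH -RintegralZl//; last exact: integrable_wave.
rewrite -RintegralD//; first last.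
- exact: integrable_wave.
- by apply: (@integrableZl _ _ _ mu _ _ (xi i) _ (integrable_wave L (a i) (b i) w _ m0 e0)).
by apply: eq_Rintegral => x _; rewrite /wave_kernel !gE !big_cons; ring.
Qed.

Lemma wave_integral_char m L a b (p : R) : sin (theta / 2) != 0 -> sin theta != 0 ->
  (0 < m)%N -> exists2 C : R, 0 <= C & forall eps, 0 < eps <= 1 ->
  `|mean P (fun w => cos (wave_integral m L a b eps w + p))
     - expR (- (2^-1 * (m%:R^-1 * \sum_(j < L) (a j ^+ 2 + b j ^+ 2)))) * cos p|
  <= C * eps.
Proof.
move=> s1 s2 m0; have [C C0 hC] := grid_char poissonN s1 s2 L (cut L a) (cut L b) p.
exists (C * (1 + 2 / m%:R)) => [|eps /andP[e0 e1]].
  by rewrite mulr_ge0// addr_ge0// divr_ge0.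
rewrite wave_integral_cut; have [A hA] := cut_bound L a b.
rewrite (_ : \sum_(j < L) _ = \sum_(j < L) (cut L a j ^+ 2 + cut L b j ^+ 2)).
  apply: (wave_integral_char_bounded m0 e0 hA e1 C0) => h K h1.
  by apply: hC => //; rewrite ltW.
by apply: eq_bigr => j _; rewrite /cut ltn_ord.
Qed.

Lemma wave_integral_sqn : cos theta < 1 -> exists2 C : R, 0 <= C &
  forall m L a b eps, (0 < m)%N -> 0 < eps ->
  (sqn P (wave_integral m L a b eps) <=
    (C * (m%:R^-1 * \sum_(j < L) (a j ^+ 2 + b j ^+ 2)))%:E)%E.
Proof.
move=> c1; have [C C0 hC] := grid_L2 poissonN c1.
exists (2 * C) => [|m L a b eps m0 e0]; first exact: mulr_ge0.
rewrite wave_integral_cut; have [A hA] := cut_bound L a b.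
rewrite (_ : \sum_(j < L) _ = \sum_(j < L) (cut L a j ^+ 2 + cut L b j ^+ 2)).
  exact: (wave_integral_sqn_bounded L m0 e0 hA C0 hC).
by apply: eq_bigr => j _; rewrite /cut ltn_ord.
Qed.

End kernel_limit.

(** * Kac-Stroock integrals of square integrable kernels *)

Section kac_stroock.
Context (R : realType) (d : measure_display) (Omega : measurableType d).
Context (P : probability Omega R) (N : R -> Omega -> nat).
Hypothesis poissonN : standard_poisson_process P N.
Variable theta : R.
Local Notation mu := (@lebesgue_measure R).
Local Notation allR := (setT : set (measurableTypeR R)).

(** [psi] treats [cos] and [sin] at once; the bound makes [`|psi x| <= 1]. *)
Variables al be : R.
Hypothesis albe : `|al| + `|be| <= 1.

Definition psi (x : R) : R := al * cos x + be * sin x.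

Definition kint (f : R -> R) (eps r : R) (w : Omega) : R :=
  \int[mu]_(s in `[0, r]) (f s * psi (theta * (fast_path N eps w s)%:R)).

Let psi_le x : `|psi x| <= 1.
Proof.
by rewrite (le_trans (ler_normD _ _))// (le_trans _ albe)// !normrM lerD// ler_piMr// ?cos_max ?sin_max.
Qed.

Let continuous_psi : continuous psi.
Proof.
move=> x; apply: cvgD; apply: cvgM; [exact: cvg_cst|exact: continuous_cos|exact: cvg_cst|exact: continuous_sin].
Qed.

Variable eps : R.
Hypothesis e0 : 0 < eps.

Let measurable_kernel (f : R -> R) r w : measurable_fun allR f ->
  measurable_fun (`[0, r] : set (measurableTypeR R))
    (fun s => f s * psi (theta * (fast_path N eps w s)%:R)).
Proof.
move=> mf; apply: measurable_funM; first exact: measurable_funTS.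
apply: (@measurable_path _ (fast_path N eps w) (fun x => psi (theta * x)) r).
  exact: (fast_path_is_path poissonN w e0).
apply: continuous_measurable_fun => x.
by apply: continuous_comp; [exact: mulrl_continuous|exact: continuous_psi].
Qed.

(** From [`|y| <= c + y ^+ 2 / c], integrated over the interval. *)
Let integral_norm_itv (f : R -> R) (r c : R) : measurable_fun allR f -> 0 <= r -> 0 < c ->
  (sqn mu f <= (c ^+ 2)%:E)%E ->
  (\int[mu]_(s in `[0%R, r]) `|f s|%:E <= ((r + 1) * c)%:E)%E.
Proof.
move=> mf r0 c0 hf.
have mr : mu `[0, r] = r%:E.
  rewrite lebesgue_measure_itv/= lte_fin; case: ltP => [_|r0']; first by rewrite oppr0 adde0.
  by congr EFin; apply/eqP; rewrite eq_le r0.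
have msq : measurable_fun (`[0, r] : set (measurableTypeR R)) (EFin \o (fun s => f s ^+ 2)).
  by apply: measurable_funTS; exact: measurable_sqr.
apply: (@le_trans _ _ (\int[mu]_(s in `[0%R, r]) (c%:E + c^-1%:E * (f s ^+ 2)%:E))%E).
  apply: ge0_le_integral => //.
  - by apply/measurable_EFinP; apply: measurable_funTS; exact: measurableT_comp.
  - by apply/measurable_EFinP; apply: measurable_funTS; apply: measurable_funD => //;
      apply: measurable_funM => //; exact: measurable_funX.
  - move=> s _; rewrite lee_fin -[f s ^+ 2]real_normK ?num_real//; set y := `|f s|.
    have y0 : 0 <= y by exact: normr_ge0.
    rewrite -(ler_pM2l c0) mulrDr mulrA mulfV ?gt_eqF// mul1r.
    by have := sqr_ge0 (c - y); rewrite sqrrB; have := mulr_ge0 (ltW c0) y0; lra.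
rewrite ge0_integralD//; last 3 first.
- by move=> s _; rewrite lee_fin ltW.
- by move=> s _; rewrite mule_ge0// lee_fin ?sqr_ge0// invr_ge0 ltW.
- by apply: emeasurable_funM => //; exact: measurable_cst.
rewrite integral_cst// [X in (_ * X)%E]mr ge0_integralZl//; last 2 first.
- by move=> s _; rewrite lee_fin sqr_ge0.
- by rewrite lee_fin invr_ge0 ltW.
rewrite -EFinM mulrDl mul1r EFinD [(r * c)%R]mulrC; apply: leeD => //.
apply: (@le_trans _ _ (c^-1%:E * (c ^+ 2)%:E)%E).
  apply: lee_wpmul2l; first by rewrite lee_fin invr_ge0 ltW.
  apply: le_trans hf; apply: ge0_subset_integral => //; first exact: measurable_sqr.
  by move=> s _; rewrite lee_fin sqr_ge0.
by rewrite -EFinM lee_fin expr2 mulrA mulVf ?mul1r// gt_eqF.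
Qed.

Let integrable_kernel (f : R -> R) (r : R) w : f \in Lfun mu 2%:E -> 0 <= r ->
  mu.-integrable `[0, r] (EFin \o (fun s => f s * psi (theta * (fast_path N eps w s)%:R))).
Proof.
move=> /Lfun2P[mf sf] r0; apply/integrableP; split.
  by apply/measurable_EFinP; exact: measurable_kernel.
have [c [c0 hc]] : exists c : R, 0 < c /\ (sqn mu f <= (c ^+ 2)%:E)%E.
  exists (fine (sqn mu f) + 1); have s0 := sqn_ge0 mu f.
  have f0 : 0 <= fine (sqn mu f) by exact: fine_ge0.
  split; first by rewrite ltr_wpDl.
  rewrite -[leLHS]fineK ?ge0_fin_numE// lee_fin; nra.
apply: (@le_lt_trans _ _ (\int[mu]_(s in `[0%R, r]) `|f s|%:E)%E); last first.
  exact: le_lt_trans (integral_norm_itv mf r0 c0 hc) (ltry _).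
apply: ge0_le_integral => //.
- by apply: measurableT_comp => //; apply/measurable_EFinP; exact: measurable_kernel.
- by apply/measurable_EFinP; apply: measurable_funTS; exact: measurableT_comp.
- by move=> s _; rewrite lee_fin normrM ler_piMr.
Qed.

Lemma kintB (f g : R -> R) (r : R) w : f \in Lfun mu 2%:E -> g \in Lfun mu 2%:E -> 0 <= r ->
  kint (fun s => f s - g s) eps r w = kint f eps r w - kint g eps r w.
Proof.
move=> hf hg r0; rewrite /kint -RintegralB//; last 2 first.
- exact: integrable_kernel.
- exact: integrable_kernel.
by apply: eq_Rintegral => s _; rewrite mulrBl.
Qed.

Let kint_le (f : R -> R) (r c : R) w : f \in Lfun mu 2%:E -> 0 <= r -> 0 < c ->
  (sqn mu f <= (c ^+ 2)%:E)%E -> `|kint f eps r w| <= (r + 1) * c.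
Proof.
move=> hf r0 c0 sf; have [mf _] := (Lfun2P _ _).1 hf.
have ik := integrable_kernel w hf r0.
rewrite -lee_fin; apply: le_trans (integral_norm_itv mf r0 c0 sf).
rewrite /kint EFin_normr_Rintegral//.
have mk : measurable_fun (`[0, r] : set (measurableTypeR R))
    (EFin \o (fun s => f s * psi (theta * (fast_path N eps w s)%:R))).
  by apply/measurable_EFinP; exact: measurable_kernel.
apply: le_trans (le_abse_integral _ _ mk) _ => //.
apply: ge0_le_integral => //.
- exact: measurableT_comp mk.
- by apply/measurable_EFinP; apply: measurable_funTS; exact: measurableT_comp.
- by move=> s _; rewrite lee_fin normrM ler_piMr.
Qed.

Let grid_fun_Lfun m L a : (0 < m)%N -> grid_fun m L a \in Lfun mu 2%:E.
Proof.
by move=> m0; apply/Lfun2P; split; [exact: measurable_grid_fun|rewrite sqn_grid_fun// ltry].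
Qed.

Lemma kint_grid m L a w : (0 < m)%N -> 2 / eps * kint (grid_fun m L a) eps (L%:R / m%:R) w =
  wave_integral N theta m L (fun j => al * a j) (fun j => be * a j) eps w.
Proof.
move=> m0; congr (_ * _); apply: eq_Rintegral => s _.
have gZ (c : R) : grid_fun m L (fun j => c * a j) s = c * grid_fun m L a s.
  by rewrite !grid_funE mulr_sumr; apply: eq_bigr => j _; rewrite mulrA.
by rewrite /wave_kernel !gZ /psi mulrDr !mulrA ![grid_fun _ _ _ _ * _]mulrC.
Qed.

Variable C : R.
Hypothesis C0 : 0 <= C.
Hypothesis hC : forall m L a b, (0 < m)%N ->
  (sqn P (wave_integral N theta m L a b eps) <=
    (C * (m%:R^-1 * \sum_(j < L) (a j ^+ 2 + b j ^+ 2)))%:E)%E.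

(** The second moment bound extends from grid functions by Fatou's lemma: on a
    bounded interval L2 convergence of the kernels makes the integrals converge
    along every path. *)
Let kint_bounded_support (n : nat) (f : R -> R) :
  f \in Lfun mu 2%:E -> (forall s, ~~ (0 <= s <= n%:R) -> f s = 0) ->
  measurable_fun setT (kint f eps n%:R) /\
  (sqn P (fun w => 2 / eps * kint f eps n%:R w)%R <= (2 * C)%:E * sqn mu f)%E.
Proof.
move=> hf f0; have [mf sf] := (Lfun2P _ _).1 hf.
have fE : f \_ `[0, +oo[ = f.
  apply/funext => s; rewrite patchE mem_setE in_itv/= andbT; case: ifPn => // s0.
  by rewrite f0// negb_and s0.
have hf' : L2_halfline f by rewrite /L2_halfline fE.
have e2 (i : nat) : 0 < (i.+1%:R^-1 : R) ^+ 2 by rewrite exprn_gt0// invr_gt0.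
have /choice[ka hka] : forall i : nat, exists ka : nat * (nat -> R), (0 < ka.1)%N /\
    (sqn mu (fun s => f s - grid_fun ka.1 (n * ka.1) ka.2 s)%R <= ((i.+1%:R^-1) ^+ 2)%:E)%E.
  move=> i; have [k0 hk] := grid_fun_dense hf' (e2 i).
  have [m0 [a ha]] := hk (maxn k0 n) (leq_maxl _ _).
  set m := maxn k0 n in m0 a ha; have nm : (n <= m)%N by exact: leq_maxr.
  exists (m, a); split=> //=; apply: le_trans ha; apply: sqn_le.
  - by apply: measurable_funB => //; exact: measurable_grid_fun.
  - rewrite (_ : _ \_ _ = fun s => f s - grid_fun m (m * m) a s).
      by apply: measurable_funB => //; exact: measurable_grid_fun.
    apply/funext => s; rewrite patchE mem_setE in_itv/= andbT; case: ifPn => // s0.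
    by rewrite f0 ?negb_and ?s0// grid_fun_le0 ?subrr// ltW// ltNge.
  - move=> s; rewrite patchE mem_setE in_itv/= andbT; case: ifPn => s0; last first.
      by rewrite f0 ?negb_and ?s0// grid_fun_le0 ?subrr// ltW// ltNge.
    rewrite /=; have [sn|ns] := leP s n%:R; last first.
      rewrite f0; last by apply/negP => /andP[_]; rewrite leNgt ns.
      by rewrite grid_fun_gt ?subrr ?normr0// natrM mulfK// pnatr_eq0 -lt0n.
    have [s0'|s0'] := leP s 0; first by rewrite !grid_fun_le0.
    have [j sj] := cell_exists m0 s0'.
    have jn : (j < n * m)%N.
      move: sj; rewrite cellE// => /andP[j1 _]; rewrite -(ltr_nat R) (lt_le_trans j1)//.
      by rewrite natrM ler_wpM2r.
    by rewrite !(grid_fun_cell _ m0 _ sj)// (leq_trans jn)// leq_mul2r nm orbT.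
pose p i := grid_fun (ka i).1 (n * (ka i).1) (ka i).2.
have hp i : p i \in Lfun mu 2%:E by have [k0 _] := hka i; exact: grid_fun_Lfun.
have kp i w : 2 / eps * kint (p i) eps n%:R w = wave_integral N theta (ka i).1 (n * (ka i).1)
    (fun j => al * (ka i).2 j) (fun j => be * (ka i).2 j) eps w.
  have [k0 _] := hka i; rewrite -kint_grid//; congr (_ * kint _ _ _ _).
  by rewrite natrM mulfK// pnatr_eq0 -lt0n.
have mp i : measurable_fun setT (fun w => 2 / eps * kint (p i) eps n%:R w).
  have [k0 _] := hka i; under eq_fun do rewrite kp.
  exact: (measurable_wave_integral poissonN).
have cp w : 2 / eps * kint (p i) eps n%:R w @[i --> \oo] --> 2 / eps * kint f eps n%:R w.
  apply: cvgM; first exact: cvg_cst.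
  apply/cvgrPdist_le => e ee.
  have c0 : (n%:R + 1) * (i.+1%:R^-1) @[i --> \oo] --> (0 : R).
    by rewrite -(mulr0 (n%:R + 1)); apply: cvgM; [exact: cvg_cst|exact: cvg_harmonic].
  move/cvgr0Pnorm_le : c0 => /(_ e ee); apply: filterS => i; apply: le_trans.
  have hB : (fun s => f s - p i s) \in Lfun mu 2%:E.
    have [_ si] := hka i; apply/Lfun2P; split; last exact: le_lt_trans si (ltry _).
    by apply: measurable_funB => //; exact: measurable_grid_fun.
  rewrite -kintB//; apply: le_trans (ler_norm _); apply: kint_le => //.
  by have [_ ] := hka i.
have mk : measurable_fun setT (fun w => 2 / eps * kint f eps n%:R w).
  by apply: (@measurable_fun_cvg _ _ _ setT (fun i w => 2 / eps * kint (p i) eps n%:R w)).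
split.
  rewrite (_ : kint f eps n%:R = fun w => (eps / 2) * (2 / eps * kint f eps n%:R w)).
    exact: measurable_funM.
  by apply/funext => w; field; rewrite gt_eqF.
have sfE : (fine (sqn mu f))%:E = sqn mu f by rewrite fineK// ge0_fin_numE// sqn_ge0.
rewrite -sfE -EFinM.
apply: (@sqn_fatou _ _ _ P (fun i w => 2 / eps * kint (p i) eps n%:R w) _
  (fun i => C * (2 * (i.+1%:R^-1 * i.+1%:R^-1) + 2 * fine (sqn mu f)))) => //.
  move=> i; have [k0 si] := hka i; under eq_fun do rewrite kp.
  apply: le_trans (hC _ _ _ k0) _; rewrite lee_fin ler_wpM2l//.
  apply: (@le_trans _ _ ((ka i).1%:R^-1 * \sum_(0 <= j < n * (ka i).1) (ka i).2 j ^+ 2)).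
    rewrite ler_wpM2l ?invr_ge0// big_mkord; apply: ler_sum => j _.
    rewrite !exprMn -mulrDl ler_piMl ?sqr_ge0//.
    rewrite -(real_normK (num_real al)) -(real_normK (num_real be)).
    have := mulr_ge0 (normr_ge0 al) (normr_ge0 be).
    have : (`|al| + `|be|) ^+ 2 <= 1 by rewrite expr_le1// addr_ge0.
    by rewrite sqrrD; lra.
  rewrite -lee_fin -sqn_grid_fun// EFinD !EFinM sfE.
  rewrite (_ : grid_fun _ _ _ = fun s => - (f s - p i s) + f s); last first.
    by apply/funext => s; rewrite opprB subrK.
  have mB : measurable_fun allR (fun s => f s - p i s).
    by apply: measurable_funB => //; exact: measurable_grid_fun.
  apply: le_trans (sqnD _ _ _) _ => //; first exact: measurableT_comp.
  rewrite sqnN; apply: leeD => //; apply: lee_wpmul2l => //.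
have -> : 2 * C * fine (sqn mu f) = C * (2 * (0 * 0) + 2 * fine (sqn mu f)) by ring.
apply: cvgM; [exact: cvg_cst|apply: cvgD; [|exact: cvg_cst]].
apply: cvgM; [exact: cvg_cst|apply: cvgM; exact: cvg_harmonic].
Qed.


Let kint_restrict (f : R -> R) (r r' : R) w : r <= r' ->
  kint (f \_ `[0, r]) eps r' w = kint f eps r w.
Proof.
move=> rr; rewrite /kint Rintegral_mkcond [RHS]Rintegral_mkcond; congr Rintegral.
apply/funext => s; rewrite !patchE !mem_setE !in_itv/=.
have [s0|s0]/= := leP 0 s; last by [].
have [sr|sr] := leP s r; first by rewrite (le_trans sr rr).
by case: ifP => // _; rewrite mul0r.
Qed.

Let restrict_Lfun (f : R -> R) (I : interval R) : f \in Lfun mu 2%:E ->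
  f \_ [set` I] \in Lfun mu 2%:E.
Proof.
move=> /Lfun2P[mf sf]; have mI : measurable ([set` I] : set (measurableTypeR R)) by exact: measurable_itv.
have mfI : measurable_fun allR (f \_ [set` I]).
  by apply/(measurable_restrictT _ mI); exact: measurable_funTS.
apply/Lfun2P; split => //; apply: le_lt_trans sf; apply: sqn_le => // s.
by rewrite patchE; case: ifP => // _; rewrite normr0.
Qed.

Let kint_sqn (f : R -> R) (r : R) : f \in Lfun mu 2%:E -> 0 <= r ->
  measurable_fun setT (kint f eps r) /\
  (sqn P (fun w => 2 / eps * kint f eps r w)%R <= (2 * C)%:E * sqn mu f)%E.
Proof.
move=> hf r0; have /andP[_ rn] := Num.Theory.truncn_itv r0; set n := (Num.truncn r).+1 in rn.
have hfr := restrict_Lfun `[0, r] hf.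
have kE : kint (f \_ `[0, r]) eps n%:R = kint f eps r.
  by apply/funext => w; apply: kint_restrict; exact: ltW.
have [|mk sk] := kint_bounded_support (n := n) hfr.
  move=> s; rewrite patchE mem_setE in_itv/=; case: ifPn => // /andP[s0 sr] /negP[].
  by rewrite s0 (le_trans sr)// ltW.
rewrite kE in mk sk; split => //; apply: le_trans sk _.
apply: lee_wpmul2l; first by rewrite lee_fin mulr_ge0.
have /Lfun2P[mfr _] := hfr; have /Lfun2P[mf _] := hf.
apply: sqn_le => // s.
by rewrite patchE; case: ifP => // _; rewrite normr0.
Qed.

Let tail_cvg0 (f : R -> R) (c : R) : f \in Lfun mu 2%:E -> 0 < c ->
  exists n0, forall r, n0%:R <= r -> (sqn mu (fun s => f \_ `[0, +oo[ s - f \_ `[0, r] s)%R <= c%:E)%E.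
Proof.
move=> hf c0; have hfo := restrict_Lfun `[0, +oo[ hf.
have mr r : measurable_fun allR (f \_ `[0, r]) by have /Lfun2P[] := restrict_Lfun `[0, r] hf.
have /Lfun2P[mo so] := hfo.
have le_r n r s : n%:R <= r -> `|f \_ `[0, +oo[ s - f \_ `[0, r] s| <=
    `|f \_ `[0, +oo[ s - f \_ `[0, n%:R] s|.
  rewrite !patchE !mem_setE !in_itv/= andbT => nr.
  have [s0|s0]/= := leP 0 s; last by [].
  have [sr|sr] := leP s r; first by rewrite subrr normr0.
  by rewrite [s <= n%:R]leNgt (le_lt_trans nr sr).
have [n0 _ hn] : \forall n \near \oo,
    (sqn mu (fun s => f \_ `[0, +oo[ s - f \_ `[0, n%:R] s)%R <= c%:E)%E.
  apply: (@sqn_dct _ (fun n s => f \_ `[0, +oo[ s - f \_ `[0, n%:R] s) (f \_ `[0, +oo[)) => //.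
  - by move=> n; apply: measurable_funB.
  - move=> n s; rewrite !patchE !mem_setE !in_itv/= andbT.
    have [s0|s0]/= := leP 0 s; last by rewrite subrr.
    by case: ifP => _; rewrite ?subrr ?normr0// subr0.
  - move=> s _; have := @num_real _ s; have [s0|s0] := leP 0 s => _; last first.
      rewrite (_ : (fun n => _) = cst 0); first exact: cvg_cst.
      by apply/funext => n; rewrite !patchE !mem_setE !in_itv/= leNgt s0/= subrr.
    have /andP[_ sn] := Num.Theory.truncn_itv s0.
    rewrite -(cvg_shiftn (Num.truncn s).+1) [X in X @ _](_ : _ = cst 0); first exact: cvg_cst.
    apply/funext => n /=; rewrite !patchE !mem_setE !in_itv/= s0/= ifT ?subrr//.
    by rewrite (le_trans (ltW sn))// ler_nat leq_addl.
exists n0 => r nr; apply: le_trans (hn n0 (leqnn _)); apply: sqn_le.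
- exact: measurable_funB.
- exact: measurable_funB.
- by move=> s; exact: le_r.
Qed.

Let Lfun2B (f g : R -> R) : f \in Lfun mu 2%:E -> g \in Lfun mu 2%:E ->
  (fun s => f s - g s) \in Lfun mu 2%:E.
Proof.
move=> /Lfun2P[mf sf] /Lfun2P[mg sg]; apply/Lfun2P; split; first exact: measurable_funB.
apply: le_lt_trans (sqnD _ _ _) _ => //; first exact: measurableT_comp.
by rewrite sqnN; apply: lte_add_pinfty; exact: lte_mul_pinfty.
Qed.

Let kint_tail (f : R -> R) (r r' : R) : f \in Lfun mu 2%:E -> 0 <= r -> r <= r' ->
  (sqn P (fun w => 2 / eps * (kint f eps r' w - kint f eps r w))%R <=
   (2 * C)%:E * sqn mu (fun s => f \_ `[0, +oo[ s - f \_ `[0, r] s)%R)%E.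
Proof.
move=> hf r0 rr; have r'0 := le_trans r0 rr; have hfr := restrict_Lfun `[0, r] hf.
have hfo := restrict_Lfun `[0, +oo[ hf.
have hB : (fun s => f \_ `[0, +oo[ s - f \_ `[0, r] s) \in Lfun mu 2%:E by exact: Lfun2B.
have [_ +] := kint_sqn hB r'0.
congr (sqn _ _ <= _)%E; apply/funext => w; congr (_ * _).
rewrite kintB// kint_restrict//; congr (_ - _).
rewrite /kint; apply: eq_Rintegral => s; rewrite inE/= in_itv/= => /andP[s0 _].
by rewrite patchE mem_setE in_itv/= s0.
Qed.

(** The second moment bound, applied to the tail of the kernel, makes the
    integrals over bounded intervals a Cauchy family. *)
Lemma poisson_integral_cvg (f : R -> R) : f \in Lfun mu 2%:E ->
  L2_cvg P +oo (kint f eps) (poisson_integral P N psi theta eps f).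
Proof.
move=> hf; suff [X hX] : exists X, L2_cvg P +oo (kint f eps) X.
  exact: (@xgetPex _ (cst 0) [set X | L2_cvg P +oo (kint f eps) X] (ex_intro _ X hX)).
pose c' : R := (eps / 2) ^+ 2; have c'0 : 0 < c' by rewrite exprn_gt0// divr_gt0.
have kE r r' w : kint f eps r' w - kint f eps r w = (eps / 2) * (2 / eps * (kint f eps r' w - kint f eps r w)).
  by field; rewrite gt_eqF.
have mk r : 0 <= r -> measurable_fun setT (kint f eps r) by move=> r0; have [] := kint_sqn hf r0.
have cauchy c : 0 < c -> exists n0 : nat, forall r r', n0%:R <= r -> r <= r' ->
    (sqn P (fun w => kint f eps r' w - kint f eps r w)%R <= c%:E)%E.
  move=> c0; have d0 : 0 < c / (c' * (2 * C + 1)) by rewrite divr_gt0// mulr_gt0// ltr_wpDl// mulr_ge0.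
  have [n0 hn0] := tail_cvg0 hf d0; exists n0 => r r' nr rr.
  have r0 : 0 <= r by rewrite (le_trans _ nr).
  under eq_fun do rewrite kE.
  rewrite sqnZ//; last first.
    by apply: measurable_funM => //; apply: measurable_funB; apply: mk => //; exact: le_trans rr.
  apply: (@le_trans _ _ (c'%:E * ((2 * C)%:E * (c / (c' * (2 * C + 1)))%:E))%E).
    apply: lee_wpmul2l; first by rewrite lee_fin ltW.
    apply: le_trans (kint_tail hf r0 rr) _.
    by apply: lee_wpmul2l; [rewrite lee_fin mulr_ge0|exact: hn0].
  rewrite -!EFinM lee_fin.
  have C1 : 0 < 2 * C + 1 by rewrite ltr_wpDl// mulr_ge0.
  rewrite [leLHS](_ : _ = c * ((2 * C) / (2 * C + 1))); last by field; rewrite !gt_eqF// divr_gt0.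
  by apply: ler_piMr; [exact: ltW|rewrite ler_pdivrMr// mul1r lerDl].
have [||c c0|X hX cX] := @L2_complete _ _ _ P (fun k => kint f eps k%:R).
- by move=> k; exact: mk.
- move=> k; rewrite (_ : kint f eps k%:R = fun w => (eps / 2) * (2 / eps * kint f eps k%:R w)); last first.
    by apply/funext => w; field; rewrite gt_eqF.
  rewrite sqnZ//; last by apply: measurable_funM => //; exact: mk.
  have [_ sk] := kint_sqn hf (ler0n R k); have /Lfun2P[_ sf] := hf.
  have sfE : (fine (sqn mu f))%:E = sqn mu f by rewrite fineK// ge0_fin_numE// sqn_ge0.
  rewrite -sfE -EFinM in sk.
  apply: (@le_lt_trans _ _ (c'%:E * (2 * C * fine (sqn mu f))%:E)%E); last by rewrite -EFinM ltry.
  by apply: lee_wpmul2l => //; rewrite lee_fin ltW.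
- have [n0 hn0] := cauchy _ c0; exists n0 => k l k0 l0.
  have [kl|/ltW lk] := leP k l.
    by rewrite sqn_sym; apply: hn0; rewrite ler_nat.
  by apply: hn0; rewrite ler_nat.
exists X; split => //.
have /Lfun2P[mX _] := hX.
apply/(Lnorm2_cvg0P P) => c c0; have c4 : 0 < c / 4 by rewrite divr_gt0.
have [n0 hn0] := cauchy _ c4; have [K hK] := cX _ c4.
near=> r.
have nr : (maxn n0 K)%:R <= r by near: r; exact: nbhs_pinfty_ge.
have r0 : 0 <= r by rewrite (le_trans _ nr).
have -> : c = 2 * (c / 4) + 2 * (c / 4) by field.
apply: (@sqn_trans _ _ _ P (kint f eps (maxn n0 K)%:R)) => //.
- exact: mk.
- exact: mk.
- by apply: hn0 => //; rewrite ler_nat leq_maxl.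
- by apply: hK; rewrite leq_maxr.
Unshelve. all: by end_near. Qed.

Let kint_halfline (f : R -> R) : kint (f \_ `[0, +oo[) eps = kint f eps.
Proof.
apply/funext => r; apply/funext => w; apply: eq_Rintegral => s.
by rewrite inE/= in_itv/= => /andP[s0 _]; rewrite patchE mem_setE in_itv/= s0.
Qed.

(** The constant [4 * C + 1] does not depend on [eps], so that the approximation
    by grid functions commutes with the limit [eps -> 0]. *)
Lemma kac_stroock_approx (f : R -> R) m L a (c : R) : L2_halfline f -> (0 < m)%N -> 0 < c ->
  (sqn mu ((f \- grid_fun m L a)%R \_ `[0%R, +oo[) <= c%:E)%E ->
  measurable_fun setT (kac_stroock P N psi theta eps f) /\
  (sqn P (fun w => kac_stroock P N psi theta eps f w -
    wave_integral N theta m L (fun j => al * a j) (fun j => be * a j) eps w)%R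
   <= ((4 * C + 1) * c)%:E)%E.
Proof.
move=> hf m0 c0 hc; pose f0 := f \_ `[0, +oo[.
have pE : poisson_integral P N psi theta eps f = poisson_integral P N psi theta eps f0.
  rewrite /poisson_integral; congr L2_lim; have := kint_halfline f.
  by rewrite /kint -/f0 => ->.
have [/Lfun2P[mX _] /(Lnorm2_cvg0P P) cX] := poisson_integral_cvg hf.
have mk : measurable_fun setT (kac_stroock P N psi theta eps f).
  rewrite /kac_stroock pE; exact: measurable_funM.
split => //.
have d0 : 0 < (eps / 2) ^+ 2 * (c / 2) by rewrite mulr_gt0 ?exprn_gt0 ?divr_gt0.
near (pinfty_nbhs R) => r.
have Lr : L%:R / m%:R <= r by near: r; exact: nbhs_pinfty_ge.
have r0 : 0 <= r by rewrite (le_trans _ Lr)// divr_ge0.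
have hr : (sqn P (fun w => kint f0 eps r w - poisson_integral P N psi theta eps f0 w)%R
    <= ((eps / 2) ^+ 2 * (c / 2))%:E)%E by near: r; exact: cX.
have hg := grid_fun_Lfun L a m0.
have gE w : kint (grid_fun m L a) eps (L%:R / m%:R) w = kint (grid_fun m L a) eps r w.
  rewrite -(kint_restrict _ _ Lr); congr (kint _ _ _ w); apply/funext => s.
  rewrite patchE mem_setE in_itv/=; case: ifPn => // /negP; rewrite -[X in X -> _]/(~ _).
  have [s0|s0] := leP s 0; first by rewrite grid_fun_le0.
  by move=> h; rewrite grid_fun_gt// ltNge; apply/negP => h'; apply: h; rewrite (ltW s0).
have hB : (fun s => f0 s - grid_fun m L a s) \in Lfun mu 2%:E by exact: Lfun2B.
have [mB sB] := kint_sqn hB r0.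
have mf0 : measurable_fun setT (kint f0 eps r) by have [] := kint_sqn hf r0.
have mw := measurable_wave_integral poissonN theta L (fun j => al * a j) (fun j => be * a j) m0 e0.
have -> : (4 * C + 1) * c = 2 * (c / 2) + 2 * (2 * C * c) by field.
apply: (@sqn_trans _ _ _ P (fun w => 2 / eps * kint f0 eps r w)) => //.
- exact: measurable_funM.
- rewrite sqn_sym /kac_stroock pE; under eq_fun do rewrite -mulrBr.
  rewrite sqnZ; last exact: measurable_funB.
  apply: le_trans (lee_wpmul2l _ hr) _; first by rewrite lee_fin sqr_ge0.
  rewrite -EFinM lee_fin [leLHS](_ : _ = c / 2)//; field.
  by rewrite gt_eqF.
- under eq_fun do rewrite -kint_grid// gE -mulrBr -kintB//.
  apply: le_trans sB _; rewrite [(2 * C * c)%:E]EFinM; apply: lee_wpmul2l; first by rewrite lee_fin mulr_ge0.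
  apply: le_trans hc; rewrite le_eqVlt; apply/orP; left; apply/eqP; congr (sqn _ _).
  apply/funext => s; rewrite /f0 !patchE; case: ifPn => //.
  by rewrite mem_setE in_itv/= andbT -ltNge => s0; rewrite grid_fun_le0 ?subrr// ltW.
Unshelve. all: by end_near. Qed.

End kac_stroock.

(** * Moments of the centered normal distribution *)

Section normal.
Context (R : realType).
Local Notation mu := (@lebesgue_measure R).
Local Notation allR := (setT : set (measurableTypeR R)).
Implicit Types s r x : R.

Lemma normal_pdf_scale s r x : 0 < s -> 0 < r ->
  r * normal_pdf 0 (r * s) x = normal_pdf 0 s x * expR ((1 - r ^- 2) * (x ^+ 2 / (2 * s ^+ 2))).
Proof.
move=> s0 r0; have rs0 : 0 < r * s by rewrite mulr_gt0.
rewrite !normal_pdfE ?gt_eqF// /normal_peak /normal_fun -[RHS]mulrA -expRD mulrA; congr (_ * expR _).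
  rewrite [X in Num.sqrt X](_ : _ = r ^+ 2 * (s ^+ 2 * pi *+ 2)); last by rewrite exprMn -mulrA mulrnAr.
  by rewrite sqrtrM ?sqr_ge0// sqrtr_sqr ger0_norm ?(ltW r0)// invfM mulrA mulfV ?mul1r// gt_eqF.
by rewrite !subr0; field; rewrite !gt_eqF.
Qed.

(** The density is the Radon-Nikodym derivative, by uniqueness of the latter. *)
Lemma integral_normal_prob s (f : R -> R) : measurable_fun allR f -> (forall x, 0 <= f x) ->
  (\int[normal_prob 0 s]_x (f x)%:E = \int[mu]_x (f x * normal_pdf 0 s x)%:E)%E.
Proof.
move=> mf f0; have dom := @normal_prob_dominates R 0 s.
have mEf : measurable_fun allR (EFin \o f) by exact/measurable_EFinP.
rewrite -(@Radon_Nikodym_SigmaFinite.change_of_variables _ _ _ (normal_prob 0 s) mu dom (EFin \o f))//.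
  under [RHS]eq_integral do rewrite EFinM.
  apply: ae_eq_integral => //.
  - apply: emeasurable_funM => //; apply: (measurable_int mu).
    exact: Radon_Nikodym_SigmaFinite.f_integrable.
  - by apply: emeasurable_funM => //; apply/measurable_EFinP; exact: measurable_normal_pdf.
  - apply: ae_eqe_mul2l; apply: integral_ae_eq => //.
    + exact: Radon_Nikodym_SigmaFinite.f_integrable.
    + by apply/measurable_EFinP; exact: measurable_normal_pdf.
    + by move=> E _ mE; rewrite -Radon_Nikodym_SigmaFinite.f_integral.
Qed.

(** Comparing the density with the density of another variance, through
    [1 + y <= expR y], bounds the second moment on both sides. *)
Lemma sqn_normal s : 0 < s -> sqn (normal_prob 0 s) idfun = (s ^+ 2)%:E.
Proof.
move=> s0; have s2 : 0 < 2 * s ^+ 2 by rewrite mulr_gt0// exprn_gt0.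
have ms r : measurable_fun allR (normal_pdf 0 r) by exact: measurable_normal_pdf.
have mx : measurable_fun allR (fun x => x ^+ 2) by exact: measurable_funX.
rewrite /sqn integral_normal_prob//; last by move=> x; exact: sqr_ge0.
set M : \bar R := integral _ _ _.
have q0 r x : (0 <= (normal_pdf 0 r x)%:E)%E by rewrite lee_fin normal_pdf_ge0.
have xq0 r x : (0 <= (x ^+ 2 * normal_pdf 0 r x)%:E)%E.
  by rewrite lee_fin mulr_ge0 ?normal_pdf_ge0// sqr_ge0.
have mxq r : measurable_fun allR (fun x => (x ^+ 2 * normal_pdf 0 r x)%:E).
  by apply/measurable_EFinP; exact: measurable_funM.
have M0 : (0 <= M)%E by apply: integral_ge0.
have iZ (c : R) r : 0 <= c -> (\int[mu]_x (c * normal_pdf 0 r x)%:E = c%:E)%E.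
  move=> c0; under eq_integral do rewrite EFinM.
  rewrite ge0_integralZl//; last by apply/measurable_EFinP.
  by rewrite integral_normal_pdf mule1.
have iM (c : R) : 0 <= c -> (\int[mu]_x (c * (x ^+ 2 * normal_pdf 0 s x))%:E = c%:E * M)%E.
  by move=> c0; under eq_integral do rewrite EFinM; rewrite ge0_integralZl.
have le r x : 0 < r ->
    normal_pdf 0 s x * (1 + (1 - r ^- 2) * (x ^+ 2 / (2 * s ^+ 2))) <= r * normal_pdf 0 (r * s) x.
  by move=> r0; rewrite normal_pdf_scale// ler_wpM2l ?normal_pdf_ge0// expR_ge1Dx.
have inv2 (r : R) : 1 < r -> 0 < 1 - r ^- 2.
  by move=> r1; rewrite subr_gt0 invf_lt1 ?exprn_egt1// exprn_gt0// (lt_trans _ r1).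
have inv2' (r : R) : 0 < r -> r < 1 -> 0 < r ^- 2 - 1.
  by move=> r0 r1; rewrite subr_gt0 invf_gt1 ?exprn_gt0// exprn_ilt1 ?ltW.
have up r : 1 < r -> (1 + ((1 - r ^- 2) / (2 * s ^+ 2))%:E * M <= r%:E)%E.
  move=> r1; have r0 : 0 < r by rewrite (lt_trans _ r1).
  have c0 : 0 <= (1 - r ^- 2) / (2 * s ^+ 2).
    by apply: divr_ge0; apply: ltW => //; exact: inv2.
  rewrite -(integral_normal_pdf 0 s) -iM// -ge0_integralD//; first last.
  - by apply/measurable_EFinP; apply: measurable_funM => //; exact: measurable_funM.
  - by move=> x _; rewrite lee_fin mulr_ge0// -lee_fin.
  - by apply/measurable_EFinP.
  rewrite -(iZ r (r * s)) ?(ltW r0)//; apply: ge0_le_integral => //.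
  - by move=> x _; rewrite adde_ge0// lee_fin mulr_ge0// -lee_fin.
  - by apply/measurable_EFinP; apply: measurable_funD => //; apply: measurable_funM => //; exact: measurable_funM.
  - by apply/measurable_EFinP; exact: measurable_funM.
  - move=> x _; rewrite -EFinD lee_fin; apply: le_trans (le r x r0).
    by rewrite le_eqVlt; apply/orP; left; apply/eqP; ring.
have lo r : 0 < r -> r < 1 -> (1 <= r%:E + ((r ^- 2 - 1) / (2 * s ^+ 2))%:E * M)%E.
  move=> r0 r1.
  have c0 : 0 <= (r ^- 2 - 1) / (2 * s ^+ 2).
    by apply: divr_ge0; apply: ltW => //; exact: inv2'.
  rewrite -{1}(integral_normal_pdf 0 s) -iM// -(iZ r (r * s)) ?(ltW r0)// -ge0_integralD//; first last.
  - by apply/measurable_EFinP; apply: measurable_funM => //; exact: measurable_funM.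
  - by move=> x _; rewrite lee_fin mulr_ge0// -lee_fin.
  - by apply/measurable_EFinP; exact: measurable_funM.
  - by move=> x _; rewrite lee_fin mulr_ge0 ?(ltW r0)// normal_pdf_ge0.
  apply: ge0_le_integral => //.
  - by apply/measurable_EFinP.
  - by apply/measurable_EFinP; apply: measurable_funD; apply: measurable_funM => //; exact: measurable_funM.
  - move=> x _; rewrite -EFinD lee_fin -lerBlDr; apply: le_trans (le r x r0).
    by rewrite le_eqVlt; apply/orP; left; apply/eqP; ring.
have Mfin : M \is a fin_num.
  rewrite ge0_fin_numE// ltey; apply/negP => /eqP ME.
  have l2 : (1 : R) < 2 by rewrite ltr1n.
  have := up 2 l2; rewrite ME gt0_muley//.
  by rewrite lte_fin divr_gt0// inv2.
have [y ME] : exists y, M = y%:E by exists (fine M); rewrite fineK.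
rewrite ME in up lo M0 *; rewrite lee_fin in M0.
have [m ye] : exists m, y = m * s ^+ 2 by exists (y / s ^+ 2); rewrite divfK// gt_eqF// exprn_gt0.
have m0 : 0 <= m by move: M0; rewrite ye pmulr_lge0// exprn_gt0.
have {}up r : 1 < r -> m * (1 + r) <= 2 * r ^+ 2.
  move=> r1; have r0 : 0 < r by rewrite (lt_trans _ r1).
  have := up r r1; rewrite -EFinM -EFinD lee_fin ye.
  have -> : (1 - r ^- 2) / (2 * s ^+ 2) * (m * s ^+ 2) = (r - 1) * (m * (1 + r) / (2 * r ^+ 2)).
    by field; rewrite !gt_eqF.
  rewrite -lerBrDl -{2}(mulr1 (r - 1)) ler_pM2l ?subr_gt0// ler_pdivrMr ?mul1r//.
  by rewrite mulr_gt0// exprn_gt0.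
have {}lo r : 0 < r -> r < 1 -> 2 * r ^+ 2 <= m * (1 + r).
  move=> r0 r1; have := lo r r0 r1; rewrite -EFinM -EFinD lee_fin ye.
  have -> : (r ^- 2 - 1) / (2 * s ^+ 2) * (m * s ^+ 2) = (1 - r) * (m * (1 + r) / (2 * r ^+ 2)).
    by field; rewrite !gt_eqF.
  rewrite -lerBlDl -{1}(mulr1 (1 - r)) ler_pM2l ?subr_gt0// ler_pdivlMr ?mul1r//.
  by rewrite mulr_gt0// exprn_gt0.
rewrite ye; suff -> : m = 1 by rewrite mul1r.
apply/eqP; rewrite eq_le; apply/andP; split; rewrite leNgt; apply/negP => h.
  (* the harmonic mean of 1 and m is at most their geometric mean *)
  have m1 : 0 < 1 + m by lra.
  have := up (2 * m / (1 + m)); rewrite ltr_pdivlMr// => /(_ ltac:(lra)).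
  have -> : m * (1 + 2 * m / (1 + m)) = m * (1 + 3 * m) * (1 + m) / (1 + m) ^+ 2.
    by field; rewrite gt_eqF.
  have -> : 2 * (2 * m / (1 + m)) ^+ 2 = m * (8 * m) / (1 + m) ^+ 2 by field; rewrite gt_eqF.
  rewrite ler_pM2r ?invr_gt0 ?exprn_gt0// -mulrA ler_pM2l//; last by lra.
  have : 0 < (m - 1) ^+ 2 by rewrite exprn_even_gt0//= subr_eq0 gt_eqF.
  nra.
have := lo ((1 + m) / 2); have r0 : 0 < (1 + m) / 2 by lra.
have : (1 + m) / 2 < 1 by lra.
move=> h1 /(_ r0 h1); have : 0 < (m - 1) ^+ 2 by rewrite exprn_even_gt0//= subr_eq0 lt_eqF.
nra.
Qed.

(** Doubling the standard deviation of the density absorbs the fourth power. *)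
Lemma normal_fourth_moment s : 0 < s ->
  (\int[normal_prob 0 s]_x (x ^+ 4)%:E <= (64 * s ^+ 4)%:E)%E.
Proof.
move=> s0; have mx : measurable_fun allR (fun x => x ^+ 4) by exact: measurable_funX.
rewrite integral_normal_prob//; last by move=> x; exact: exprn_even_ge0.
apply: (@le_trans _ _ (\int[mu]_x ((64 * s ^+ 4)%:E * (normal_pdf 0 (2 * s) x)%:E))%E); last first.
  rewrite ge0_integralZl//.
  - by rewrite integral_normal_pdf mule1.
  - by apply/measurable_EFinP; exact: measurable_normal_pdf.
  - by move=> x _; rewrite lee_fin normal_pdf_ge0.
  - by rewrite lee_fin mulr_ge0// exprn_ge0// ltW.
apply: ge0_le_integral => //.
- by move=> x _; rewrite lee_fin mulr_ge0 ?normal_pdf_ge0// exprn_even_ge0.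
- by apply/measurable_EFinP; apply: measurable_funM => //; exact: measurable_normal_pdf.
- by apply/measurable_EFinP; apply: measurable_funM => //; exact: measurable_normal_pdf.
move=> x _; rewrite -EFinM lee_fin.
have h := normal_pdf_scale x s0 (ltr0n R 2).
set q := normal_pdf 0 s x in h *; set q2 := normal_pdf 0 (2 * s) x in h *.
pose y := 3 * x ^+ 2 / (8 * s ^+ 2).
have y0 : 0 <= y by apply: divr_ge0; apply: mulr_ge0 => //; exact: sqr_ge0.
have ey : y ^+ 2 <= 4 * expR y.
  have -> : y = y / 2 + y / 2 by field.
  rewrite expRD; have := expR_ge1Dx (y / 2); nra.
have q0 : 0 <= q by exact: normal_pdf_ge0.
have -> : x ^+ 4 = 64 / 9 * s ^+ 4 * y ^+ 2 by rewrite /y; field; rewrite gt_eqF.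
have e2 : (1 - 2 ^- 2) * (x ^+ 2 / (2 * s ^+ 2)) = y :> R by rewrite /y; field; rewrite gt_eqF.
rewrite e2 in h.
have s4 : 0 <= s ^+ 4 by rewrite exprn_ge0// ltW.
have h2 : q * y ^+ 2 <= 8 * q2.
  rewrite (_ : 8 * q2 = q * (4 * expR y)); first by rewrite ler_wpM2l.
  by rewrite mulrCA -h; ring.
have q20 : 0 <= q2 by exact: normal_pdf_ge0.
have := ler_wpM2l s4 h2; have := mulr_ge0 s4 q20; lra.
Qed.

Lemma normal_prob_opp s (B : set (measurableTypeR R)) : s != 0 -> measurable B ->
  normal_prob 0 s (-%R @^-1` B) = normal_prob 0 s B.
Proof.
move=> s0 mB; rewrite /normal_prob.
have mN : measurable_fun allR (-%R : measurableTypeR R -> measurableTypeR R) by exact: oppr_measurable.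
transitivity (\int[pushforward mu (-%R : _ -> measurableTypeR R)]_(x in B) (normal_pdf 0 s x)%:E)%E.
  rewrite ge0_integral_pushforward//.
  - apply: eq_integral => x _ /=; rewrite !normal_pdfE//; congr (_ * expR _)%:E.
    by rewrite !subr0 sqrrN.
  - by apply: measurable_funTS; apply/measurable_EFinP; exact: measurable_normal_pdf.
  - by move=> x _; rewrite lee_fin normal_pdf_ge0.
by apply: eq_measure_integral => A mA _; exact: (lebesgue_measureN mA).
Qed.

End normal.

(** * Factorization of means under independence *)

Section independence.
Context (R : realType) (d : measure_display) (Omega : measurableType d).
Context (P : probability Omega R).
Local Notation allR := (setT : set (measurableTypeR R)).
Import HBNNSimple.

Definition ind (X : Omega -> R) (B : set R) (w : Omega) : R := \1_B (X w).

Lemma bounded_ind X (B : set (measurableTypeR R)) : measurable_fun setT X -> measurable B ->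
  bounded_rv (ind X B).
Proof.
move=> mX mB; split; last first.
  by exists 1 => w; rewrite /ind indicE; case: (_ \in _); rewrite ?normr1 ?normr0.
by apply: (@measurableT_comp _ _ _ _ _ _ (\1_B : measurableTypeR R -> R)).
Qed.

(** A product rule for the indicators of [X] extends to bounded functions of
    [X]: up to a constant these are increasing limits of simple functions. *)
Lemma mean_factor (X Z : Omega -> R) (c : R) (f : R -> R) (M : R) :
  measurable_fun setT X -> bounded_rv Z ->
  (forall B : set (measurableTypeR R), measurable B ->
     mean P (fun w => ind X B w * Z w) = mean P (ind X B) * c) ->
  measurable_fun allR f -> (forall x, `|f x| <= M) ->
  mean P (fun w => f (X w) * Z w) = mean P (fun w => f (X w)) * c.
Proof.
move=> mX bZ hB mf fM; pose g x : \bar R := (f x + M)%:E.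
have mg : measurable_fun allR g by apply/measurable_EFinP; exact: measurable_funD.
have g0 x : (0 <= g x)%E.
  by rewrite lee_fin; have := fM x; rewrite ler_norml => /andP[]; lra.
pose h n : {nnsfun measurableTypeR R >-> R} := nnsfun_approx measurableT mg n.
have hc (x : R) : (h n x : R) @[n --> \oo] --> (f x + M : R).
  have := @cvg_nnsfun_approx _ (measurableTypeR R) R setT measurableT g mg (fun x _ => g0 x) x Logic.I.
  by move=> gc; exact: (fine_cvg gc).
have hle n x : h n x <= f x + M.
  have nd : nondecreasing_seq (fun n => h n x).
    move=> i j ij; have /lefP := @nd_nnsfun_approx _ (measurableTypeR R) R setT measurableT g mg i j ij.
    exact.
  rewrite -(cvg_lim _ (hc x))//; apply: nondecreasing_cvgn_le => //.
  by apply/cvg_ex; eexists; exact: hc.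
have h0 n x : 0 <= h n x by [].
have hM n x : `|h n x| <= 2 * M.
  rewrite ger0_norm// (le_trans (hle n x))//; have := fM x; rewrite ler_norml => /andP[_].
  by lra.
have bh n : bounded_rv (fun w => h n (X w)).
  have mh : measurable_fun allR (h n) by exact: measurable_funPT.
  have mX' : measurable_fun setT (X : Omega -> measurableTypeR R) := mX.
  by split; [exact: (measurableT_comp mh mX')|exists (2 * M) => w; exact: hM].
have simple n : mean P (fun w => h n (X w) * Z w) = mean P (fun w => h n (X w)) * c.
  pose s : seq R := finmap.enum_fset (fset_set (range (h n))).
  have hE w : h n (X w) = \sum_(y <- s) y * ind X (h n @^-1` [set y]) w.
    by rewrite fimfunE fsbig_finite.
  have bi y : bounded_rv (ind X (h n @^-1` [set y])) by exact: bounded_ind.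
  under eq_fun do rewrite hE mulr_suml.
  under [in RHS]eq_fun do rewrite hE.
  rewrite !mean_sum; first last.
  - move=> y; under eq_fun do rewrite -mulrA.
    by apply: bounded_rvZ; exact: bounded_rvM.
  - by move=> y; exact: bounded_rvZ.
  rewrite mulr_suml; apply: eq_bigr => y _.
  under eq_fun do rewrite -mulrA.
  by rewrite !meanZ//; [rewrite hB// mulrA|exact: bounded_rvM].
have bf : bounded_rv (fun w => f (X w)) by exact: bounded_rv_comp mf fM mX.
have [mZ [K hK]] := bZ.
have lim1 : mean P (fun w => h n (X w) * Z w) @[n --> \oo] --> mean P (fun w => (f (X w) + M) * Z w).
  apply: (@mean_cvg _ _ _ _ _ _ (2 * M * K)).
  - by move=> n; apply: measurable_funM => //; have [] := bh n.
  - by apply: measurable_funM => //; apply: measurable_funD => //; have [] := bf.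
  - by move=> n w; rewrite normrM ler_pM.
  - by move=> w; apply: cvgM; [exact: hc|exact: cvg_cst].
have lim2 : mean P (fun w => h n (X w)) * c @[n --> \oo] --> mean P (fun w => f (X w) + M) * c.
  apply: cvgM; last exact: cvg_cst.
  apply: (@mean_cvg _ _ _ _ _ _ (2 * M)).
  - by move=> n; have [] := bh n.
  - by apply: measurable_funD => //; have [] := bf.
  - by move=> n w.
  - by move=> w; exact: hc.
have bM : bounded_rv (fun=> M : R) := bounded_rv_cst _ M.
have lim : mean P (fun w => (f (X w) + M) * Z w) = mean P (fun w => f (X w) + M) * c.
  have e : (fun n => mean P (fun w => h n (X w) * Z w)) = (fun n => mean P (fun w => h n (X w)) * c).
    by apply/funext => n; exact: simple.
  by rewrite -(cvg_lim _ lim1)// e; exact: cvg_lim.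
have hT : mean P Z = c.
  have := hB setT measurableT; rewrite /ind.
  under eq_fun do rewrite indicT mul1r.
  by move=> ->; under eq_fun do rewrite indicT; rewrite mean_cst mul1r.
move: lim; under eq_fun do rewrite mulrDl.
rewrite !meanD//; [|exact: bounded_rvM|exact: bounded_rvZ].
by rewrite meanZ// hT mean_cst mulrDl => /addIr.
Qed.

(** Increments with a symmetric law contribute the mean of their cosine to the
    characteristic function of their sum; they are peeled off one at a time,
    the indicators of the others being absorbed in the weight [Z]. *)
Lemma indep_char (X : nat -> Omega -> R) (a phi : nat -> R) n (Z : Omega -> R) (p : R) :
  (forall i, measurable_fun setT (X i)) -> bounded_rv Z ->
  (forall B : nat -> set (measurableTypeR R), (forall i, measurable (B i)) ->
    mean P (fun w => Z w * \prod_(i < n) ind (X i) (B i) w) =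
    mean P Z * \prod_(i < n) mean P (ind (X i) (B i))) ->
  (forall i, mean P (fun w => cos (a i * X i w)) = phi i) ->
  (forall i, mean P (fun w => sin (a i * X i w)) = 0) ->
  mean P (fun w => Z w * cos (\sum_(i < n) a i * X i w + p)) =
  mean P Z * cos p * \prod_(i < n) phi i.
Proof.
move=> mX bZ + hc hs; elim: n => [|n IH] in Z p bZ * => hB.
  under eq_fun do rewrite big_ord0 add0r mulrC.
  by rewrite meanZ// big_ord0 mulr1 mulrC.
pose S w := \sum_(i < n) a i * X i w.
have mS : measurable_fun setT S.
  by apply: measurable_sum => i; exact: measurable_funM.
have bcS q : bounded_rv (fun w => cos (S w + q)).
  by apply: bounded_rv_cos; exact: measurable_funD.
have bZS q : bounded_rv (fun w => Z w * cos (S w + q)) by exact: bounded_rvM.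
have key q (B : set (measurableTypeR R)) : measurable B ->
    mean P (fun w => ind (X n) B w * (Z w * cos (S w + q))) =
    mean P (ind (X n) B) * (mean P Z * cos q * \prod_(i < n) phi i).
  move=> mB; have bI : bounded_rv (ind (X n) B) by exact: bounded_ind.
  have bIZ : bounded_rv (fun w => ind (X n) B w * Z w) by exact: bounded_rvM.
  have hn (B' : nat -> set (measurableTypeR R)) : (forall i, measurable (B' i)) ->
      mean P (fun w => ind (X n) B w * Z w * \prod_(i < n) ind (X i) (B' i) w) =
      mean P Z * mean P (ind (X n) B) * \prod_(i < n) mean P (ind (X i) (B' i)).
    move=> mB'; have := hB (fun i => if (i < n)%N then B' i else B).
    move=> /(_ ltac:(by move=> i; case: ifP)).
    rewrite big_ord_recr/= ltnn => e.
    transitivity (mean P Z * ((\prod_(i < n) mean P (ind (X i) (if (i < n)%N then B' i else B)))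
        * mean P (ind (X n) B))).
      rewrite -e; congr mean; apply/funext => w; rewrite big_ord_recr/= ltnn.
      rewrite [ind _ _ _ * Z w]mulrC -mulrA [in LHS](mulrC (ind _ _ _)); congr (_ * (_ * _)).
      by apply: eq_bigr => i _; rewrite ltn_ord.
    rewrite [in RHS]mulrAC -mulrA; congr (_ * (_ * _)).
    by apply: eq_bigr => i _; rewrite ltn_ord.
  have ZE : mean P (fun w => ind (X n) B w * Z w) = mean P Z * mean P (ind (X n) B).
    have := hn (fun=> setT) (fun=> measurableT).
    rewrite [X in _ * _ * X]big1 => [|i _].
      rewrite mulr1 => <-; congr mean; apply/funext => w.
      by rewrite big1 ?mulr1// => i _; rewrite /ind indicT.
    by rewrite /ind; under eq_fun do rewrite indicT; exact: mean_cst.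
  under eq_fun do rewrite mulrA.
  rewrite (IH (fun w => ind (X n) B w * Z w) q bIZ).
    by rewrite ZE; ring.
  by move=> B' mB'; rewrite ZE; exact: hn.
have cE w : Z w * cos (\sum_(i < n.+1) a i * X i w + p) =
    cos (a n * X n w) * (Z w * cos (S w + p)) -
    sin (a n * X n w) * (Z w * cos (S w + (p - pi / 2))).
  rewrite big_ord_recr/= -/(S w) addrA cosBpihalf addrAC cosD; ring.
under eq_fun do rewrite cE.
have mcos : measurable_fun allR (fun x => cos (a n * x)).
  by apply: measurableT_comp; [exact: measurable_cos|exact: measurable_funM].
have msin : measurable_fun allR (fun x => sin (a n * x)).
  by apply: measurableT_comp; [exact: measurable_sin|exact: measurable_funM].
have fcos := mean_factor (mX n) (bZS p) (key p) mcos (fun x => cos_max _).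
have fsin := mean_factor (mX n) (bZS (p - pi / 2)) (key (p - pi / 2)) msin (fun x => sin_max _).
have maX : measurable_fun setT (fun w => a n * X n w) by exact: measurable_funM.
rewrite meanB; last 2 first.
- by apply: bounded_rvM => //; exact: bounded_rv_cos.
- by apply: bounded_rvM => //; exact: bounded_rv_sin.
by rewrite fcos fsin hc hs mul0r subr0 big_ord_recr/=; ring.
Qed.

Lemma prod_ind n (X : nat -> Omega -> R) (B : nat -> set (measurableTypeR R)) :
  (fun w => \prod_(i < n) ind (X i) (B i) w) =
  \1_(\bigcap_(i in [set: 'I_n]) (X i @^-1` B i)).
Proof.
apply/funext => w; rewrite indicE; case: (boolP (w \in _)) => [|/negP].
  rewrite inE => h; rewrite big1// => i _; rewrite /ind indicE mem_set//; exact: (h i Logic.I).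
rewrite inE => h.
have [i ni] : exists i : 'I_n, ~ B i (X i w).
  by apply: contrapT => no; apply: h => i _; apply: contrapT => ni; apply: no; exists i.
by rewrite (bigD1 i)//= /ind indicE memNset// mul0r.
Qed.

(** The product rule for events, read on indicators. *)
Lemma mutually_independent_mean n (X : nat -> Omega -> R) (B : nat -> set (measurableTypeR R)) :
  mutually_independent P (fun (i : 'I_n) => X i : Omega -> measurableTypeR R) ->
  (forall i, measurable_fun setT (X i)) -> (forall i, measurable (B i)) ->
  mean P (fun w => \prod_(i < n) ind (X i) (B i) w) = \prod_(i < n) mean P (ind (X i) (B i)).
Proof.
move=> indX mX mB.
have mXB i : measurable (X i @^-1` B i).
  have mXi : measurable_fun setT (X i : Omega -> measurableTypeR R) := mX i.
  by rewrite -[X in measurable X]setTI; exact: mXi.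
have iE i : mean P (ind (X i) (B i)) = fine (P (X i @^-1` B i)).
  by rewrite -mean_indic//.
rewrite prod_ind mean_indic; last by apply: fin_bigcap_measurable.
rewrite (indX (fun i => B i))//.
under [RHS]eq_bigr do rewrite iE.
transitivity (fine (\prod_(i < n) (fine (P (X i @^-1` B i)))%:E)%E); last by rewrite prodEFin.
by congr fine; apply: eq_bigr => i _; rewrite fineK// fin_num_measure.
Qed.

End independence.

(** * Increments of a Brownian motion *)

Section brownian.
Context (R : realType) (d : measure_display) (Omega : measurableType d).
Context (P : probability Omega R) (W : R -> Omega -> R).
Hypothesis brownianW : standard_brownian_motion P W.
Local Notation mu := (@lebesgue_measure R).
Local Notation allR := (setT : set (measurableTypeR R)).
Implicit Types s t xi : R.

Definition incr s t (w : Omega) : R := W t w - W s w.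

Lemma measurable_incr s t : 0 <= s -> 0 <= t -> measurable_fun setT (incr s t).
Proof. by move=> s0 t0; apply: measurable_funB; exact: brownian_measurable brownianW _ _. Qed.

Lemma integral_incr s t (f : R -> R) : 0 <= s -> s < t -> measurable_fun allR f ->
  (forall x, 0 <= f x) ->
  (\int[P]_w (f (incr s t w))%:E = \int[normal_prob 0 (Num.sqrt (t - s))]_x (f x)%:E)%E.
Proof.
move=> s0 st mf f0.
have mi : measurable_fun setT (incr s t : Omega -> measurableTypeR R).
  by apply: measurable_incr => //; rewrite (le_trans s0)// ltW.
have := @ge0_integral_pushforward _ _ _ _ _ _ mi P setT (EFin \o f) measurableT.
rewrite preimage_setT => <-//; last 2 first.
- exact/measurable_EFinP.
- by move=> x _; rewrite lee_fin.
by apply: eq_measure_integral => A mA _; exact: (brownian_increment_law brownianW).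
Qed.

Lemma sqn_incr s t : 0 <= s -> s <= t -> sqn P (incr s t) = (t - s)%:E.
Proof.
move=> s0; rewrite le_eqVlt => /predU1P[->|st].
  by rewrite subrr /incr; under eq_fun do rewrite subrr; rewrite sqn_cst expr0n.
have ts : 0 < t - s by rewrite subr_gt0.
have mx : measurable_fun allR (fun x : R => x ^+ 2) by exact: measurable_funX.
rewrite /sqn (@integral_incr s t (fun x => x ^+ 2))//; last by move=> x; exact: sqr_ge0.
have := @sqn_normal R (Num.sqrt (t - s)); rewrite sqrtr_gt0 => /(_ ts).
by rewrite /sqn sqr_sqrtr// ltW.
Qed.

Let fourth_moment_incr s t : 0 <= s -> s < t ->
  (\int[P]_w (incr s t w ^+ 4)%:E <= (64 * (t - s) ^+ 2)%:E)%E.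
Proof.
move=> s0 st; have ts : 0 < t - s by rewrite subr_gt0.
have mx : measurable_fun allR (fun x : R => x ^+ 4) by exact: measurable_funX.
rewrite (@integral_incr s t (fun x => x ^+ 4))//; last by move=> x; exact: exprn_even_ge0.
have := @normal_fourth_moment R (Num.sqrt (t - s)); rewrite sqrtr_gt0 => /(_ ts).
by rewrite (_ : 4%N = (2 * 2)%N)// exprM sqr_sqrtr// ltW.
Qed.

(** The law of an increment is symmetric. *)
Lemma mean_sin_incr s t xi : 0 <= s -> s <= t ->
  mean P (fun w => sin (xi * incr s t w)) = 0.
Proof.
move=> s0; rewrite le_eqVlt => /predU1P[<-|st].
  by rewrite /incr; under eq_fun do rewrite subrr mulr0 sin0; exact: mean_cst.
have mi : measurable_fun setT (incr s t).
  by apply: measurable_incr => //; rewrite (le_trans s0)// ltW.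
have bs (c : R) : bounded_rv (fun w => sin (c * incr s t w)).
  by apply: bounded_rv_sin; exact: measurable_funM.
have m1 (c : R) : mean P (fun w => 1 + sin (c * incr s t w)) = 1 + mean P (fun w => sin (c * incr s t w)).
  by rewrite meanD//; [rewrite mean_cst|exact: bounded_rv_cst].
have ms (c : R) : measurable_fun allR (fun x => 1 + sin (c * x)).
  apply: measurable_funD => //; apply: measurableT_comp; first exact: measurable_sin.
  exact: measurable_funM.
have s1 (c : R) x : 0 <= 1 + sin (c * x) by rewrite addrC -lerBlDr sub0r sin_geN1.
have sq : Num.sqrt (t - s) != 0 by rewrite gt_eqF// sqrtr_gt0 subr_gt0.
suff e : mean P (fun w => 1 + sin (xi * incr s t w)) = mean P (fun w => 1 + sin (- xi * incr s t w)).
  move: e; rewrite !m1 => /addrI.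
  under [in RHS]eq_fun do rewrite mulNr sinN -mulN1r.
  by rewrite meanZ// mulN1r => /eqP; rewrite -addr_eq0 -mulr2n mulrn_eq0/= => /eqP.
rewrite /mean /Rintegral; congr fine.
rewrite (@integral_incr s t (fun x => 1 + sin (xi * x)))//.
rewrite (@integral_incr s t (fun x => 1 + sin (- xi * x)))//.
have mN : measurable_fun allR (-%R : measurableTypeR R -> measurableTypeR R) by exact: oppr_measurable.
transitivity (\int[pushforward (normal_prob 0 (Num.sqrt (t - s))) (-%R : measurableTypeR R -> measurableTypeR R)]_x
    (1 + sin (xi * x))%:E)%E.
  apply: eq_measure_integral => A mA _; exact/esym/(normal_prob_opp sq mA).
have mE : measurable_fun allR (EFin \o (fun x => 1 + sin (xi * x))) by apply/measurable_EFinP.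
rewrite ge0_integral_pushforward//.
rewrite preimage_setT; apply: eq_integral => x _ /=.
by rewrite mulrN mulNr.
Qed.

Let integrable_pow s t n (c : R) : 0 <= s -> s < t -> ~~ odd n ->
  (\int[P]_w (incr s t w ^+ n)%:E <= c%:E)%E ->
  P.-integrable setT (EFin \o (fun w => incr s t w ^+ n)).
Proof.
move=> s0 st en hc; have mi : measurable_fun setT (incr s t).
  by apply: measurable_incr => //; rewrite (le_trans s0)// ltW.
apply/integrableP; split; first by apply/measurable_EFinP; exact: measurable_funX.
apply: le_lt_trans (ltry c); apply: le_trans hc.
rewrite le_eqVlt; apply/orP; left; apply/eqP; apply: eq_integral => w _ /=.
by rewrite ger0_norm// exprn_even_ge0.
Qed.

(** The second order expansion is exact up to the fourth moment. *)
Lemma mean_cos_incr_taylor s t xi : 0 <= s -> s <= t ->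
  `|mean P (fun w => cos (xi * incr s t w)) - (1 - xi ^+ 2 * (t - s) / 2)|
  <= 64 * (xi ^+ 2 * (t - s)) ^+ 2.
Proof.
move=> s0; rewrite le_eqVlt => /predU1P[<-|st].
  rewrite /incr; under eq_fun do rewrite subrr mulr0 cos0.
  by rewrite mean_cst !subrr mulr0 mul0r subr0 subrr normr0 expr0n mulr0.
have mi : measurable_fun setT (incr s t).
  by apply: measurable_incr => //; rewrite (le_trans s0)// ltW.
have i2 : P.-integrable setT (EFin \o (fun w => incr s t w ^+ 2)).
  apply: (@integrable_pow s t 2 (t - s)) => //.
  by have := sqn_incr s0 (ltW st); rewrite /sqn => ->.
have i4 : P.-integrable setT (EFin \o (fun w => incr s t w ^+ 4)).
  by apply: (@integrable_pow s t 4) => //; exact: fourth_moment_incr.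
have ic : P.-integrable setT (EFin \o (fun w => cos (xi * incr s t w) - 1)).
  apply: bounded_rv_integrable; apply: bounded_rvB; last exact: bounded_rv_cst.
  by apply: bounded_rv_cos; exact: measurable_funM.
have i2' : P.-integrable setT (EFin \o (fun w => (xi ^+ 2 / 2) * incr s t w ^+ 2)).
  exact: (@integrableZl _ _ _ P setT measurableT _ _ i2).
have i4' : P.-integrable setT (EFin \o (fun w => xi ^+ 4 * incr s t w ^+ 4)).
  exact: (@integrableZl _ _ _ P setT measurableT _ _ i4).
have e2 : \int[P]_w (incr s t w ^+ 2) = t - s.
  by rewrite /Rintegral; have := sqn_incr s0 (ltW st); rewrite /sqn => ->.
have e4 : \int[P]_w (incr s t w ^+ 4) <= 64 * (t - s) ^+ 2.
  rewrite -lee_fin /Rintegral fineK; first exact: fourth_moment_incr.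
  exact: integrable_fin_num.
have -> : mean P (fun w => cos (xi * incr s t w)) - (1 - xi ^+ 2 * (t - s) / 2) =
    \int[P]_w (cos (xi * incr s t w) - 1 + (xi ^+ 2 / 2) * incr s t w ^+ 2).
  rewrite RintegralD// RintegralZl// e2.
  rewrite -/(mean P (fun w => cos (xi * incr s t w) - 1)) meanB; last 2 first.
  - by apply: bounded_rv_cos; exact: measurable_funM.
  - exact: bounded_rv_cst.
  by rewrite mean_cst; ring.
have i3 : P.-integrable setT (EFin \o (fun w => cos (xi * incr s t w) - 1 + (xi ^+ 2 / 2) * incr s t w ^+ 2)).
  exact: integrableD ic i2'.
apply: le_trans (le_normr_Rintegral _ i3) _ => //.
apply: (@le_trans _ _ (\int[P]_w (xi ^+ 4 * incr s t w ^+ 4))).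
  apply: le_Rintegral => //; first exact: (integrable_abse i3).
  move=> w _; rewrite -exprMn; have -> : xi ^+ 2 / 2 * incr s t w ^+ 2 = (xi * incr s t w) ^+ 2 / 2 by ring.
  exact: cos_taylor3.
rewrite RintegralZl// (_ : 64 * _ = xi ^+ 4 * (64 * (t - s) ^+ 2)); last by ring.
by rewrite ler_wpM2l// exprn_even_ge0.
Qed.

Let prod_dist (a : nat -> R) (b e : R) n : (forall i, `|a i| <= 1) -> `|b| <= 1 ->
  (forall i, (i < n)%N -> `|a i - b| <= e) -> `|\prod_(i < n) a i - b ^+ n| <= n%:R * e.
Proof.
move=> ha hb; have p1 k : `|\prod_(i < k) a i| <= 1.
  elim: k => [|k IH]; first by rewrite big_ord0 normr1.
  by rewrite big_ord_recr/= normrM mulr_ile1.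
elim: n => [|n IH] he; first by rewrite big_ord0 expr0 subrr normr0 mul0r.
rewrite big_ord_recr/= exprSr.
rewrite (_ : _ - _ = \prod_(i < n) a i * (a n - b) + b * (\prod_(i < n) a i - b ^+ n)); last by ring.
apply: le_trans (ler_normD _ _) _; rewrite !normrM -natr1 mulrDl mul1r addrC; apply: lerD.
  apply: le_trans (IH _); first by rewrite ler_piMl.
  by move=> i ni; apply: he; rewrite ltnW.
by apply: le_trans (he n _) => //; rewrite ler_piMl.
Qed.

Let indep_incr (t : nat -> R) (n : nat) (B : nat -> set (measurableTypeR R)) :
  0 <= t 0%N -> nondecreasing_seq t -> (forall i, measurable (B i)) ->
  mean P (fun w => \prod_(i < n) ind (incr (t i) (t i.+1)) (B i) w) =
  \prod_(i < n) mean P (ind (incr (t i) (t i.+1)) (B i)).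
Proof.
move=> t0 tn mB; have ti i : 0 <= t i by rewrite (le_trans t0)// tn.
apply: (@mutually_independent_mean _ _ _ P n (fun i => incr (t i) (t i.+1))) => //.
  exact: (brownian_independent_increments brownianW).
by move=> i; apply: measurable_incr.
Qed.

(** The characteristic function of an increment: split it into [n]
    independent increments and let [n] grow. *)
Lemma mean_cos_incr s t xi : 0 <= s -> s <= t ->
  mean P (fun w => cos (xi * incr s t w)) = expR (- (xi ^+ 2 * (t - s) / 2)).
Proof.
move=> s0 st; set v := xi ^+ 2 * (t - s).
have v0 : 0 <= v by rewrite mulr_ge0 ?sqr_ge0 ?subr_ge0.
apply/eqP; rewrite -subr_eq0 -normr_le0; apply/ler_addgt0Pl => e e0; rewrite addr0.
have bound n : (0 < n)%N ->
    `|mean P (fun w => cos (xi * incr s t w)) - expR (- (v / 2))| <= 65 * v ^+ 2 * n%:R^-1.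
  move=> n0; have n0' : (0 : R) < n%:R by rewrite ltr0n.
  pose tt i : R := s + (t - s) / n%:R * i%:R.
  have d0 : 0 <= (t - s) / n%:R by rewrite divr_ge0 ?subr_ge0.
  have tt0 i : 0 <= tt i by rewrite addr_ge0// mulr_ge0.
  have ttn : nondecreasing_seq tt by move=> i j ij; rewrite lerD2l ler_wpM2l// ler_nat.
  have ttS i : tt i.+1 - tt i = (t - s) / n%:R by rewrite /tt -natr1; ring.
  pose X i := incr (tt i) (tt i.+1).
  have mX i : measurable_fun setT (X i) by exact: measurable_incr.
  have sumX w : \sum_(i < n) xi * X i w + 0 = xi * incr s t w.
    rewrite addr0 -mulr_sumr; congr (_ * _).
    rewrite -(big_mkord xpredT (fun i => X i w)) telescope_sumr// /incr; congr (W _ w - W _ w).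
      by rewrite /tt divfK ?gt_eqF// subrKC.
    by rewrite /tt mulr0 addr0.
  have hs i : mean P (fun w => sin (xi * X i w)) = 0 by apply: mean_sin_incr => //; exact: ttn.
  have hB (B : nat -> set (measurableTypeR R)) : (forall i, measurable (B i)) ->
      mean P (fun w => 1 * \prod_(i < n) ind (X i) (B i) w) =
      mean P (fun=> 1) * \prod_(i < n) mean P (ind (X i) (B i)).
    move=> mB; rewrite mean_cst mul1r; under eq_fun do rewrite mul1r; exact: indep_incr.
  have := indep_char 0 mX (bounded_rv_cst _ 1) hB (fun i => erefl) hs.
  under eq_fun do rewrite mul1r sumX; rewrite cos0 mean_cst !mul1r => ->.
  have -> : expR (- (v / 2)) = expR (- (v / 2 / n%:R)) ^+ n.
    by rewrite -expRM_natl; congr expR; field; rewrite gt_eqF.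
  have -> : 65 * v ^+ 2 * n%:R^-1 = n%:R * (65 * (v / n%:R) ^+ 2) by field; rewrite gt_eqF.
  apply: (@prod_dist (fun i => mean P (fun w => cos (xi * X i w)))).
  - move=> i; apply: mean_norm_le; first by apply: bounded_rv_cos; exact: measurable_funM.
    by move=> w; exact: cos_max.
  - by rewrite ger0_norm ?expR_ge0// -[leRHS]expR0 ler_expR oppr_le0 !divr_ge0.
  - move=> i _; have := mean_cos_incr_taylor xi (tt0 i) (ttn _ _ (leqnSn i)).
    rewrite ttS -/(X i) mulrA -/v => h1.
    have h2 : `|expR (- (v / 2 / n%:R)) - (1 - v / n%:R / 2)| <= (v / n%:R) ^+ 2.
      have x0 : 0 <= v / n%:R / 2 by rewrite !divr_ge0.
      rewrite mulrAC; apply: le_trans (expRN_taylor x0) _.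
      by rewrite ler_pXn2r ?nnegrE ?divr_ge0// ler_pdivrMr// ler_peMr ?divr_ge0// ler1n.
    rewrite (_ : _ - _ = (mean P (fun w => cos (xi * X i w)) - (1 - v / n%:R / 2)) -
       (expR (- (v / 2 / n%:R)) - (1 - v / n%:R / 2))); last by ring.
    apply: le_trans (ler_normB _ _) _; lra.
have c0 : 65 * v ^+ 2 * n.+1%:R^-1 @[n --> \oo] --> (0 : R).
  by rewrite -(mulr0 (65 * v ^+ 2)); apply: cvgM; [exact: cvg_cst|exact: cvg_harmonic].
move/cvgr0Pnorm_le : c0 => /(_ e e0)[n _ /(_ n (leqnn n))] h.
apply: le_trans (bound n.+1 isT) _; exact: le_trans (ler_norm _) h.
Qed.

(** The weight [Z] is meant for an event of another process, independent of
    [W]: it then factors out of the joint characteristic function. *)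
Lemma grid_char_incr (Z : Omega -> R) m L (a : nat -> R) (p : R) : (0 < m)%N -> bounded_rv Z ->
  (forall B : nat -> set (measurableTypeR R), (forall i, measurable (B i)) ->
    mean P (fun w => Z w * \prod_(i < L) ind (incr (i%:R / m%:R) (i.+1%:R / m%:R)) (B i) w) =
    mean P Z * mean P (fun w => \prod_(i < L) ind (incr (i%:R / m%:R) (i.+1%:R / m%:R)) (B i) w)) ->
  mean P (fun w => Z w * cos (step_integral W (grid_data m L a) w + p)) =
  mean P Z * cos p * expR (- (2^-1 * (m%:R^-1 * \sum_(j < L) a j ^+ 2))).
Proof.
move=> m0 bZ hB; have m0' : (0 : R) < m%:R by rewrite ltr0n.
pose tt i : R := i%:R / m%:R.
have tt0 i : 0 <= tt i by rewrite divr_ge0.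
have ttn : nondecreasing_seq tt by move=> i j ij; rewrite ler_wpM2r ?invr_ge0// ler_nat.
have ttS i : tt i.+1 - tt i = m%:R^-1 by rewrite /tt -mulrBl -natr1 addrAC subrr add0r mul1r.
have sE w : step_integral W (grid_data m L a) w = \sum_(i < L) a i * incr (tt i) (tt i.+1) w.
  rewrite /step_integral big_map -(big_mkord xpredT (fun i => a i * incr (tt i) (tt i.+1) w)).
  by rewrite /index_iota subn0.
under eq_fun do rewrite sE.
rewrite (@indep_char _ _ _ P (fun i => incr (tt i) (tt i.+1)) a
   (fun i => expR (- (a i ^+ 2 / m%:R / 2)))) //.
- congr (_ * _); rewrite -expR_sum; congr expR.
  by rewrite sumrN mulr_sumr mulr_sumr; congr (- _); apply: eq_bigr => i _; field; rewrite gt_eqF.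
- by move=> i; exact: measurable_incr.
- by move=> B mB; rewrite hB//; congr (_ * _); exact: indep_incr.
- by move=> i; rewrite mean_cos_incr ?ttS// ttn.
- by move=> i; rewrite mean_sin_incr// ttn.
Qed.

End brownian.

(** * The Wiener integral *)

Section gram.
Context (R : realType) (d : measure_display) (T : measurableType d).
Context (mu : {measure set T -> \bar R}) (I : Type).

Let sum_sqr (s : seq I) (c x : I -> R) (y : R) :
  \sum_(j <- s) c j * (y - x j) ^+ 2 = (\sum_(j <- s) c j) * y ^+ 2
    - 2 * y * (\sum_(j <- s) c j * x j) + \sum_(j <- s) c j * x j ^+ 2.
Proof.
by elim: s => [|j s IH]; rewrite ?big_nil ?big_cons ?IH; ring.
Qed.

Let sum_sqr2 (s : seq I) (c x : I -> R) (a b e : R) :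
  \sum_(i <- s) c i * (a * x i ^+ 2 + b * x i - e) =
  a * (\sum_(i <- s) c i * x i ^+ 2) + b * (\sum_(i <- s) c i * x i) - e * \sum_(i <- s) c i.
Proof.
by elim: s => [|j s IH]; rewrite ?big_nil ?big_cons ?IH; ring.
Qed.

Let integrable_comb (s : seq I) (c : I -> R) (F : I -> T -> R) :
  (forall i, mu.-integrable setT (EFin \o F i)) ->
  mu.-integrable setT (EFin \o (fun w => \sum_(i <- s) c i * F i w)) /\
  \int[mu]_w (\sum_(i <- s) c i * F i w) = \sum_(i <- s) c i * \int[mu]_w F i w.
Proof.
move=> iF; elim: s => [|i s [IH1 IH2]].
  rewrite big_nil; under eq_fun do rewrite big_nil; split.
    by rewrite [X in _.-integrable _ X](_ : _ = cst 0%E)//; exact: integrable0.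
  by rewrite /Rintegral integral0.
under eq_fun do rewrite big_cons.
have ic : mu.-integrable setT (EFin \o (fun w => c i * F i w)).
  exact: (@integrableZl _ _ _ mu setT measurableT _ _ (iF i)).
split; first exact: integrableD ic IH1.
by rewrite RintegralD// RintegralZl// IH2 big_cons.
Qed.

(** Polarization: families in two different L2 spaces are compared through the
    squared norms of their members and of the differences of these. *)
Lemma sqn_comb (s : seq I) (c : I -> R) (X : I -> T -> R) :
  (forall i, measurable_fun setT (X i)) -> (forall i, (sqn mu (X i) < +oo)%E) ->
  sqn mu (fun w => \sum_(i <- s) c i * X i w) =
  (\sum_(i <- s) c i * ((\sum_(j <- s) c j) * fine (sqn mu (X i))
     - \sum_(j <- s) (c j / 2) * fine (sqn mu (fun w => X i w - X j w)%R)))%:E.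
Proof.
move=> mX fX; pose S2 (f : T -> R) w := f w ^+ 2.
have i2 (f : T -> R) : measurable_fun setT f -> (sqn mu f < +oo)%E ->
    mu.-integrable setT (EFin \o S2 f).
  move=> mf ff; apply/integrableP; split; first exact: measurable_sqr.
  apply: le_lt_trans ff; rewrite le_eqVlt; apply/orP; left; apply/eqP.
  by apply: eq_integral => w _ /=; rewrite ger0_norm ?sqr_ge0.
have mB i j : measurable_fun setT (fun w => X i w - X j w) by exact: measurable_funB.
have fB i j : (sqn mu (fun w => X i w - X j w)%R < +oo)%E.
  apply: le_lt_trans (sqnD _ (mX i) (measurableT_comp (@oppr_measurable R setT) (mX j))) _.
  by rewrite sqnN; apply: lte_add_pinfty; exact: lte_mul_pinfty.
pose F i w := (\sum_(j <- s) c j) * S2 (X i) w - \sum_(j <- s) (c j / 2) * S2 (fun w => X i w - X j w) w.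
have iS i := @integrable_comb s (fun j => c j / 2) (fun j => S2 (fun w => X i w - X j w))
  (fun j => i2 _ (mB i j) (fB i j)).
have iX i : mu.-integrable setT (EFin \o (fun w => (\sum_(j <- s) c j) * S2 (X i) w)).
  exact: (@integrableZl _ _ _ mu setT measurableT _ _ (i2 _ (mX i) (fX i))).
have iF i : mu.-integrable setT (EFin \o F i).
  by have [iSi _] := iS i; exact: integrableB (iX i) iSi.
have [iC eC] := integrable_comb s c iF.
have eF i : \int[mu]_w F i w = (\sum_(j <- s) c j) * fine (sqn mu (X i))
     - \sum_(j <- s) (c j / 2) * fine (sqn mu (fun w => X i w - X j w)%R).
  have [iSi eSi] := iS i.
  by rewrite /F RintegralB// RintegralZl ?eSi//; exact: i2.
have sE w : (\sum_(i <- s) c i * X i w) ^+ 2 = \sum_(i <- s) c i * F i w.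
  have FE i : F i w = (2^-1 * \sum_(j <- s) c j) * X i w ^+ 2
      + (\sum_(j <- s) c j * X j w) * X i w - 2^-1 * \sum_(j <- s) c j * X j w ^+ 2.
    rewrite /F [X in _ - X](eq_bigr (fun j => 2^-1 * (c j * (X i w - X j w) ^+ 2))); last first.
      by move=> j _; rewrite /S2; field.
    by rewrite -mulr_sumr sum_sqr /S2; field.
  by under [RHS]eq_bigr do rewrite FE; rewrite sum_sqr2; ring.
rewrite /sqn; under eq_integral do rewrite sE.
rewrite -[LHS]fineK; last exact: (integrable_fin_num measurableT iC).
by congr EFin; rewrite -[LHS]/(\int[mu]_w _) eC; apply: eq_bigr => i _; rewrite eF.
Qed.

End gram.

Section isometry.
Context (R : realType) (d : measure_display) (Omega : measurableType d).
Context (P : probability Omega R) (W : R -> Omega -> R).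
Hypothesis brownianW : standard_brownian_motion P W.
Local Notation mu := (@lebesgue_measure R).
Local Notation allR := (setT : set (measurableTypeR R)).

(** Replacing negative times by [0] gives families indexed by the whole line. *)
Let tp (t : R) : R := Num.max t 0.
Let X t := incr W 0 (tp t).
Let Y t : R -> R := \1_(`]0, tp t] : set R).

Let tp0 t : 0 <= tp t.
Proof. by rewrite le_max lexx orbT. Qed.

Let mX t : measurable_fun setT (X t).
Proof. exact: (measurable_incr brownianW). Qed.

Let mY t : measurable_fun allR (Y t).
Proof. by apply: measurable_indic; exact: measurable_itv. Qed.

Let sqn_itv (u v : R) : u <= v ->
  sqn mu (\1_(`]u, v] : set (measurableTypeR R)) : R -> R) = (v - u)%:E.
Proof.
move=> uv; rewrite /sqn.
transitivity (\int[mu]_s (\1_(`]u, v] : set (measurableTypeR R)) s)%:E)%E.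
  by apply: eq_integral => s _; rewrite indicE; case: (_ \in _); rewrite ?expr1n ?expr0n.
rewrite integral_indic ?setIT//.
transitivity (mu `]u, v]) => //; rewrite lebesgue_measure_itv/= lte_fin.
case: ltP => [_|vu]; first by rewrite EFinB.
by congr EFin; apply/esym/eqP; rewrite subr_eq0 eq_le vu.
Qed.

Let YB (s t : R) : tp s <= tp t ->
  (fun x => Y t x - Y s x) = \1_(`]tp s, tp t] : set (measurableTypeR R)).
Proof.
move=> st; apply/funext => x; rewrite /Y !indicE !mem_setE !in_itv/=.
have [x0|x0]/= := ltP 0 x; last by rewrite subrr ltNge (le_trans x0 (tp0 s)).
have [xs|xs]/= := leP x (tp s); first by rewrite (le_trans xs st) subrr.
by rewrite subr0.
Qed.

Let XB (s t : R) : (fun w => X t w - X s w) = incr W (tp s) (tp t).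
Proof. by apply/funext => w; rewrite /X /incr opprB addrA subrK. Qed.

Let sqnXY t : sqn P (X t) = sqn mu (Y t).
Proof. by rewrite sqn_incr// [RHS](sqn_itv (tp0 t)). Qed.

Let sqnXYB s t : sqn P (fun w => X s w - X t w)%R = sqn mu (fun x => Y s x - Y t x)%R.
Proof.
have le_case s' t' : tp s' <= tp t' ->
    sqn P (fun w => X t' w - X s' w)%R = sqn mu (fun x => Y t' x - Y s' x)%R.
  by move=> st; rewrite XB YB// sqn_incr// [RHS]sqn_itv.
have [st|/ltW ts] := leP (tp s) (tp t); last exact: le_case.
by rewrite sqn_sym [RHS]sqn_sym; exact: le_case.
Qed.

Let ends (p : step_data R) : seq (R * R) :=
  [seq (q.1, q.2.2) | q <- p] ++ [seq (- q.1, q.2.1) | q <- p].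

Let tpE t : 0 <= t -> tp t = t.
Proof. by move=> t0; rewrite /tp max_l. Qed.

Let step_integralE p w : step_wf p -> step_integral W p w = \sum_(q <- ends p) q.1 * X q.2 w.
Proof.
move=> wp; rewrite /ends big_cat !big_map/= -big_split/= /step_integral !big_seq.
apply: eq_bigr => q qp; have [u0 uv] := wp q qp.
by rewrite /X /incr !tpE ?(le_trans u0 uv)//; ring.
Qed.

Let step_funE p x : step_wf p -> step_fun p x = \sum_(q <- ends p) q.1 * Y q.2 x.
Proof.
move=> wp; rewrite /ends big_cat !big_map/= -big_split/= /step_fun !big_seq.
apply: eq_bigr => q qp; have [u0 uv] := wp q qp.
rewrite mulNr -mulrBr; congr (_ * _).
have := @YB q.2.1 q.2.2; rewrite !tpE ?(le_trans u0 uv)// => /(_ uv).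
by move/(congr1 (fun f => f x)).
Qed.

Lemma measurable_step_integral p : step_wf p -> measurable_fun setT (step_integral W p).
Proof.
move=> wp; rewrite (_ : step_integral W p = fun w => \sum_(q <- ends p) q.1 * X q.2 w).
  by apply: measurable_sum => q; apply: measurable_funM => //; exact: mX.
by apply/funext => w; exact: step_integralE.
Qed.

Lemma measurable_step_fun (p : step_data R) : step_wf p -> measurable_fun allR (step_fun p).
Proof.
move=> wp; rewrite (_ : step_fun p = fun w => \sum_(q <- ends p) q.1 * Y q.2 w).
  by apply: measurable_sum => q; apply: measurable_funM => //; exact: mY.
by apply/funext => w; exact: step_funE.
Qed.

(** Ito's isometry: the increments of [W] have the squared norms of the
    indicators of the corresponding intervals, and a linear combination is
    controlled by squared norms alone. *)
Lemma step_isometry p : step_wf p -> sqn P (step_integral W p) = sqn mu (step_fun p).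
Proof.
move=> wp.
rewrite (_ : step_integral W p = fun w => \sum_(q <- ends p) q.1 * X q.2 w); last first.
  by apply/funext => w; exact: step_integralE.
rewrite (_ : step_fun p = fun w => \sum_(q <- ends p) q.1 * Y q.2 w); last first.
  by apply/funext => w; exact: step_funE.
rewrite (@sqn_comb _ _ _ P _ (ends p) (fun q => q.1) (fun q => X q.2)); last 2 first.
- by move=> q; exact: mX.
- by move=> q; rewrite (sqn_incr brownianW)// ltry.
rewrite (@sqn_comb _ _ _ mu _ (ends p) (fun q => q.1) (fun q => Y q.2)); last 2 first.
- by move=> q; exact: mY.
- by move=> q; rewrite -sqnXY (sqn_incr brownianW)// ltry.
congr EFin; apply: eq_bigr => q _; rewrite sqnXY; congr (_ * (_ - _)).
by apply: eq_bigr => q' _; rewrite sqnXYB.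
Qed.

Let opp_data (p : step_data R) : step_data R := [seq (- q.1, q.2) | q <- p].

Lemma step_isometryB (p q : step_data R) : step_wf p -> step_wf q ->
  sqn P (fun w => step_integral W p w - step_integral W q w)%R =
  sqn mu (fun s => step_fun p s - step_fun q s)%R.
Proof.
move=> wp wq; pose r := p ++ opp_data q.
have wr : step_wf r.
  move=> x; rewrite mem_cat => /orP[/wp//|/mapP[y yq ->]]; exact: (wq y yq).
transitivity (sqn P (step_integral W r)).
  congr sqn; apply/funext => w; rewrite /step_integral big_cat/= big_map/=; congr (_ + _).
  by rewrite -sumrN; apply: eq_bigr => x _; rewrite mulNr.
rewrite step_isometry//; congr sqn; apply/funext => s.
rewrite /step_fun big_cat/= big_map/=; congr (_ + _).
by rewrite -sumrN; apply: eq_bigr => x _; rewrite mulNr.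
Qed.

Lemma step_fun_lt0 (p : step_data R) s : step_wf p -> s < 0 -> step_fun p s = 0.
Proof.
move=> wp s0; rewrite /step_fun big_seq big1// => q qp; have [u0 _] := wp q qp.
rewrite indicE memNset ?mulr0//= in_itv/= => /andP[us _].
by move: (lt_trans us s0); rewrite ltNge u0.
Qed.

Let restrictE (h : R -> R) (p : step_data R) : step_wf p ->
  (step_fun p \- h) \_ `[0, +oo[ = fun s => step_fun p s - (h \_ `[0, +oo[) s.
Proof.
move=> wp; apply/funext => s; rewrite !patchE; case: ifPn => // sN.
by rewrite step_fun_lt0 ?subr0// ltNge; move: sN; rewrite mem_setE in_itv/= andbT.
Qed.

(** The isometry turns grid functions that converge to [h] into a Cauchy
    sequence of step integrals. *)
Lemma wiener_integral_spec (h : R -> R) : L2_halfline h ->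
  is_wiener_integral P W h (wiener_integral P W h).
Proof.
move=> hh; suff [X0 hX] : exists Z, is_wiener_integral P W h Z.
  exact: (@xgetPex _ (cst 0) [set Z | is_wiener_integral P W h Z] (ex_intro _ X0 hX)).
have /Lfun2P[mh sh] := hh.
have e0 (i : nat) : 0 < (i.+1%:R^-1 : R) by rewrite invr_gt0.
have /choice[ka hka] : forall i : nat, exists ka : nat * (nat -> R),
    (sqn mu (fun s => h \_ `[0%R, +oo[ s - grid_fun ka.1 (ka.1 * ka.1) ka.2 s)%R <= (i.+1%:R^-1)%:E)%E.
  move=> i; have [k0 hk] := grid_fun_dense hh (e0 i).
  have [m0 [a ha]] := hk k0 (leqnn _).
  exists (k0, a) => /=; apply: le_trans ha; rewrite le_eqVlt; apply/orP; left; apply/eqP.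
  congr sqn; apply/funext => s; rewrite !patchE; case: ifPn => // sN.
  by rewrite /grid_fun step_fun_lt0 ?subr0//; [exact: grid_data_wf|rewrite ltNge; move: sN; rewrite mem_setE in_itv/= andbT].
pose p i : step_data R := grid_data (ka i).1 ((ka i).1 * (ka i).1) (ka i).2.
have wp i : step_wf (p i) by exact: grid_data_wf.
have mp i : measurable_fun allR (step_fun (p i)) by exact: measurable_step_fun.
have hp (c : R) : 0 < c -> exists K, forall i, (K <= i)%N ->
    (sqn mu (fun s => h \_ `[0%R, +oo[ s - step_fun (p i) s)%R <= c%:E)%E.
  move=> c0; have /cvgr0Pnorm_le/(_ c c0)[K _ hK] := @cvg_harmonic R.
  exists K => i Ki; apply: le_trans (hka i) _; rewrite lee_fin.
  exact: le_trans (ler_norm _) (hK i Ki).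
have [||c c0|Z hZ cZ] := @L2_complete _ _ _ P (fun i => step_integral W (p i)).
- by move=> i; exact: measurable_step_integral.
- move=> i; rewrite step_isometry//.
  rewrite (_ : step_fun (p i) = fun s => - (h \_ `[0%R, +oo[ s - step_fun (p i) s) + h \_ `[0%R, +oo[ s); last first.
    by apply/funext => s; ring.
  apply: le_lt_trans (sqnD _ _ mh) _.
    by apply: measurableT_comp => //; exact: measurable_funB.
  rewrite sqnN; apply: lte_add_pinfty; apply: lte_mul_pinfty => //.
  exact: le_lt_trans (hka i) (ltry _).
- have [K hK] := hp (c / 4) ltac:(by rewrite divr_gt0).
  exists K => k l Kk Kl; rewrite step_isometryB//.
  have -> : c = 2 * (c / 4) + 2 * (c / 4) by field.
  apply: (sqn_trans (mp k) mh (mp l)); last exact: hK.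
  by rewrite sqn_sym; exact: hK.
exists Z, p; split => //.
  apply/(Lnorm2_cvg0P mu) => c c0; have [K hK] := hp c c0.
  exists K => // i /= Ki; rewrite restrictE// sqn_sym; exact: hK.
split => //; apply/(Lnorm2_cvg0P P) => c c0; have [K hK] := cZ c c0.
by exists K.
Qed.

Lemma wiener_integral_approx (h : R -> R) m L a (c : R) : L2_halfline h -> (0 < m)%N -> 0 < c ->
  (sqn mu ((h \- grid_fun m L a)%R \_ `[0%R, +oo[) <= c%:E)%E ->
  measurable_fun setT (wiener_integral P W h) /\
  (sqn P (fun w => wiener_integral P W h w - step_integral W (grid_data m L a) w)%R <= (10 * c)%:E)%E.
Proof.
move=> hh m0 c0 hc; have [p [wp /(Lnorm2_cvg0P mu) cp [/Lfun2P[mZ _] /(Lnorm2_cvg0P P) cZ]]] := wiener_integral_spec hh.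
split => //; have /Lfun2P[mh _] := hh.
have wg : step_wf (grid_data m L a) by exact: grid_data_wf.
have [K1 _ h1] := cp c c0; have [K2 _ h2] := cZ c c0.
pose i := maxn K1 K2.
have {}h1 := h1 i (leq_maxl _ _); have {}h2 := h2 i (leq_maxr _ _).
rewrite /= restrictE// in h1.
have -> : 10 * c = 2 * c + 2 * (2 * c + 2 * c) by ring.
apply: (@sqn_trans _ _ _ P (step_integral W (p i))).
- exact: mZ.
- exact: measurable_step_integral.
- exact: measurable_step_integral.
- by rewrite sqn_sym.
- rewrite step_isometryB//; apply: (sqn_trans _ mh _ h1).
  + exact: measurable_step_fun.
  + exact: measurable_step_fun.
  + apply: le_trans hc; rewrite le_eqVlt; apply/orP; left; apply/eqP.
    congr sqn; apply/funext => s; rewrite !patchE; case: ifPn => // sN.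
    by rewrite /grid_fun step_fun_lt0 ?subr0// ltNge; move: sN; rewrite mem_setE in_itv/= andbT.
Qed.

End isometry.

Section pair.
Context (R : realType) (d : measure_display) (Omega : measurableType d).
Context (P : probability Omega R) (W W' : R -> Omega -> R).
Hypothesis brownianW : standard_brownian_motion P W.
Hypothesis brownianW' : standard_brownian_motion P W'.
Hypothesis indepWW' : independent_processes P W W'.
Local Notation allR := (setT : set (measurableTypeR R)).

Let gen (V : R -> Omega -> R) : set (set Omega) :=
  \bigcup_(s in [set s : R | 0 <= s])
    preimage_set_system setT (V s) (measurable : set (set (measurableTypeR R))).

Let measurable_gen (V : R -> Omega -> R) s : 0 <= s ->
  measurable_fun setT (V s : g_sigma_algebraType (gen V) -> measurableTypeR R).
Proof.
by move=> s0 _ B mB; apply: sub_sigma_algebra; exists s => //; exists B.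
Qed.

Let sigma_incr (V : R -> Omega -> R) s t : 0 <= s -> 0 <= t ->
  measurable_fun setT (incr V s t : g_sigma_algebraType (gen V) -> measurableTypeR R).
Proof. by move=> s0 t0; apply: measurable_funB; exact: measurable_gen. Qed.

Let sigma_step (V : R -> Omega -> R) m L a (B : set (measurableTypeR R)) : measurable B ->
  sigma_process V (step_integral V (grid_data m L a) @^-1` B).
Proof.
move=> mB; have mS : measurable_fun setT
    (step_integral V (grid_data m L a) : g_sigma_algebraType (gen V) -> measurableTypeR R).
  rewrite (_ : step_integral V (grid_data m L a) =
     fun w => \sum_(j <- iota 0 L) a j * incr V (j%:R / m%:R) (j.+1%:R / m%:R) w).
    apply: measurable_sum => j; apply: measurable_funM => //.
    by apply: sigma_incr; rewrite divr_ge0.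
  by apply/funext => w; rewrite /step_integral big_map.
by have := mS measurableT B mB; rewrite setTI.
Qed.

(** The events of [W'] serve as the weights of [grid_char_incr] for [W]; summing
    over them decouples the two cosines. *)
Lemma step_integral_char m L a b (p : R) : (0 < m)%N ->
  mean P (fun w => cos (step_integral W (grid_data m L a) w + step_integral W' (grid_data m L b) w + p)) =
  expR (- (2^-1 * (m%:R^-1 * \sum_(j < L) (a j ^+ 2 + b j ^+ 2)))) * cos p.
Proof.
move=> m0; have tt0 i : 0 <= i%:R / m%:R :> R by rewrite divr_ge0.
pose S := step_integral W (grid_data m L a); pose S' := step_integral W' (grid_data m L b).
have mS : measurable_fun setT S.
  by apply: (measurable_step_integral brownianW); exact: grid_data_wf.
have mS' : measurable_fun setT S'.
  by apply: (measurable_step_integral brownianW'); exact: grid_data_wf.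
pose Phi (c : nat -> R) := expR (- (2^-1 * (m%:R^-1 * \sum_(j < L) c j ^+ 2))).
have bcS q : bounded_rv (fun w => cos (S w + q)).
  by apply: bounded_rv_cos; exact: measurable_funD.
have key q (B : set (measurableTypeR R)) : measurable B ->
    mean P (fun w => ind S' B w * cos (S w + q)) = mean P (ind S' B) * (cos q * Phi a).
  move=> mB; rewrite mulrA; apply: (grid_char_incr brownianW) => //.
    exact: bounded_ind.
  move=> C mC.
  have pE := prod_ind L (fun i => incr W (i%:R / m%:R) (i.+1%:R / m%:R)) C.
  rewrite [X in _ = _ * mean P X]pE; move: pE; set E := \bigcap_(i in _) _ => pE.
  have mSB : measurable (S' @^-1` B).
    have mS1 : measurable_fun setT (S' : Omega -> measurableTypeR R) := mS'.
    by rewrite -[X in measurable X]setTI; exact: mS1.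
  have mE : measurable E.
    apply: fin_bigcap_measurable => // i _.
    have mi : measurable_fun setT (incr W (i%:R / m%:R) (i.+1%:R / m%:R) : Omega -> measurableTypeR R).
      exact: (measurable_incr brownianW).
    by rewrite -[X in measurable X]setTI; exact: mi.
  have sE : sigma_process W E.
    apply: (@fin_bigcap_measurable _ (g_sigma_algebraType (gen W))) => // i _.
    by have := @sigma_incr W _ _ (tt0 i) (tt0 i.+1) measurableT (C i) (mC i); rewrite setTI.
  have iE : ind S' B = \1_(S' @^-1` B) by [].
  rewrite iE !mean_indic//.
  have -> : (fun w => \1_(S' @^-1` B) w * \prod_(i < L) ind (incr W (i%:R / m%:R) (i.+1%:R / m%:R)) (C i) w) = \1_(E `&` S' @^-1` B) :> (Omega -> R).
    by apply/funext => w; rewrite (congr1 (fun f => f w) pE) setIC indicI.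
  rewrite mean_indic; last exact: measurableI.
  have sS : sigma_process W' (S' @^-1` B) by exact: sigma_step.
  rewrite (indepWW' sE sS) fineM ?fin_num_measure// mulrC//.
have one_hB V : standard_brownian_motion P V -> forall q c,
    mean P (fun w => cos (step_integral V (grid_data m L c) w + q)) = cos q * Phi c.
  move=> brV q c; rewrite -[cos q]mul1r -{1}(mean_cst P 1) -(grid_char_incr brV c q m0 (bounded_rv_cst _ 1)).
    by congr mean; apply/funext => w; rewrite mul1r.
  by move=> C mC; rewrite mean_cst mul1r; under eq_fun do rewrite mul1r.
have fcos := mean_factor mS' (bcS p) (key p) (@measurable_cos R) (@cos_max R).
have fsin := mean_factor mS' (bcS (p - pi / 2)) (key (p - pi / 2)) (@measurable_sin R) (@sin_max R).
have cE w : cos (S w + S' w + p) = cos (S' w) * cos (S w + p) - sin (S' w) * cos (S w + (p - pi / 2)).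
  by rewrite [S w + S' w]addrC -addrA [in LHS]cosD [S w + (p - _)]addrA cosBpihalf.
under eq_fun do rewrite -/(S _) -/(S' _) cE.
rewrite meanB; last 2 first.
- by apply: bounded_rvM => //; exact: bounded_rv_cos.
- by apply: bounded_rvM => //; exact: bounded_rv_sin.
rewrite fcos fsin.
have -> : mean P (fun w => cos (S' w)) = Phi b.
  by have := one_hB _ brownianW' 0 b; under eq_fun do rewrite addr0; rewrite cos0 mul1r.
have -> : mean P (fun w => sin (S' w)) = 0.
  have := one_hB _ brownianW' (- (pi / 2)) b; under eq_fun do rewrite cosBpihalf.
  by rewrite cosN cos_pihalf mul0r.
rewrite mul0r subr0 mulrCA mulrC; congr (_ * _).
rewrite /Phi -expRD; congr expR; rewrite big_split/=; ring.
Qed.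

End pair.

(** * Polynomial approximation in trigonometric coordinates *)

Section bernstein.
Context (R : realType).
Implicit Types (u : R) (g : nat -> R).

(** The mean of [g] at a binomial variable of parameters [n] and [u], that is
    the value at [u] of a Bernstein polynomial. *)
Fixpoint bernstein u n g : R :=
  if n is n'.+1 then u * bernstein u n' (fun k => g k.+1) + (1 - u) * bernstein u n' g
  else g 0%N.

Lemma bernstein_lin u n (a b : R) g g' :
  bernstein u n (fun k => a * g k + b * g' k) = a * bernstein u n g + b * bernstein u n g'.
Proof. by elim: n g g' => [//|n IH] g g' /=; rewrite !IH; ring. Qed.

Lemma bernsteinB u n g g' :
  bernstein u n (fun k => g k - g' k) = bernstein u n g - bernstein u n g'.
Proof. by elim: n g g' => [//|n IH] g g' /=; rewrite !IH; ring. Qed.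

Lemma bernstein_cst u n (c : R) : bernstein u n (fun=> c) = c.
Proof. by elim: n => [//|n IH] /=; rewrite IH; ring. Qed.

Lemma bernstein_le u n g g' : 0 <= u <= 1 -> (forall k, (k <= n)%N -> g k <= g' k) ->
  bernstein u n g <= bernstein u n g'.
Proof.
move=> /andP[u0 u1]; elim: n g g' => [|n IH] g g' gg /=; first exact: gg.
apply: lerD; apply: ler_wpM2l; rewrite ?subr_ge0//; apply: IH => k kn; apply: gg => //.
exact: leqW.
Qed.

Lemma bernstein_norm u n g (M : R) : 0 <= u <= 1 -> (forall k, `|g k| <= M) ->
  `|bernstein u n g| <= M.
Proof.
move=> u01 gM; rewrite ler_norml -(bernstein_cst u n (- M)) -{2}(bernstein_cst u n M).
by rewrite !bernstein_le// => k _; have := gM k; rewrite ler_norml => /andP[].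
Qed.

Lemma bernstein_variance u n (c : R) :
  bernstein u n (fun k => (k%:R - c) ^+ 2) = n%:R * (u * (1 - u)) + (n%:R * u - c) ^+ 2.
Proof.
elim: n c => [|n IH] c /=; first by ring.
have -> : (fun k => (k.+1%:R - c) ^+ 2) = (fun k => (k%:R - (c - 1)) ^+ 2) :> (nat -> R).
  by apply/funext => k; rewrite -natr1; congr (_ ^+ 2); ring.
by rewrite !IH -natr1; ring.
Qed.

(** Bernstein's bound: the binomial variable concentrates around [n * u]. *)
Lemma bernstein_approx u n g (A eta M delta : R) : 0 <= u <= 1 -> (0 < n)%N -> 0 < delta -> 0 <= eta ->
  (forall k, (k <= n)%N -> `|g k - A| <= 2 * M) ->
  (forall k, (k <= n)%N -> `|k%:R / n%:R - u| <= delta -> `|g k - A| <= eta) ->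
  `|bernstein u n g - A| <= eta + 2 * M / (delta ^+ 2 * n%:R).
Proof.
move=> u01 n0 d0 e0 gM geta.
have n0' : (0 : R) < n%:R by rewrite ltr0n.
have M0 : 0 <= 2 * M by apply: le_trans (gM 0%N _) => //; rewrite normr_ge0.
pose c := 2 * M / (delta ^+ 2 * n%:R ^+ 2).
have c0 : 0 <= c by rewrite divr_ge0// mulr_ge0// ?sqr_ge0.
have gk k : (k <= n)%N -> `|g k - A| <= eta + c * (k%:R - n%:R * u) ^+ 2.
  move=> kn; have [h|h] := leP `|k%:R / n%:R - u| delta.
    by apply: le_trans (geta k kn h) _; rewrite lerDl mulr_ge0// sqr_ge0.
  apply: le_trans (gM k kn) _; rewrite -[leLHS]add0r; apply: lerD => //.
  have -> : k%:R - n%:R * u = n%:R * (k%:R / n%:R - u) by field; rewrite gt_eqF.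
  rewrite exprMn -(real_normK (num_real (_ / _ - u))).
  have -> : c * (n%:R ^+ 2 * `|k%:R / n%:R - u| ^+ 2) = 2 * M * (`|k%:R / n%:R - u| ^+ 2 / delta ^+ 2).
    by rewrite /c; field; rewrite !gt_eqF.
  rewrite ler_peMr// ler_pdivlMr ?exprn_gt0// mul1r ler_pXn2r ?nnegrE// ltW//.
have B : `|bernstein u n g - A| <= bernstein u n (fun k => eta * 1 + c * (k%:R - n%:R * u) ^+ 2).
  rewrite -[in leLHS](bernstein_cst u n A).
  rewrite -bernsteinB.
  rewrite ler_norml; apply/andP; split.
    rewrite -mulN1r -[X in X <= _](addr0) -(mul0r (bernstein u n (fun=> 0))) -bernstein_lin.
    apply: bernstein_le => // k kn; rewrite mul0r addr0 mulN1r mulr1.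
    by have := gk k kn; rewrite ler_norml => /andP[].
  apply: bernstein_le => // k kn; rewrite mulr1.
  by have := gk k kn; rewrite ler_norml => /andP[].
apply: le_trans B _; rewrite bernstein_lin bernstein_cst bernstein_variance subrr expr0n addr0 mulr1.
rewrite lerD2l.
have -> : c * (n%:R * (u * (1 - u))) = 2 * M / (delta ^+ 2 * n%:R) * (u * (1 - u)).
  by rewrite /c; field; rewrite !gt_eqF.
have /andP[u0 u1] := u01.
have m0 : 0 <= 2 * M / (delta ^+ 2 * n%:R) by rewrite divr_ge0// mulr_ge0// sqr_ge0.
by rewrite ler_piMr// mulr_ile1// ?subr_ge0// lerBlDr lerDl.
Qed.

(** A right inverse of [y |-> (1 + sin y) / 2] on [[-1, 1]], where the sine has
    slope at least [1 / 2], extended by the end points. *)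
Lemma sin_inverse (t : R) : exists y, `|y| <= 1 /\
  forall x, `|x| <= 1 -> `|y - x| <= 4 * `|t - (1 + sin x) / 2|.
Proof.
have cos_ge (x : R) : `|x| <= 1 -> 2^-1 <= cos x.
  move=> x1; have := norm_subr1_cos x; have : x ^+ 2 <= 1.
    by rewrite -(real_normK (num_real x)) expr_le1.
  by rewrite ler_norml => h /andP[h2 _]; lra.
have sin_gap (x y : R) : `|x| <= 1 -> `|y| <= 1 -> x <= y -> y - x <= 2 * (sin y - sin x).
  move=> x1 y1; rewrite le_eqVlt => /predU1P[->|xy]; first by rewrite !subrr mulr0.
  have [|c + ->] := @MVT_segment R sin cos x y (ltW xy).
    by apply: continuous_subspaceT; exact: continuous_sin.
  rewrite in_itv/= => /andP[xc cy]; have c1 : 2^-1 <= cos c.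
    apply: cos_ge; rewrite ler_norml; move: x1 y1; rewrite !ler_norml => /andP[x1 _] /andP[_ y1].
    by rewrite (le_trans x1 xc) (le_trans cy y1).
  have : 0 <= y - x by rewrite subr_ge0 ltW.
  nra.
have sin_dist (x y : R) : `|x| <= 1 -> `|y| <= 1 -> `|y - x| <= 2 * `|sin y - sin x|.
  move=> x1 y1; have [xy|/ltW yx] := leP x y.
    have := sin_gap _ _ x1 y1 xy; rewrite (ger0_norm (_ : 0 <= y - x)) ?subr_ge0// => h.
    by apply: le_trans h _; rewrite ler_wpM2l// ler_norm.
  rewrite distrC [X in 2 * X]distrC.
  have := sin_gap _ _ y1 x1 yx; rewrite (ger0_norm (_ : 0 <= x - y)) ?subr_ge0// => h.
  by apply: le_trans h _; rewrite ler_wpM2l// ler_norm.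
have one1 : `|1 : R| <= 1 by rewrite normr1.
have onem : `|-1 : R| <= 1 by rewrite normrN normr1.
have fourE (x : R) : 4 * `|t - (1 + sin x) / 2| = 2 * `|2 * t - 1 - sin x|.
  rewrite (_ : 2 * t - 1 - sin x = 2 * (t - (1 + sin x) / 2)); last by field.
  by rewrite normrM ger0_norm// mulrA; congr (_ * _); ring.
have lt1 (x : R) : `|x| <= 1 -> x <= 1 by rewrite ler_norml => /andP[].
have gt1 (x : R) : `|x| <= 1 -> -1 <= x by rewrite ler_norml => /andP[].
have [h1|h1] := leP (sin 1) (2 * t - 1).
  exists 1; split => // x x1; rewrite fourE.
  have := sin_gap x 1 x1 one1 (lt1 _ x1); have := lt1 _ x1 => x1' h.
  rewrite ger0_norm ?subr_ge0//; apply: le_trans h _; rewrite ler_wpM2l//.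
  by apply: le_trans (ler_norm _); rewrite lerD2r.
have [h2|h2] := leP (2 * t - 1) (sin (-1)).
  exists (-1); split => // x x1; rewrite fourE.
  have := sin_gap (-1) x onem x1 (gt1 _ x1); have := gt1 _ x1 => x1' h.
  rewrite distrC ger0_norm ?subr_ge0//; apply: le_trans h _; rewrite ler_wpM2l//.
  by rewrite distrC; apply: le_trans (ler_norm _); rewrite lerD2l lerN2.
have [y] := @IVT R sin (-1) 1 (2 * t - 1) ltac:(lra)
  ltac:(by apply: continuous_subspaceT; exact: continuous_sin)
  ltac:(by rewrite ge_min le_max (ltW h1) (ltW h2) orbT).
rewrite in_itv/= => /andP[y1 y2] sy; have ny : `|y| <= 1 by rewrite ler_norml y1.
by exists y; split => // x x1; rewrite fourE -sy; exact: sin_dist.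
Qed.

End bernstein.

Section smoothing.
Context (R : realType) (I : finType).
Implicit Types (z x : I -> R) (F : (I -> R) -> R).
Variables (L M : R) (n : nat).
Hypothesis L0 : 0 < L.
Hypothesis n0 : (0 < n)%N.

Definition upd z (i : I) (v : R) : I -> R := fun j => if j == i then v else z j.

Definition cube z : Prop := forall i, `|z i| <= L.

(** Polynomials in these coordinates are trigonometric polynomials. *)
Definition angle x i : R := (1 + sin (L^-1 * x i)) / 2.

(** The grid point [k / n] of the coordinate [angle], read in the original
    coordinate. *)
Definition node (k : nat) : R := L * projT1 (cid (sin_inverse (k%:R / n%:R : R))).

Fixpoint smooth (s : seq I) F z x : R :=
  if s is i :: s' then bernstein (angle x i) n (fun k => smooth s' F (upd z i (node k)) x)
  else F z.

Let angle01 x i : 0 <= angle x i <= 1.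
Proof.
have := sin_max (L^-1 * x i); rewrite ler_norml /angle => /andP[h1 h2].
by apply/andP; split; lra.
Qed.

Lemma smooth_norm s F z x : (forall z, `|F z| <= M) -> `|smooth s F z x| <= M.
Proof.
move=> FM; elim: s z => [|i s IH] z /=; first exact: FM.
by apply: bernstein_norm => // k; exact: IH.
Qed.

Let node_le k : `|node k| <= L.
Proof.
rewrite /node; case: cid => y [y1 _] /=.
by rewrite normrM gtr0_norm// ler_piMr// ltW.
Qed.

Let node_dist k x i : cube x -> `|node k - x i| <= 4 * L * `|k%:R / n%:R - angle x i|.
Proof.
move=> cx; rewrite /node; case: cid => y [y1 hy] /=.
have x1 : `|L^-1 * x i| <= 1.
  by rewrite normrM ger0_norm ?invr_ge0 ?(ltW L0)// mulrC ler_pdivrMr// mul1r.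
have -> : L * y - x i = L * (y - L^-1 * x i) by rewrite mulrBr mulrA mulfV ?gt_eqF// mul1r.
rewrite normrM gtr0_norm// [4 * L]mulrC -mulrA ler_pM2l//; exact: hy.
Qed.

Let cube_upd z i v : cube z -> `|v| <= L -> cube (upd z i v).
Proof. by move=> cz vL j; rewrite /upd; case: eqP. Qed.

Let merge (s : seq I) z x : I -> R := fun j => if j \in s then x j else z j.

Let smooth_approx_seq s F z x (eta delta : R) : 0 < delta -> 0 <= eta ->
  (forall z, `|F z| <= M) ->
  (forall z z', cube z -> cube z' -> (forall i, `|z i - z' i| <= 4 * L * delta) -> `|F z - F z'| <= eta) ->
  cube z -> cube x ->
  `|smooth s F z x - F (merge s z x)| <= (size s)%:R * (eta + 2 * M / (delta ^+ 2 * n%:R)).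
Proof.
move=> d0 e0 FM hF + cx; elim: s z => [|i s IH] z cz.
  by rewrite /= mul0r (_ : merge [::] z x = z) ?subrr ?normr0//; apply/funext.
set eta' := eta + _ in IH *; rewrite [smooth _ _ _ _]/=.
have cm k : cube (merge s (upd z i (node k)) x).
  by move=> j; rewrite /merge; case: ifP => // _; exact: cube_upd.
have cm' : cube (merge (i :: s) z x) by move=> j; rewrite /merge; case: ifP.
have h1 : `|bernstein (angle x i) n (fun k => smooth s F (upd z i (node k)) x)
    - bernstein (angle x i) n (fun k => F (merge s (upd z i (node k)) x))| <= (size s)%:R * eta'.
  set g := (fun k => smooth _ _ _ _); set g' := (fun k => F _).
  rewrite -bernsteinB.
  by apply: bernstein_norm => // k; apply: IH; exact: cube_upd.
have h2 : `|bernstein (angle x i) n (fun k => F (merge s (upd z i (node k)) x))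
    - F (merge (i :: s) z x)| <= eta'.
  apply: bernstein_approx => //.
    move=> k _; apply: le_trans (ler_normB _ _) _.
    by have := FM (merge s (upd z i (node k)) x); have := FM (merge (i :: s) z x); lra.
  move=> k _ hk; apply: hF => // j; rewrite /merge /upd inE.
  case: (j \in s); rewrite ?orbT ?orbF ?subrr ?normr0.
    by rewrite !mulr_ge0// ltW.
  case: eqP => [->|_]; last by rewrite subrr normr0 !mulr_ge0// ltW.
  by apply: le_trans (node_dist k i cx) _; rewrite ler_wpM2l// mulr_ge0// ltW.
rewrite -[X in `|X - _|](subrK (bernstein (angle x i) n (fun k => F (merge s (upd z i (node k)) x)))).
rewrite -addrA; apply: le_trans (ler_normD _ _) _.
by rewrite /= -natr1 mulrDl mul1r; apply: lerD.
Qed.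

Lemma smooth_approx F x (eta delta : R) : 0 < delta -> 0 <= eta ->
  (forall z, `|F z| <= M) ->
  (forall z z', cube z -> cube z' -> (forall i, `|z i - z' i| <= 4 * L * delta) -> `|F z - F z'| <= eta) ->
  cube x ->
  `|smooth (enum I) F (fun=> 0) x - F x| <= #|I|%:R * (eta + 2 * M / (delta ^+ 2 * n%:R)).
Proof.
move=> d0 e0 FM hF cx; have := @smooth_approx_seq (enum I) F (fun=> 0) x eta delta d0 e0 FM hF.
rewrite (_ : merge (enum I) (fun=> 0) x = x); last first.
  by apply/funext => j; rewrite /merge mem_enum.
by rewrite -cardE; apply => // i; rewrite normr0 ltW.
Qed.

End smoothing.

(** * From characteristic functions to convergence in law *)

(** A compact set has the same modulus of continuity throughout; the second
    point may leave the set. *)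
Lemma heine (R : realType) (U : pseudoMetricType R) (K : set U) (f : U -> R) :
  compact K -> continuous f -> forall eta : R, 0 < eta ->
  exists2 delta : R, 0 < delta & forall x y, K x -> ball x delta y -> `|f x - f y| <= eta.
Proof.
move=> /compact_near_coveringP cK cf eta eta0.
have := cK R (0 : R)^'+ (fun delta x => forall y, ball x delta y -> `|f x - f y| <= eta) _.
case=> [x Kx|e /= e0 he].
  have eta2 : 0 < eta / 2 by rewrite divr_gt0.
  have /cvgrPdist_le/(_ _ eta2) := cf x.
  rewrite -filter_from_ballE => -[r r0 hr].
  have r2 : 0 < r / 2 by rewrite divr_gt0.
  exists (ball x (r / 2), [set d | 0 < d < r / 2]).
    split => /=; first exact: nbhsx_ballx.
    exists (r / 2) => // d /=; rewrite sub0r normrN => dr d0.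
    by rewrite d0/= (le_lt_trans (ler_norm _) dr).
  move=> [x' dl] /= [xx' /andP[d0 dr]] y x'y.
  have hx' : `|f x - f x'| <= eta / 2 by apply: hr; apply: le_ball xx'; lra.
  have hy : `|f x - f y| <= eta / 2.
    apply: hr; rewrite (splitr r); apply: ball_triangle xx' _; apply: le_ball x'y; exact: ltW.
  rewrite (_ : _ - _ = (f x - f y) - (f x - f x')); last by ring.
  apply: le_trans (ler_normB _ _) _; lra.
exists (e / 2); first by rewrite divr_gt0.
move=> x y Kx xy; apply: (he (e / 2)) xy => //; last by rewrite divr_gt0.
by rewrite /= sub0r normrN gtr0_norm ?divr_gt0// ltr_pdivrMr// ltr_pMr// ltr1n.
Qed.

Section levy.
Context (R : realType) (d d' : measure_display) (Omega : measurableType d) (Omega' : measurableType d').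
Context (P : probability Omega R) (P' : probability Omega' R).
Context (I : finType) (T : Type) (Fl : set_system T) {FF : ProperFilter Fl}.
Variables (Z : T -> I -> Omega -> R) (Y : I -> Omega' -> R).
Hypothesis mZ : forall e i, measurable_fun setT (Z e i).
Hypothesis mY : forall i, measurable_fun setT (Y i).
Hypothesis char_cvg : forall (xi : I -> R) (p : R),
  mean P (fun w => cos (\sum_i xi i * Z e i w + p)) @[e --> Fl] -->
  mean P' (fun w => cos (\sum_i xi i * Y i w + p)).

Let Ze e w := fun i => Z e i w.
Let Yv w := fun i => Y i w.
Let lin (xi z : I -> R) : R := \sum_i xi i * z i.

(** The test functions that remain good after multiplication by any
    [cos (lin xi z + p)]; the shift [p] covers the sine. *)
Let good (g : (I -> R) -> R) : Prop :=
  [/\ forall e, bounded_rv (fun w => g (Ze e w)), bounded_rv (fun w => g (Yv w)) &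
  forall xi p, mean P (fun w => g (Ze e w) * cos (lin xi (Ze e w) + p)) @[e --> Fl] -->
    mean P' (fun w => g (Yv w) * cos (lin xi (Yv w) + p))].

Let bounded_cosZ xi p e : bounded_rv (fun w => cos (lin xi (Ze e w) + p)).
Proof.
apply: bounded_rv_cos; apply: measurable_funD => //.
by apply: measurable_sum => i; apply: measurable_funM => //; exact: mZ.
Qed.

Let bounded_cosY xi p : bounded_rv (fun w => cos (lin xi (Yv w) + p)).
Proof.
apply: bounded_rv_cos; apply: measurable_funD => //.
by apply: measurable_sum => i; apply: measurable_funM => //; exact: mY.
Qed.

Let good_cst (c : R) : good (fun=> c).
Proof.
split => [e||xi p]; [exact: bounded_rv_cst|exact: bounded_rv_cst|].
rewrite meanZ; last exact: bounded_cosY.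
rewrite [X in X @ _](_ : _ = fun e => c * mean P (fun w => cos (lin xi (Ze e w) + p))); last first.
  by apply/funext => e; rewrite meanZ//; exact: bounded_cosZ.
by apply: cvgM; [exact: cvg_cst|exact: char_cvg].
Qed.

Let good_lin (a b : R) g g' : good g -> good g' -> good (fun z => a * g z + b * g' z).
Proof.
move=> [gZ gY cg] [gZ' gY' cg']; split => [e||xi p].
- by apply: bounded_rvD; exact: bounded_rvZ.
- by apply: bounded_rvD; exact: bounded_rvZ.
have mE (d0 : measure_display) (O : measurableType d0) (Q : probability O R) (h h' c : O -> R) :
    bounded_rv h -> bounded_rv h' -> bounded_rv c ->
    mean Q (fun w => (a * h w + b * h' w) * c w) =
    a * mean Q (fun w => h w * c w) + b * mean Q (fun w => h' w * c w).
  move=> bh bh' bc; rewrite -!meanZ; [|exact: bounded_rvM|exact: bounded_rvM].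
  rewrite -meanD; [|by apply: bounded_rvZ; exact: bounded_rvM|by apply: bounded_rvZ; exact: bounded_rvM].
  by congr mean; apply/funext => w; ring.
rewrite mE; [|exact: gY|exact: gY'|exact: bounded_cosY].
rewrite [X in X @ _](_ : _ = fun e => a * mean P (fun w => g (Ze e w) * cos (lin xi (Ze e w) + p))
    + b * mean P (fun w => g' (Ze e w) * cos (lin xi (Ze e w) + p))); last first.
  by apply/funext => e; rewrite mE; [|exact: gZ|exact: gZ'|exact: bounded_cosZ].
by apply: cvgD; apply: cvgM; [exact: cvg_cst|exact: cg|exact: cvg_cst|exact: cg'].
Qed.

Let good_cos k q g : good g -> good (fun z => g z * cos (lin k z + q)).
Proof.
move=> [gZ gY cg]; split => [e||xi p].
- by apply: bounded_rvM => //; exact: bounded_cosZ.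
- by apply: bounded_rvM => //; exact: bounded_cosY.
have linD a b z : lin (fun i => a i + b i) z = lin a z + lin b z.
  by rewrite /lin -big_split/=; apply: eq_bigr => i _; rewrite mulrDl.
have linB a b z : lin (fun i => a i - b i) z = lin a z - lin b z.
  by rewrite /lin -sumrB; apply: eq_bigr => i _; rewrite mulrBl.
have mE (d0 : measure_display) (O : measurableType d0) (Q : probability O R) (h : O -> R) (z : O -> I -> R) :
    bounded_rv h -> (forall xi p, bounded_rv (fun w => cos (lin xi (z w) + p))) ->
    mean Q (fun w => h w * cos (lin k (z w) + q) * cos (lin xi (z w) + p)) =
    2^-1 * mean Q (fun w => h w * cos (lin (fun i => k i + xi i) (z w) + (q + p))) +
    2^-1 * mean Q (fun w => h w * cos (lin (fun i => k i - xi i) (z w) + (q - p))).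
  move=> bh bc; rewrite -!meanZ; [|exact: bounded_rvM|exact: bounded_rvM].
  rewrite -meanD; [|by apply: bounded_rvZ; exact: bounded_rvM|by apply: bounded_rvZ; exact: bounded_rvM].
  congr mean; apply/funext => w; rewrite linD linB.
  rewrite (_ : lin k (z w) + lin xi (z w) + (q + p) = (lin k (z w) + q) + (lin xi (z w) + p)); last by ring.
  rewrite (_ : lin k (z w) - lin xi (z w) + (q - p) = (lin k (z w) + q) - (lin xi (z w) + p)); last by ring.
  by set A := _ + q; set C := _ + p; rewrite cosD cosB; field.
rewrite mE; [|exact: gY|move=> *; exact: bounded_cosY].
rewrite [X in X @ _](_ : _ = fun e =>
    2^-1 * mean P (fun w => g (Ze e w) * cos (lin (fun i => k i + xi i) (Ze e w) + (q + p))) +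
    2^-1 * mean P (fun w => g (Ze e w) * cos (lin (fun i => k i - xi i) (Ze e w) + (q - p)))); last first.
  by apply/funext => e; rewrite mE; [|exact: gZ|move=> *; exact: bounded_cosZ].
by apply: cvgD; apply: cvgM; [exact: cvg_cst|exact: cg|exact: cvg_cst|exact: cg].
Qed.

Let good_angle (L : R) i g : good g -> good (fun z => angle L z i * g z).
Proof.
move=> gg; have := good_lin (2^-1) (2^-1) gg
  (good_cos (fun j => if j == i then L^-1 else 0) (- (pi / 2)) gg).
congr good; apply/funext => z.
have -> : lin (fun j => if j == i then L^-1 else 0) z = L^-1 * z i.
  rewrite /lin (bigD1 i)//= eqxx big1 ?addr0// => j /negbTE ->; exact: mul0r.
by rewrite cosBpihalf /angle; field.
Qed.

Let good_bernstein (L : R) i n (G : nat -> (I -> R) -> R) : (forall k, good (G k)) ->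
  good (fun z => bernstein (angle L z i) n (G^~ z)).
Proof.
elim: n G => [|n IH] G gG /=; first exact: gG.
have g1 := IH (fun k => G k.+1) (fun k => gG k.+1); have g2 := IH G gG.
have := good_lin 1 1 (good_angle L i g1) (good_lin 1 (-1) g2 (good_angle L i g2)).
by congr good; apply/funext => z; ring.
Qed.

Let good_smooth (L : R) n s F z : good (smooth L n s F z).
Proof.
elim: s z => [|i s IH] z /=; first exact: good_cst.
by apply: (@good_bernstein L i n (fun k => smooth L n s F (upd z i (node L n k)))).
Qed.

Variables (F : (I -> R) -> R) (M : R).
Hypothesis FM : forall z, `|F z| <= M.
Hypothesis unif : forall L eta : R, 0 < L -> 0 < eta -> exists2 delta : R, 0 < delta &
  forall z z', cube L z -> cube L z' -> (forall i, `|z i - z' i| <= delta) -> `|F z - F z'| <= eta.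

Let approx (L eta : R) : 0 < L -> 0 < eta -> exists g, [/\ good g, forall z, `|g z| <= M &
  forall z, cube L z -> `|g z - F z| <= eta].
Proof.
move=> L0 eta0; have N0 : (0 : R) < #|I|%:R + 1 by rewrite ltr_wpDl.
pose eta1 := eta / (2 * (#|I|%:R + 1)).
have eta10 : 0 < eta1 by rewrite divr_gt0// mulr_gt0.
have [delta0 d00 hF] := unif L0 eta10.
pose delta := delta0 / (4 * L).
have d0 : 0 < delta by rewrite divr_gt0// mulr_gt0.
have dE : 4 * L * delta = delta0 by rewrite /delta; field; rewrite gt_eqF.
have M0 : 0 <= M by apply: le_trans (FM (fun=> 0)); exact: normr_ge0.
have c0 : 2 * M / delta ^+ 2 * n.+1%:R^-1 @[n --> \oo] --> (0 : R).
  by rewrite -(mulr0 (2 * M / delta ^+ 2)); apply: cvgM; [exact: cvg_cst|exact: cvg_harmonic].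
have /cvgr0Pnorm_le/(_ _ eta10)[n _ /(_ n (leqnn n))/= hn] := c0.
exists (smooth L n.+1 (enum I) F (fun=> 0)); split.
- exact: good_smooth.
- by move=> z; exact: smooth_norm.
move=> z cz; have := @smooth_approx R I L M n.+1 L0 isT F z eta1 delta d0 (ltW eta10) FM.
rewrite dE => /(_ hF cz) /le_trans; apply.
apply: (@le_trans _ _ (#|I|%:R * (eta1 + eta1))).
  rewrite ler_wpM2l// lerD2l; apply: le_trans hn; apply: le_trans (ler_norm _).
  by rewrite invfM mulrA.
rewrite /eta1 (_ : _ * _ = eta * (#|I|%:R / (#|I|%:R + 1))); last by field; rewrite gt_eqF.
by apply: ler_piMr; [exact: ltW|rewrite ler_pdivrMr// mul1r lerDl].
Qed.

(** In particular the test function is measurable along [Z] and [Y]. *)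
Let cvg_approx : exists g : nat -> (I -> R) -> R, (forall n, good (g n)) /\
  forall z, g n z @[n --> \oo] --> F z.
Proof.
have /choice[g hg] : forall n : nat, exists g, [/\ good g, forall z, `|g z| <= M &
    forall z, cube n.+1%:R z -> `|g z - F z| <= n.+1%:R^-1].
  by move=> n; apply: approx; rewrite ?invr_gt0.
exists g; split=> [n|z]; first by have [] := hg n.
apply/cvgrPdist_le => e e0.
have [K hK] : exists K : nat, cube K%:R z.
  have z0 : 0 <= \sum_i `|z i| by apply: sumr_ge0.
  exists (Num.truncn (\sum_i `|z i|)).+1 => i.
  have /andP[_ h] := Num.Theory.truncn_itv z0; apply: le_trans (ltW h).
  by rewrite (bigD1 i)//= lerDl; apply: sumr_ge0.
have /cvgr0Pnorm_le/(_ _ e0)[K' _ hK'] := @cvg_harmonic R.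
exists (maxn K K') => // n /=; rewrite geq_max => /andP[Kn K'n].
have [_ _ h] := hg n; rewrite distrC; apply: le_trans (h z _) _.
  by move=> i; apply: le_trans (hK i) _; rewrite ler_nat ltnW.
exact: le_trans (ler_norm _) (hK' n K'n).
Qed.

Lemma bounded_test e : bounded_rv (fun w => F (Ze e w)).
Proof.
have [g [gg cg]] := cvg_approx; split; last by exists M => w; exact: FM.
apply: (@measurable_fun_cvg _ _ _ setT (fun n w => g n (Ze e w))).
  by move=> n; have [h _ _] := gg n; have [] := h e.
by move=> w _; exact: cg.
Qed.

Lemma bounded_test' : bounded_rv (fun w => F (Yv w)).
Proof.
have [g [gg cg]] := cvg_approx; split; last by exists M => w; exact: FM.
apply: (@measurable_fun_cvg _ _ _ setT (fun n w => g n (Yv w))).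
  by move=> n; have [_ h _] := gg n; have [] := h.
by move=> w _; exact: cg.
Qed.

Variable B : R.
Hypothesis hZ : forall e i, (sqn P (Z e i) <= B%:E)%E.
Hypothesis hY : forall i, (sqn P' (Y i) <= B%:E)%E.

(** Outside the cube of side [2 * L] some coordinate satisfies
    [1 <= z i ^+ 2 / L ^+ 2]. *)
Let approx_mean (d0 : measure_display) (O : measurableType d0) (Q : probability O R)
  (X : I -> O -> R) (g : (I -> R) -> R) (L eta : R) : 0 < L -> 0 <= eta ->
  (forall i, measurable_fun setT (X i)) -> (forall i, (sqn Q (X i) <= B%:E)%E) ->
  bounded_rv (fun w => g (X^~ w)) -> bounded_rv (fun w => F (X^~ w)) ->
  (forall z, `|g z| <= M) -> (forall z, cube L z -> `|g z - F z| <= eta) ->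
  `|mean Q (fun w => g (X^~ w)) - mean Q (fun w => F (X^~ w))| <=
    eta + 2 * M / L ^+ 2 * (#|I|%:R * B).
Proof.
move=> L0 eta0 mX hX bg bF gM gF; have bB := bounded_rvB bg bF.
have M0 : 0 <= M by apply: le_trans (FM (fun=> 0)); exact: normr_ge0.
have c0 : 0 <= 2 * M / L ^+ 2 by apply: divr_ge0; [exact: mulr_ge0|exact: sqr_ge0].
have le_w w : `|g (X^~ w) - F (X^~ w)| <= eta + \sum_i 2 * M / L ^+ 2 * X i w ^+ 2.
  have s0 : 0 <= \sum_i 2 * M / L ^+ 2 * X i w ^+ 2.
    by apply: sumr_ge0 => i _; rewrite mulr_ge0// sqr_ge0.
  have [cz|ncz] := pselect (cube L (X^~ w)).
    by apply: le_trans (gF _ cz) _; rewrite lerDl.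
  have [i hi] : exists i, L < `|X i w|.
    apply: contrapT => no; apply: ncz => i; rewrite leNgt; apply/negP => hi.
    by apply: no; exists i.
  apply: (@le_trans _ _ (2 * M)).
    by apply: le_trans (ler_normB _ _) _; rewrite mulr2n mulrDl mul1r lerD.
  rewrite -[leLHS]add0r; apply: lerD => //; rewrite (bigD1 i)//=.
  apply: (@le_trans _ _ (2 * M / L ^+ 2 * X i w ^+ 2)); last first.
    by rewrite lerDl; apply: sumr_ge0 => j _; rewrite mulr_ge0// sqr_ge0.
  rewrite -mulrA ler_peMr ?mulr_ge0// mulrC ler_pdivlMr ?exprn_gt0// mul1r.
  by rewrite -(real_normK (num_real (X i w))) ler_pXn2r ?nnegrE// ltW.
have mB : measurable_fun setT (fun w => g (X^~ w) - F (X^~ w)) by have [] := bB.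
have mS : measurable_fun setT (fun w => \sum_i 2 * M / L ^+ 2 * X i w ^+ 2).
  by apply: measurable_sum => i; apply: measurable_funM => //; exact: measurable_funX.
rewrite -meanB// -lee_fin /mean EFin_normr_Rintegral//; last exact: bounded_rv_integrable.
apply: le_trans (le_abse_integral _ _ _) _ => //; first exact/measurable_EFinP.
apply: (@le_trans _ _ (\int[Q]_w (eta%:E + (\sum_i 2 * M / L ^+ 2 * X i w ^+ 2)%:E))%E).
  apply: ge0_le_integral => //.
  - by apply: measurableT_comp => //; exact/measurable_EFinP.
  - by apply/measurable_EFinP; exact: measurable_funD.
  - by move=> w _; rewrite -EFinD lee_fin.
rewrite ge0_integralD//; last 2 first.
- by move=> w _; rewrite lee_fin; apply: sumr_ge0 => i _; rewrite mulr_ge0// sqr_ge0.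
- exact/measurable_EFinP.
rewrite integral_cst// [X in (_ * X)%E](probability_setT Q) mule1 EFinD; apply: leeD => //.
under eq_integral do rewrite -sumEFin.
rewrite ge0_integral_sum//; last 2 first.
- by move=> i; apply/measurable_EFinP; apply: measurable_funM => //; exact: measurable_funX.
- by move=> i w _; rewrite lee_fin mulr_ge0// sqr_ge0.
apply: (@le_trans _ _ (\sum_(i : I) (2 * M / L ^+ 2 * B)%:E)%E).
  apply: lee_sum => i _; under eq_integral do rewrite EFinM.
  rewrite ge0_integralZl//.
  - by rewrite [leRHS]EFinM; apply: lee_wpmul2l; [rewrite lee_fin|exact: hX].
  - exact: measurable_sqr.
  - by move=> w _; rewrite lee_fin sqr_ge0.
by rewrite sumEFin lee_fin sumr_const -[leLHS]mulr_natl mulrCA.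
Qed.

(** Levy's continuity theorem for families with bounded second moments. *)
Lemma cvg_mean_of_char : mean P (fun w => F (Ze e w)) @[e --> Fl] --> mean P' (fun w => F (Yv w)).
Proof.
apply/cvgrPdist_le => eps eps0.
have M0 : 0 <= M by apply: le_trans (FM (fun=> 0)); exact: normr_ge0.
have eps4 : 0 < eps / 6 by rewrite divr_gt0.
have [L L0 hL] : exists2 L : R, 0 < L & 2 * M / L ^+ 2 * (#|I|%:R * B) <= eps / 6.
  pose c := `|2 * M * (#|I|%:R * B)| + 1.
  have c1 : 1 <= c by rewrite lerDr.
  set m := Num.min (eps / 6) 1; have m0 : 0 < m by rewrite lt_min eps4 ltr01.
  have m1 : m <= 1 by rewrite ge_min lexx orbT.
  have m2 : m <= eps / 6 by rewrite ge_min lexx.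
  have c0 : 0 < c by rewrite (lt_le_trans ltr01).
  exists (c / m); first exact: divr_gt0.
  have -> : 2 * M / (c / m) ^+ 2 * (#|I|%:R * B) = m ^+ 2 * (2 * M * (#|I|%:R * B) / c ^+ 2).
    by field; rewrite !gt_eqF.
  apply: le_trans m2; rewrite -[leRHS]mulr1 expr2 -mulrA ler_pM2l//.
  apply: (@le_trans _ _ (m * 1)); last by rewrite mulr1.
  rewrite ler_pM2l// ler_pdivrMr ?exprn_gt0// mul1r expr2.
  apply: (@le_trans _ _ c); last by rewrite ler_peMr// ltW.
  by apply: le_trans (ler_norm _) _; rewrite lerDl.
have [g [gg gM gF]] := approx L0 eps4; have [gZ gY cg] := gg.
have h2 := @approx_mean _ _ P' Y g L _ L0 (ltW eps4) mY hY gY bounded_test' gM gF.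
have g0 : mean P (fun w => g (Ze e w)) @[e --> Fl] --> mean P' (fun w => g (Yv w)).
  have cos1 z : cos (lin (fun=> 0) z + 0) = 1 :> R.
    by rewrite addr0 /lin big1 ?cos0// => i _; rewrite mul0r.
  have := cg (fun=> 0) 0; under eq_fun do under eq_fun do rewrite cos1 mulr1.
  by under [in X in _ --> X]eq_fun do rewrite cos1 mulr1.
move/cvgrPdist_le : g0 => /(_ _ eps4); apply: filterS => e he.
have h1 := @approx_mean _ _ P (Z e) g L _ L0 (ltW eps4) (mZ e) (hZ e) (gZ e) (bounded_test e) gM gF.
set a := mean P (fun w => F (Ze e w)) in h1 *; set b := mean P' (fun w => F (Yv w)) in h2 *.
set a' := mean P (fun w => g (Ze e w)) in h1 he; set b' := mean P' (fun w => g (Yv w)) in h2 he.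
rewrite (_ : b - a = - (b' - b) + (b' - a') + (a' - a)); last by ring.
apply: le_trans (ler_normD _ _) _; have := ler_normD (- (b' - b)) (b' - a').
by rewrite normrN; lra.
Qed.

End levy.

(** * Joint convergence *)

Section fdd.
Context (R : realType).
Context (d : measure_display) (Omega : measurableType d) (P : probability Omega R).
Context (d' : measure_display) (Omega' : measurableType d') (P' : probability Omega' R).
Variables (N : R -> Omega -> nat) (W W' : R -> Omega' -> R) (theta : R).
Hypothesis poissonN : standard_poisson_process P N.
Hypothesis brownianW : standard_brownian_motion P' W.
Hypothesis brownianW' : standard_brownian_motion P' W'.
Hypothesis indepWW' : independent_processes P' W W'.
Hypothesis theta01 : 0 < theta < pi \/ pi < theta < 2 * pi.
Local Notation mu := (@lebesgue_measure R).
Local Notation allR := (setT : set (measurableTypeR R)).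

Let theta_lt : 0 < theta < 2 * pi.
Proof. by have := pi_gt0 R; case: theta01 => /andP[h1 h2] h3; apply/andP; split; lra. Qed.

Let sin_half_neq0 : sin (theta / 2) != 0.
Proof.
have /andP[t0 t2] := theta_lt; rewrite gt_eqF//; apply: sin_gt0_pi.
by rewrite divr_gt0//= ltr_pdivrMr// mulrC.
Qed.

Let sin_neq0 : sin theta != 0.
Proof.
case: theta01 => [h|/andP[h1 h2]]; first by rewrite gt_eqF// sin_gt0_pi.
rewrite -[theta](subrK pi) sinDpi oppr_eq0 gt_eqF// sin_gt0_pi// subr_gt0 h1/=.
by rewrite ltrBlDr -mulr2n -mulr_natl.
Qed.

Let cos_lt1 : cos theta < 1.
Proof.
rewrite cos_half ltrBlDr ltrDl mulr_gt0//.
by rewrite exprn_even_gt0//= sin_half_neq0.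
Qed.

(** The index [i] stands for one coordinate of the pair: [side i] tells which
    of the two components it belongs to, and [h i] is its kernel. *)
Context (I : finType).
Variables (side : I -> bool) (h : I -> R -> R).
Hypothesis hh : forall i, L2_halfline (h i).

Let al i : R := if side i then 1 else 0.
Let be i : R := if side i then 0 else 1.
Let trig i : R -> R := if side i then cos else sin.
Let V i := if side i then W else W'.

Definition kac_coord (eps : R) (i : I) : Omega -> R := kac_stroock P N (trig i) theta eps (h i).

Definition wiener_coord (i : I) : Omega' -> R := wiener_integral P' (V i) (h i).

Let trigE i : trig i = psi (al i) (be i).
Proof.
by apply/funext => x; rewrite /trig /psi /al /be; case: (side i); rewrite mul1r mul0r ?addr0 ?add0r.
Qed.

Let albe i : `|al i| + `|be i| <= 1.
Proof. by rewrite /al /be; case: (side i); rewrite normr0 normr1 ?addr0 ?add0r. Qed.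

Let brownianV i : standard_brownian_motion P' (V i).
Proof. by rewrite /V; case: (side i). Qed.

Let common_grid (c : R) : 0 < c -> exists2 m, (0 < m)%N & exists a : I -> nat -> R,
  forall i, (sqn mu ((h i \- grid_fun m (m * m) (a i))%R \_ `[0%R, +oo[) <= c%:E)%E.
Proof.
move=> c0; have /choice[k hk] : forall i, exists k0, forall k, (k0 <= k)%N -> (0 < k)%N /\
    exists a, (sqn mu ((h i \- grid_fun k (k * k) a)%R \_ `[0%R, +oo[) <= c%:E)%E.
  by move=> i; exact: grid_fun_dense.
pose m := (\max_i k i).+1.
have km i : (k i <= m)%N by rewrite ltnW// ltnS leq_bigmax.
exists m => //.
have /choice[a ha] : forall i, exists a, (sqn mu ((h i \- grid_fun m (m * m) a)%R \_ `[0%R, +oo[) <= c%:E)%E.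
  by move=> i; have [_] := hk i m (km i).
by exists a.
Qed.

Let kac_approx : exists2 C : R, 0 <= C & forall eps i m a (c : R), 0 < eps -> (0 < m)%N -> 0 < c ->
  (sqn mu ((h i \- grid_fun m (m * m) a)%R \_ `[0%R, +oo[) <= c%:E)%E ->
  [/\ measurable_fun setT (kac_coord eps i),
   (sqn P (fun w => kac_coord eps i w - wave_integral N theta m (m * m)
       (fun j => al i * a j) (fun j => be i * a j) eps w)%R <= (C * c)%:E)%E &
   (sqn P (wave_integral N theta m (m * m) (fun j => al i * a j)%R (fun j => be i * a j)%R eps) <=
     (C * (m%:R^-1 * \sum_(j < m * m) a j ^+ 2))%:E)%E].
Proof.
have [C C0 hC] := wave_integral_sqn poissonN cos_lt1.
exists (4 * C + 1) => [|eps i m a c e0 m0 c0 hc]; first by rewrite addr_ge0// mulr_ge0.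
have [] := kac_stroock_approx poissonN (albe i) e0 C0 (fun m L a b m0 => hC m L a b eps m0 e0) (hh i) m0 c0 hc.
rewrite -trigE => mk sk; split => //.
apply: le_trans (hC _ _ _ _ _ m0 e0) _; rewrite lee_fin.
have s0 : 0 <= m%:R^-1 * \sum_(j < m * m) a j ^+ 2.
  by rewrite mulr_ge0 ?invr_ge0//; apply: sumr_ge0 => j _; exact: sqr_ge0.
rewrite (eq_bigr (fun j : 'I_(m * m) => a j ^+ 2)).
  by rewrite ler_wpM2r//; lra.
move=> j _; rewrite /al /be; case: (side i).
  by rewrite mul1r mul0r expr0n addr0.
by rewrite mul1r mul0r expr0n add0r.
Qed.

Let wiener_approx i m a (c : R) : (0 < m)%N -> 0 < c ->
  (sqn mu ((h i \- grid_fun m (m * m) a)%R \_ `[0%R, +oo[) <= c%:E)%E ->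
  measurable_fun setT (wiener_coord i) /\
  (sqn P' (fun w => wiener_coord i w - step_integral (V i) (grid_data m (m * m) a) w)%R <= (10 * c)%:E)%E.
Proof. exact: wiener_integral_approx. Qed.

Lemma measurable_kac_coord eps i : 0 < eps -> measurable_fun setT (kac_coord eps i).
Proof.
move=> e0; have [m m0 [a ha]] := common_grid ltr01; have [C C0 hC] := kac_approx.
by have [] := hC eps i m (a i) 1 e0 m0 ltr01 (ha i).
Qed.

Lemma measurable_wiener_coord i : measurable_fun setT (wiener_coord i).
Proof.
have [m m0 [a ha]] := common_grid ltr01.
by have [] := wiener_approx m0 ltr01 (ha i).
Qed.

(** Uniform second moments provide tightness. *)
Lemma sqn_coord_bounded : exists B : R, (forall eps i, 0 < eps -> (sqn P (kac_coord eps i) <= B%:E)%E) /\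
  (forall i, (sqn P' (wiener_coord i) <= B%:E)%E).
Proof.
have [m m0 [a ha]] := common_grid ltr01; have [C C0 hC] := kac_approx.
pose q i : R := m%:R^-1 * \sum_(j < m * m) a i j ^+ 2.
have q0 i : 0 <= q i.
  by rewrite mulr_ge0 ?invr_ge0//; apply: sumr_ge0 => j _; exact: sqr_ge0.
pose Q := \sum_i q i.
have qQ i : q i <= Q by rewrite /Q (bigD1 i)//= lerDl; apply: sumr_ge0.
exists (2 * (C + 10) + 2 * ((C + 1) * Q)); split=> [eps i e0|i].
  have [mk sk sw] := hC eps i m (a i) 1 e0 m0 ltr01 (ha i).
  set w_ := wave_integral _ _ _ _ _ _ _ in sk sw.
  have mw : measurable_fun setT w_ by exact: (measurable_wave_integral poissonN).
  have -> : kac_coord eps i = fun w => (kac_coord eps i w - w_ w) + w_ w.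
    by apply/funext => w; rewrite subrK.
  apply: le_trans (sqnD _ (measurable_funB mk mw) mw) _; rewrite [leRHS]EFinD; apply: leeD.
    rewrite [leRHS]EFinM; apply: lee_wpmul2l => //; apply: le_trans sk _; rewrite lee_fin; lra.
  rewrite [leRHS]EFinM; apply: lee_wpmul2l => //; apply: le_trans sw _; rewrite lee_fin.
  by rewrite -/(q i); apply: ler_pM => //; rewrite ?lerDl// qQ.
have [mk sk] := wiener_approx m0 ltr01 (ha i).
set s_ := step_integral _ _ in sk.
have wf : step_wf (grid_data m (m * m) (a i)) by exact: grid_data_wf.
have ms : measurable_fun setT s_ by exact: (measurable_step_integral (brownianV i)).
have -> : wiener_coord i = fun w => (wiener_coord i w - s_ w) + s_ w.
  by apply/funext => w; rewrite subrK.
apply: le_trans (sqnD _ (measurable_funB mk ms) ms) _; rewrite [leRHS]EFinD; apply: leeD.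
  rewrite [leRHS]EFinM; apply: lee_wpmul2l => //; apply: le_trans sk _; rewrite lee_fin; lra.
rewrite [leRHS]EFinM; apply: lee_wpmul2l => //.
rewrite (step_isometry (brownianV i) wf) [X in (sqn _ X <= _)%E](_ : _ = grid_fun m (m * m) (a i))//.
rewrite sqn_grid_fun// big_mkord lee_fin -/(q i); apply: le_trans (qQ i) _.
by rewrite ler_peMl// ?lerDr//; exact: le_trans (q0 i) (qQ i).
Qed.

(** Both sides are close in L2, uniformly in [eps], to their values for the
    step kernels of a common grid, whose characteristic functions converge. *)
Lemma coord_char_cvg (xi : I -> R) (p : R) :
  mean P (fun w => cos (\sum_i xi i * kac_coord eps i w + p)) @[eps --> 0^'+] -->
  mean P' (fun w => cos (\sum_i xi i * wiener_coord i w + p)).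
Proof.
apply/cvgrPdist_le => e e0; have e3 : 0 < e / 3 by rewrite divr_gt0.
have [C C0 hC] := kac_approx.
have [s sumE] : exists s : seq I, forall F : I -> R, \sum_i F i = \sum_(i <- s) F i.
  by exists (enum I) => F; rewrite big_enum.
pose K := 2 ^+ size s * (\sum_(i <- s) xi i ^+ 2) * (C + 10) + 1.
have S0 : 0 <= \sum_(i <- s) xi i ^+ 2 by apply: sumr_ge0 => i _; exact: sqr_ge0.
have K0 : 0 < K.
  apply: ltr_wpDl => //; apply: mulr_ge0; last exact: addr_ge0.
  by apply: mulr_ge0 => //; exact: exprn_ge0.
pose c := (e / 3) ^+ 2 / K.
have c0 : 0 < c by rewrite divr_gt0// exprn_gt0.
have [m m0 [a ha]] := common_grid c0.
pose A j := \sum_(i <- s) xi i * (al i * a i j).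
pose A' j := \sum_(i <- s) xi i * (be i * a i j).
have small (d0 : measure_display) (O : measurableType d0) (Q : probability O R) (X X' : I -> O -> R) (D : R) :
    0 <= D <= C + 10 ->
    (forall i, measurable_fun setT (X i)) -> (forall i, measurable_fun setT (X' i)) ->
    (forall i, sqn Q (fun w => X i w - X' i w)%R <= (D * c)%:E)%E ->
    (sqn Q (fun w => \sum_(i <- s) xi i * X i w - \sum_(i <- s) xi i * X' i w)%R <= ((e / 3) ^+ 2)%:E)%E.
  move=> /andP[D0 DC] mX mX' hX.
  rewrite (_ : (fun w => _) = fun w => \sum_(i <- s) xi i * (X i w - X' i w)); last first.
    by apply/funext => w; rewrite -sumrB; apply: eq_bigr => i _; rewrite mulrBr.
  have mB i : measurable_fun setT (fun w => X i w - X' i w) by exact: measurable_funB.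
  apply: (@le_trans _ _ (2 ^+ size s * \sum_(i <- s) xi i ^+ 2 * (D * c))%:E).
    apply: sqn_sum => i; first exact: measurable_funM.
    by rewrite sqnZ// [leRHS]EFinM; apply: lee_wpmul2l => //; rewrite lee_fin sqr_ge0.
  rewrite lee_fin -mulr_suml mulrA.
  have -> : (e / 3) ^+ 2 = K * c by rewrite /c [RHS]mulrC divfK// gt_eqF.
  rewrite mulrA ler_wpM2r ?(ltW c0)// /K -[leLHS]addr0 lerD//.
  by rewrite ler_wpM2l// mulr_ge0// exprn_ge0.
pose wv eps i := wave_integral N theta m (m * m) (fun j => al i * a i j) (fun j => be i * a i j) eps.
pose st i := step_integral (V i) (grid_data m (m * m) (a i)).
have wvE eps w : 0 < eps -> \sum_(i <- s) xi i * wv eps i w =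
    wave_integral N theta m (m * m) A A' eps w.
  by move=> eps0; rewrite (wave_integral_lin poissonN)//.
have stE w : \sum_(i <- s) xi i * st i w =
    step_integral W (grid_data m (m * m) A) w + step_integral W' (grid_data m (m * m) A') w.
  rewrite /step_integral !big_map -big_split/=.
  under eq_bigr do rewrite /st /step_integral big_map mulr_sumr/=.
  rewrite exchange_big/=; apply: eq_bigr => j _.
  rewrite /A /A' !mulr_suml -big_split/=; apply: eq_bigr => i _.
  by rewrite /V /al /be; case: (side i); ring.
have mst i : measurable_fun setT (st i).
  by apply: (measurable_step_integral (brownianV i)); exact: grid_data_wf.
have hY : `|mean P' (fun w => cos (\sum_i xi i * wiener_coord i w + p)) -
    expR (- (2^-1 * (m%:R^-1 * \sum_(j < m * m) (A j ^+ 2 + A' j ^+ 2)))) * cos p| <= e / 3.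
  rewrite -(step_integral_char brownianW brownianW' indepWW' _ _ _ _ m0).
  under eq_fun do rewrite sumE; under [in X in _ - X]eq_fun do rewrite -stE.
  apply: mean_cos_dist => //.
  - by apply: measurable_sum => i; apply: measurable_funM => //; exact: measurable_wiener_coord.
  - by apply: measurable_sum => i; exact: measurable_funM.
  apply: (small _ _ P' wiener_coord st 10) => //; first by rewrite lerDr C0 andbT.
    by move=> i; exact: measurable_wiener_coord.
  by move=> i; have [] := wiener_approx m0 c0 (ha i).
have [C' C'0 hchar] := wave_integral_char poissonN (m * m) A A' p sin_half_neq0 sin_neq0 m0.
near=> eps.
have eps0 : 0 < eps by near: eps; exact: nbhs_right_gt.
have eps1 : eps <= 1 by near: eps; exact: nbhs_right_le.
have epsC : eps <= e / 3 / (C' + 1).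
  by near: eps; apply: nbhs_right_le; rewrite divr_gt0// ltr_wpDl.
have hX : `|mean P (fun w => cos (\sum_i xi i * kac_coord eps i w + p)) -
    mean P (fun w => cos (wave_integral N theta m (m * m) A A' eps w + p))| <= e / 3.
  under eq_fun do rewrite sumE; under [in X in _ - X]eq_fun do rewrite -wvE//.
  have mw i : measurable_fun setT (wv eps i) by exact: (measurable_wave_integral poissonN).
  apply: mean_cos_dist => //.
  - by apply: measurable_sum => i; apply: measurable_funM => //; exact: measurable_kac_coord.
  - by apply: measurable_sum => i; exact: measurable_funM.
  have C10 : 0 <= C <= C + 10 by rewrite C0/= lerDl.
  apply: (small _ _ P (kac_coord eps) (wv eps) C C10) => //.
    by move=> i; exact: measurable_kac_coord.
  by move=> i; have [] := hC eps i m (a i) c eps0 m0 c0 (ha i).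
have e01 : 0 < eps <= 1 by rewrite eps0.
have hW := hchar eps e01.
have hWe : C' * eps <= e / 3.
  apply: le_trans (ler_wpM2l C'0 epsC) _; rewrite mulrCA; apply: ler_piMr; first exact: ltW.
  by rewrite ler_pdivrMr ?ltr_wpDl// mul1r lerDl.
set x := mean P' _ in hY *; set y := mean P _ in hX *.
set x' := expR _ * _ in hY hW; set y' := mean P _ in hX hW.
rewrite (_ : x - y = (x - x') - (y' - x') - (y - y')); last by ring.
apply: le_trans (ler_normB _ _) _; have := ler_normB (x - x') (y' - x'); lra.
Unshelve. all: by end_near. Qed.

End fdd.

(** Cubes of row vectors are compact, so [heine] applies. *)
Lemma row_pair_unif (R : realType) n (phi : 'rV[R]_n * 'rV[R]_n -> R) : continuous phi ->
  forall L eta : R, 0 < L -> 0 < eta -> exists2 delta : R, 0 < delta &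
  forall z z' : 'I_n + 'I_n -> R, cube L z -> cube L z' -> (forall i, `|z i - z' i| <= delta) ->
  `|phi (\row_j z (inl j), \row_j z (inr j)) - phi (\row_j z' (inl j), \row_j z' (inr j))| <= eta.
Proof.
move=> cphi L eta L0 eta0.
pose box := [set v : 'rV[R]_n | forall i, `[- L, L]%classic (v ord0 i)].
have cbox : compact box by apply: (@rV_compact R n (fun=> `[- L, L]%classic)) => i; exact: segment_compact.
have [delta d0 hd] := heine (compact_setX cbox cbox) cphi eta0.
exists (delta / 2); first by rewrite divr_gt0.
move=> z z' cz cz' zz; apply: hd.
  by split => i /=; rewrite mxE in_itv/= -ler_norml; exact: cz.
have bz i : ball (z i) delta (z' i).
  by rewrite /ball/= (le_lt_trans (zz i))// ltr_pdivrMr// ltr_pMr// ltr1n.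
by split; split => // i j; rewrite !mxE; exact: bz.
Qed.

Theorem theorem2p1 (R : realType)
  (d : measure_display) (Omega : measurableType d) (P : probability Omega R)
  (d' : measure_display) (Omega' : measurableType d')
  (P' : probability Omega' R)
  (T : R) (f g : R -> R -> R) (theta : R)
  (N : R -> Omega -> nat) (W W' : R -> Omega' -> R) :
  0 < T ->
  (forall t, 0 <= t <= T -> L2_halfline (f t)) ->
  (forall t, 0 <= t <= T -> L2_halfline (g t)) ->
  0 < theta < pi \/ pi < theta < 2 * pi ->
  standard_poisson_process P N ->
  standard_brownian_motion P' W ->
  standard_brownian_motion P' W' ->
  independent_processes P' W W' ->
  fdd_pair_cvg P P' `[0, T] 0^'+
    (fun eps t => kac_stroock P N cos theta eps (f t))
    (fun eps t => kac_stroock P N sin theta eps (g t))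
    (fun t => wiener_integral P' W (f t))
    (fun t => wiener_integral P' W' (g t)).
Proof.
move=> _ hf hg theta01 poissonN brW brW' indep n t ht phi cphi [M hM].
pose side (i : 'I_n + 'I_n) := if i is inl _ then true else false.
pose h (i : 'I_n + 'I_n) := match i with inl j => f (t j) | inr j => g (t j) end.
have ht' j : 0 <= t j <= T by have := ht j; rewrite /= in_itv.
have hh i : L2_halfline (h i) by case: i => j; [exact: hf|exact: hg].
apply/cvg_at_rightP => u [u0 cu].
pose Z k := kac_coord P N theta side h (u k).
pose Y := wiener_coord P' W W' side h.
have [B [BZ BY]] := sqn_coord_bounded poissonN brW brW' theta01 side hh.
have mZ k i : measurable_fun setT (Z k i) by exact: measurable_kac_coord.
have mY i : measurable_fun setT (Y i) by exact: measurable_wiener_coord.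
have char_cvg xi p : mean P (fun w => cos (\sum_i xi i * Z k i w + p)) @[k --> \oo] -->
    mean P' (fun w => cos (\sum_i xi i * Y i w + p)).
  have /cvg_at_rightP := coord_char_cvg poissonN brW brW' indep theta01 (side := side) hh (xi := xi) (p := p).
  by move=> /(_ u (conj u0 cu)).
pose F (z : 'I_n + 'I_n -> R) := phi (\row_j z (inl j), \row_j z (inr j)).
exact: (cvg_mean_of_char mZ mY char_cvg (F := F) (fun z => hM _) (row_pair_unif cphi) (fun k i => BZ _ i (u0 k)) BY).
Qed.
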